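(* Let $n$ be a square-free positive integer and let $\Gamma=PSL_2(\mathbb Z)$. Then $$n\,\big(\hat T(n)Q^{(-1)}_{\Gamma}\big)=\sum_{h\| n}Q^{(-n/h^2)}_{B(h\mathbb Z)\backslash\Gamma},$$ where the sum is over the exact divisors $h$ of $n$, $Q^{(-1)}_\Gamma$ is the modified Rademacher sum of weight $0$ and order $-1$ associated to $\Gamma$, and $Q^{(-n/h^2)}_{B(h\mathbb Z)\backslash\Gamma}$ is the modified fractional Rademacher sum of weight $0$ and order $-n/h^2$ associated to the set of cosets $B(h\mathbb Z)\backslash\Gamma=\{B(h\mathbb Z)\gamma\mid\gamma\in\Gamma\}$.
   Context: $\mathbb H$ is the upper half plane, $e(z)=\exp(2\pi i z)$. An exact divisor of $n$ is a positive divisor $h$ with $(h,n/h)=1$, written $h\|n$. For a positive integer $h$, $B(h\mathbb Z)$ is the group generated by $z\mapsto z+h$. For $\gamma\in\Gamma=PSL_2(\mathbb Z)$ represented by $\begin{pmatrix}a&b\\c&d\end{pmatrix}\in SL_2(\mathbb Z)$ put $c(\gamma)=|c|$, $d(\gamma)=|d|$; $\gamma$ acts by Möbius transformations. Hecke operator: for a modular function $f$ for $\Gamma$, $(\hat T(n)f)(z)=\frac1n\sum_{ad=n,\ 0\le b<d}f\big(\frac{az+b}{d}\big)$. Weight $0$ (fractional) modified Rademacher sums: let $\mu=-g/h$ with $g,h$ coprime positive integers (for $n$ square-free and $h\|n$, $n/h^2=(n/h)/h$ is in lowest terms). For $z\in\mathbb H$, $\Re(s)>1$, with principal branches of powers and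 $x^{(s)}=x^s/\Gamma(s+1)$ ($\Gamma(\cdot)$ the Gamma function), put $$T_\gamma^{(\mu)}(z,s)=e(\mu\gamma\infty)\sum_{k\ge0}(2\pi i(\mu\gamma z-\mu\gamma\infty))^{(k+s)}$$ if $c(\gamma)\neq0$, $T_\gamma^{(\mu)}(z,s)=e(\mu\gamma z)$ if $c(\gamma)=0$; and $$T_{0,\gamma}^{(\mu)}(s)=e(\mu\gamma\infty)\Big[(2\pi i(\mu\gamma 0-\mu\gamma\infty))^{(s)}-e(s/2)(2\pi i(\mu\gamma\infty-\mu\gamma0))^{(s)}\Big]$$ if $c(\gamma)d(\gamma)\ne0$, $T_{0,\gamma}^{(\mu)}(s)=0$ otherwise. These depend only on $B(h\mathbb Z)\gamma$, and $$Q^{(\mu)}_{B(h\mathbb Z)\backslash\Gamma}(z)=\lim_{s\to1^+}\sum_{B(h\mathbb Z)\gamma\in B(h\mathbb Z)\backslash\Gamma}\big(T_\gamma^{(\mu)}(z,s)-T_{0,\gamma}^{(\mu)}(s)\big).$$ For $h=1$ this is the modified Rademacher sum $Q^{(\mu)}_\Gamma$ of weight $0$ and integral order $\mu<0$. *)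

(* Defs.v *)
From HB Require Import structures.
From mathcomp Require Import all_boot all_order all_algebra.
From mathcomp Require Import all_classical all_reals all_analysis.
From mathcomp Require Import complex.
From mathcomp.analysis Require Import showcase.summability.

Set Implicit Arguments.
Unset Strict Implicit.
Unset Printing Implicit Defensive.

Import Order.TTheory GRing.Theory Num.Theory numFieldNormedType.Exports.

Local Open Scope classical_set_scope.
Local Open Scope ring_scope.
Local Open Scope complex_scope.

(* MathComp-Analysis equips R[i]^o (the field R[i] as a module over itself)
   with the topology of the complex modulus; functions whose limits or sums are
   taken are therefore given the codomain R[i]^o. *)

Definition cexp (R : realType) (z : R[i]) : R[i] :=
  (expR (complex.Re z))%:C * (cos (complex.Im z) +i* sin (complex.Im z)).

(* Principal argument, with values in ]-pi, pi] for z != 0. *)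
Definition carg (R : realType) (z : R[i]) : R :=
  let t := acos (complex.Re z / complex.Re `|z|) in
  if 0 <= complex.Im z then t else - t.

Definition cln (R : realType) (z : R[i]) : R[i] :=
  ln (complex.Re `|z|) +i* carg z.

(* Principal branch of z ^ s; only meaningful for z != 0. *)
Definition cpow (R : realType) (z s : R[i]) : R[i] := cexp (s * cln z).

(* Euler's integral of t ^ (s - 1) * exp (- t) over t > 0, split into real and
   imaginary parts; only meaningful for Re s > 0. *)
Definition cgamma (R : realType) (s : R[i]) : R[i] :=
  (\int[lebesgue_measure]_(t in `]0, +oo[%classic)
      (t `^ (complex.Re s - 1) * expR (- t) * cos (complex.Im s * ln t)))
  +i*
  (\int[lebesgue_measure]_(t in `]0, +oo[%classic)
      (t `^ (complex.Re s - 1) * expR (- t) * sin (complex.Im s * ln t))).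

(* x^{(s)} = x^s / Gamma(s + 1). *)
Definition divpow (R : realType) (x s : R[i]) : R[i] :=
  cpow x s / cgamma (s + 1).

Definition twopii (R : realType) : R[i] := 0 +i* (pi *+ 2).

(* e(z) = exp(2 pi i z). *)
Definition e1 (R : realType) (z : R[i]) : R[i] := cexp (twopii R * z).

Definition mobius (R : realType) (g : 'M[int]_2) (z : R[i]) : R[i] :=
  ((g 0 0)%:~R * z + (g 0 1)%:~R) / ((g 1 0)%:~R * z + (g 1 1)%:~R).

(* The image of the cusp oo; only meaningful when the lower left entry is
   nonzero. *)
Definition mobius_oo (R : realType) (g : 'M[int]_2) : R[i] :=
  (g 0 0)%:~R / (g 1 0)%:~R.

Definition radT (R : realType) (mu : R) (g : 'M[int]_2) (z s : R[i]) : R[i] :=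
  if g 1 0 == 0 then e1 (mu%:C * mobius g z)
  else e1 (mu%:C * mobius_oo R g) *
       limn (series (fun k : nat =>
         (divpow (twopii R * (mu%:C * mobius g z - mu%:C * mobius_oo R g))
                 (k%:R + s) : R[i]^o))).

Definition radT0 (R : realType) (mu : R) (g : 'M[int]_2) (s : R[i]) : R[i] :=
  if g 1 0 * g 1 1 == 0 then 0
  else e1 (mu%:C * mobius_oo R g) *
       (divpow (twopii R * (mu%:C * mobius g 0 - mu%:C * mobius_oo R g)) s
        - e1 (s / 2%:R) *
          divpow (twopii R * (mu%:C * mobius_oo R g - mu%:C * mobius g 0)) s).

Definition SL2Z : set 'M[int]_2 := [set g | \det g = 1].

Definition translation (m : int) : 'M[int]_2 := 1%:M + m *: delta_mx 0 1.

(* The coset B(hZ)g in PSL_2(Z), represented by its full preimage in SL_2(Z):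
   both signs of each representing matrix are included. *)
Definition Bcoset (h : nat) (g : 'M[int]_2) : set 'M[int]_2 :=
  [set x | exists k : int, x = translation (h%:Z * k) *m g \/
                           x = - (translation (h%:Z * k) *m g)].

Definition Bcosets (h : nat) : set (set 'M[int]_2) :=
  [set Bcoset h g | g in SL2Z].

(* A chosen element of the coset; for mu = - g / h the summands below do not
   depend on the choice. *)
Definition coset_repr (X : set 'M[int]_2) : 'M[int]_2 := xget 1%:M X.

(* Unordered sum over B(hZ)\Gamma: the limit of the partial sums along the
   finite sets of cosets. *)
Definition radSum (R : realType) (mu : R) (h : nat) (z s : R[i]) : R[i]^o :=
  sum (fun X : set_type (Bcosets h) =>
    (radT mu (coset_repr (val X)) z s - radT0 mu (coset_repr (val X)) s
       : R[i]^o)).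

Definition radQ (R : realType) (mu : R) (h : nat) (z : R[i]) : R[i] :=
  lim (radSum mu h z s%:C @[s --> (1 : R)^'+]).

Definition hecke (R : realType) (n : nat) (f : R[i] -> R[i]) (z : R[i]) : R[i] :=
  n%:R^-1 *
  \sum_(d <- divisors n) \sum_(b < d) f (((n %/ d)%:R * z + b%:R) / d%:R).

Definition squarefree (n : nat) : Prop :=
  (0 < n)%N /\ forall p : nat, prime p -> ~~ (p ^ 2 %| n)%N.

Definition exact_divisor (n h : nat) : bool := (h %| n)%N && coprime h (n %/ h).

(* Main.v *)
(* For s > 1, listing the cosets B(Z)g by the lower row (c, d) of g with c >= 0
   turns the summand sum of order -m at level one into e(-mz) plus the absolutely
   convergent sum S_m(z, s) of e(-m d^-1 / c) Phi(m / (c (c z + d)), s) over c > 0,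
   minus kappa_m(s) L_m(s), where L_m(s) is the sum of e(m d^-1 / c) (c d)^(-s) over
   c, d > 0 and kappa_m vanishes at s = 1.
   Multiplying lower rows by the matrices of the Hecke operator gives
   S_n(z, s) = sum of S_1((alpha z + b) / delta, s), already for s > 1.
   The residue of L_m at 1 is rho_m + conj rho_m, where rho_m is the sum over c of
   the Ramanujan sums of m modulo c divided by c^2; since m rho_m = sigma(m) rho_1,
   the limits of kappa_m L_m are compatible with the Hecke operator as well.  The
   existence of all limits at s = 1 rests on a power saving for Kloosterman sums,
   obtained from their fourth moment.
   For an exact divisor h > 1 of n, z |-> z + 1 permutes the cosets of B(hZ) and
   multiplies every summand by e(-n/h^2), which is not 1, so the term of h is 0. *)
From HB Require Import structures.
From mathcomp Require Import all_boot all_order all_algebra.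
From mathcomp Require Import all_classical all_reals all_analysis.
From mathcomp Require Import complex finmap lra ring zify.
From mathcomp Require cyclic.
From mathcomp.analysis Require Import showcase.summability.
Require Import Defs.
Set Implicit Arguments.
Unset Strict Implicit.
Unset Printing Implicit Defensive.
Import Order.TTheory GRing.Theory Num.Theory numFieldNormedType.Exports.
Local Open Scope classical_set_scope.
Local Open Scope ring_scope.
Local Open Scope complex_scope.

(** * Limits and unordered sums of complex numbers *)

Section norm.
Variable R : realType.
Implicit Types z w : R[i].

(** At s = 1 the terms over lower rows (c, d) are only of size 1 / (c |c z + d|), which is not
    summable, so a majorant uniform in s > 1 must come from cancellation in d. Splitting e(m d^-1 /
    c) into its mean over d and a difference in d, and summing by parts, gains a power of d at the
    price of an incomplete Kloosterman sum of size E(c). What has to converge is essentially the sum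
    of E(c) / c^2, where the trivial bound, of order c, just fails and a power saving is enough. The
    fourth moment supplies one because its system of equations, over any finite commutative ring,
    reduces to the vanishing of one product of three factors. When d runs over all integers, the
    mean telescopes away up to a summable error, so the [radT] part simply has a limit. In the
    quadrant c, d > 0 the mean survives and produces the pole of L_m, cancelled by the zero of
    kappa_m; there only the limits are compared. *)

Lemma complex_ext z w : complex.Re z = complex.Re w -> complex.Im z = complex.Im w -> z = w.
Proof. by case: z w => [? ?] [? ?] /= -> ->. Qed.

(* The modulus as an element of R; `|z| lies in R[i]. *)
Definition nC z : R := complex.Re `|z|.

Lemma nCE z : `|z| = (nC z)%:C.
Proof. by rewrite /nC normc_def. Qed.

Lemma nC_ge0 z : 0 <= nC z.
Proof. by rewrite -ler0c -nCE normr_ge0. Qed.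

Lemma nC0 : nC 0 = 0 :> R. Proof. by rewrite /nC normr0. Qed.

Lemma nC_eq0 z : (nC z == 0) = (z == 0).
Proof. by rewrite -[RHS]normr_eq0 nCE -(inj_eq (@complexI R)). Qed.

Lemma nCD z w : nC (z + w) <= nC z + nC w.
Proof. by rewrite -lecR rmorphD /= -!nCE ler_normD. Qed.

Lemma nCM z w : nC (z * w) = nC z * nC w.
Proof. by apply: complexI; rewrite rmorphM /= -!nCE normrM. Qed.

Lemma nCV z : nC z^-1 = (nC z)^-1.
Proof. by apply: complexI; rewrite fmorphV /= -!nCE normfV. Qed.

Lemma nCX z k : nC (z ^+ k) = nC z ^+ k.
Proof. by apply: complexI; rewrite rmorphXn /= -!nCE normrX. Qed.

Lemma nCN z : nC (- z) = nC z.
Proof. by rewrite /nC normrN. Qed.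

Lemma nCB z w : nC (z - w) <= nC z + nC w.
Proof. by rewrite -(nCN w) nCD. Qed.

Lemma nC_distC z w : nC (z - w) = nC (w - z).
Proof. by rewrite -nCN opprB. Qed.

Lemma nC_real (x : R) : nC x%:C = `|x|.
Proof. by rewrite /nC normc_def /= expr0n addr0 sqrtr_sqr. Qed.

Lemma nC1 : nC 1 = 1 :> R. Proof. by rewrite -[1]/(1%:C) nC_real normr1. Qed.

Lemma nC_nat k : nC (k%:R) = k%:R :> R.
Proof. by rewrite -(rmorph_nat (real_complex R)) nC_real normr_nat. Qed.

Lemma nC_conj z : nC (conjc z) = nC z.
Proof. by rewrite /nC normcJ. Qed.

Lemma nC_sum (I : Type) (r : seq I) (P : pred I) (F : I -> R[i]) :
  nC (\sum_(i <- r | P i) F i) <= \sum_(i <- r | P i) nC (F i).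
Proof.
elim/big_rec2: _ => [|i x y _ h]; first by rewrite nC0.
by rewrite (le_trans (nCD _ _)) // lerD2l.
Qed.

Lemma nC_Re z : `|complex.Re z| <= nC z.
Proof. by rewrite -lecR -nCE normc_ge_Re. Qed.

Lemma nC_Im z : `|complex.Im z| <= nC z.
Proof.
rewrite /nC normc_def /= -sqrtr_sqr ler_wsqrtr // lerDr sqr_ge0 //.
Qed.

Lemma nC_le z : nC z <= `|complex.Re z| + `|complex.Im z|.
Proof.
rewrite {1}(complexE z); apply: (le_trans (nCD _ _)); rewrite nCM !nC_real.
have -> : nC 'i%C = 1 :> R by rewrite /nC normc_def /= expr0n add0r expr1n sqrtr1.
by rewrite mul1r.
Qed.

(** The norm of [R[i]^o] takes values in [R[i]], so its topology speaks of complex epsilons; a real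
    epsilon keeps all estimates in [R]. [cvP] links the two. *)
Definition cv (T : Type) (F : set_system T) (u : T -> R[i]) (l : R[i]) :=
  forall e : R, 0 < e -> \forall t \near F, nC (u t - l) < e.

Lemma cvP (T : Type) (F : set_system T) {FF : Filter F} (u : T -> R[i]) l :
  cv F u l <-> ((u : T -> R[i]^o) @ F --> (l : R[i]^o)).
Proof.
split=> [h|h].
  apply/cvgrPdist_lt => e e0; have eR : e = (complex.Re e)%:C.
    by rewrite RRe_real // gtr0_real.
  have /h : 0 < complex.Re e by rewrite -ltcR -eR.
  apply: filterS => t; rewrite -ltcR -eR -nCE.
  by rewrite -normrN opprB.
move=> e e0; move/cvgrPdist_lt : h => /(_ e%:C); rewrite ltcR => /(_ e0).
by apply: filterS => t; rewrite -ltcR -nCE -normrN opprB.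
Qed.

Lemma cv_eq (T : Type) (F : set_system T) {FF : Filter F} (u v : T -> R[i]) l :
  (\forall t \near F, u t = v t) -> cv F u l -> cv F v l.
Proof.
move=> uv h e e0; apply: filterS2 uv (h e e0) => t -> //.
Qed.

Lemma cvM (T : Type) (F : set_system T) {FF : Filter F} (u v : T -> R[i]) l k :
  cv F u l -> cv F v k -> cv F (fun t => u t * v t) (l * k).
Proof. by move=> /cvP h /cvP h'; apply/cvP; exact: cvgM h h'. Qed.

Lemma cvD (T : Type) (F : set_system T) {FF : Filter F} (u v : T -> R[i]) l k :
  cv F u l -> cv F v k -> cv F (fun t => u t + v t) (l + k).
Proof. by move=> /cvP h /cvP h'; apply/cvP; exact: cvgD h h'. Qed.

Lemma cvN (T : Type) (F : set_system T) {FF : Filter F} (u : T -> R[i]) l :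
  cv F u l -> cv F (fun t => - u t) (- l).
Proof. by move=> /cvP h; apply/cvP; exact: cvgN h. Qed.

Lemma cvB (T : Type) (F : set_system T) {FF : Filter F} (u v : T -> R[i]) l k :
  cv F u l -> cv F v k -> cv F (fun t => u t - v t) (l - k).
Proof. by move=> h /cvN; apply: cvD. Qed.

Lemma cvV (T : Type) (F : set_system T) {FF : Filter F} (u : T -> R[i]) l :
  l != 0 -> cv F u l -> cv F (fun t => (u t)^-1) l^-1.
Proof. by move=> l0 /cvP h; apply/cvP; exact: cvgV h. Qed.

Lemma cv_cst (T : Type) (F : set_system T) {FF : Filter F} l :
  cv F (fun _ : T => l) l.
Proof. by move=> e e0; apply: nearW => t; rewrite subrr nC0. Qed.

Lemma cv_sum (T I : Type) (F : set_system T) {FF : Filter F} (r : seq I)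
   (u : I -> T -> R[i]) l :
  (forall i, cv F (u i) (l i)) ->
  cv F (fun t => \sum_(i <- r) u i t) (\sum_(i <- r) l i).
Proof.
move=> h; elim: r => [|i r ih].
  by apply: cv_eq (cv_cst _); apply: nearW => t; rewrite !big_nil.
rewrite big_cons; apply: cv_eq (cvD (h i) ih).
by apply: nearW => t; rewrite big_cons.
Qed.

Lemma cv_uniq (T : Type) (F : set_system T) {FF : ProperFilter F}
   (u : T -> R[i]) l k : cv F u l -> cv F u k -> l = k.
Proof.
move=> hl hk; apply/eqP; rewrite -subr_eq0 -nC_eq0; apply/negPn/negP => n0.
have e0 : 0 < nC (l - k) / 2 by rewrite divr_gt0 // lt_neqAle eq_sym n0 nC_ge0.
have [t [h1 h2]] := filter_ex (filterI (hl _ e0) (hk _ e0)).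
have : nC (l - k) <= nC (u t - l) + nC (u t - k).
  rewrite (nC_distC _ l); apply: le_trans (nCD _ _).
  by rewrite (_ : _ + _ = l - k) //; ring.
by rewrite leNgt (lt_le_trans (ltrD h1 h2)) // -splitr.
Qed.

Lemma cv_lim (T : Type) (F : set_system T) {FF : ProperFilter F}
   (u : T -> R[i]) l : cv F u l -> lim ((u : T -> R[i]^o) @ F) = l.
Proof. by move=> /cvP h; apply: cvg_lim => //. Qed.

Lemma cv_realP (T : Type) (F : set_system T) {FF : Filter F} (u : T -> R) (l : R) :
  cv F (fun t => (u t)%:C) l%:C <-> (u @ F --> l).
Proof.
split=> h.
  apply/cvgrPdist_lt => e e0; apply: filterS (h e e0) => t.
  by rewrite -rmorphB nC_real distrC.
move=> e e0; move/cvgrPdist_lt : h => /(_ e e0); apply: filterS => t.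
by rewrite -rmorphB nC_real distrC.
Qed.

Lemma cv_ReIm (T : Type) (F : set_system T) {FF : Filter F} (u v : T -> R) (a b : R) :
  u @ F --> a -> v @ F --> b -> cv F (fun t => u t +i* v t) (a +i* b).
Proof.
move=> /cv_realP hu /cv_realP hv.
have E (x y : R) : x%:C + 'i * y%:C = x +i* y by exact: esym (complexE (x +i* y)).
rewrite -E; apply: cv_eq (cvD hu (cvM (cv_cst 'i%C) hv)).
by apply: nearW => t; exact: E.
Qed.

End norm.

#[global] Existing Instance totally_filter.

Section summation.
Local Open Scope fset_scope.
Local Open Scope ring_scope.
Variable R : realType.

(** [summability.sum] returns a default value on divergent families; this relation also records that
    the sum exists. *)
Definition dsum (I : choiceType) (f : I -> R[i]) (l : R[i]) :=
  forall e : R, 0 < e -> exists A : {fset I}, forall B : {fset I},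
    A `<=` B -> nC (\sum_(i <- B) f i - l) < e.

Definition bdd (I : choiceType) (g : I -> R) :=
  (forall i, 0 <= g i) /\ exists M, forall A : {fset I}, \sum_(i <- A) g i <= M.

Definition asum (I : choiceType) (f : I -> R[i]) := bdd (fun i => nC (f i)).

Lemma dsumP (I : choiceType) (f : I -> R[i]) l :
  dsum f l <-> cv (@totally I) (fun A : {fset I} => \sum_(i <- A) f i) l.
Proof.
split=> h e e0.
  by have [A hA] := h e e0; exists A => // B /= /hA.
by have [A _ hA] := h e e0; exists A => B /hA.
Qed.

Lemma dsum_sum (I : choiceType) (f : I -> R[i]) l :
  dsum f l -> summability.sum (f : I -> R[i]^o) = l.
Proof.
move=> /dsumP h; rewrite /summability.sum.
rewrite (_ : partial_sum _ = fun A : {fset I} => \sum_(i <- A) f i); last first.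
  by apply: funext => A; exact: esym (big_seq_fsetE _ A xpredT f).
exact: cv_lim h.
Qed.

Lemma dsum_uniq (I : choiceType) (f : I -> R[i]) l k :
  dsum f l -> dsum f k -> l = k.
Proof. by move=> /dsumP h /dsumP; apply: cv_uniq h. Qed.

Lemma dsumD (I : choiceType) (f g : I -> R[i]) l k :
  dsum f l -> dsum g k -> dsum (fun i => f i + g i) (l + k).
Proof.
move=> /dsumP h /dsumP h'; apply/dsumP; apply: cv_eq (cvD h h').
by apply: nearW => A; rewrite big_split.
Qed.

Lemma dsumZ (I : choiceType) (f : I -> R[i]) l a :
  dsum f l -> dsum (fun i => a * f i) (a * l).
Proof.
move=> /dsumP h; apply/dsumP; apply: cv_eq (cvM (cv_cst a) h).
by apply: nearW => A; rewrite mulr_sumr.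
Qed.

Lemma dsumN (I : choiceType) (f : I -> R[i]) l :
  dsum f l -> dsum (fun i => - f i) (- l).
Proof.
move=> /dsumP h; apply/dsumP; apply: cv_eq (cvN h).
by apply: nearW => A; rewrite sumrN.
Qed.

Lemma dsumB (I : choiceType) (f g : I -> R[i]) l k :
  dsum f l -> dsum g k -> dsum (fun i => f i - g i) (l - k).
Proof. by move=> h /dsumN; apply: dsumD. Qed.

Lemma dsum0 (I : choiceType) : dsum (fun _ : I => 0) 0.
Proof. by move=> e e0; exists fset0 => B _; rewrite big1 // subrr nC0. Qed.

Lemma dsum_bigsum (I : choiceType) (J : Type) (r : seq J) (f : J -> I -> R[i]) l :
  (forall j, dsum (f j) (l j)) ->
  dsum (fun i => \sum_(j <- r) f j i) (\sum_(j <- r) l j).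
Proof.
move=> h; elim: r => [|j r ih].
  by rewrite big_nil; under [X in dsum X _]funext do rewrite big_nil; exact: dsum0.
rewrite big_cons; under [X in dsum X _]funext do rewrite big_cons.
exact: dsumD.
Qed.

Lemma dsum_ext (I : choiceType) (f g : I -> R[i]) l :
  f =1 g -> dsum f l -> dsum g l.
Proof. by move=> /funext ->. Qed.

Lemma dsum_conj (I : choiceType) (f : I -> R[i]) l :
  dsum f l -> dsum (fun i => conjc (f i)) (conjc l).
Proof.
move=> h e /h[A hA]; exists A => B /hA; rewrite -(rmorph_sum (@conjc R)) /=.
by rewrite -rmorphB nC_conj.
Qed.

Lemma bdd_le (I : choiceType) (f g : I -> R) :
  (forall i, 0 <= f i) -> (forall i, f i <= g i) -> bdd g -> bdd f.
Proof.
move=> f0 fg [_ [M hM]]; split => //; exists M => A.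
by apply: le_trans (hM A); apply: ler_sum.
Qed.

Lemma bddZ (I : choiceType) (f : I -> R) a :
  0 <= a -> bdd f -> bdd (fun i => a * f i).
Proof.
move=> a0 [f0 [M hM]]; split; first by move=> i; rewrite mulr_ge0.
by exists (a * M) => A; rewrite -mulr_sumr ler_wpM2l.
Qed.

Lemma bddD (I : choiceType) (f g : I -> R) :
  bdd f -> bdd g -> bdd (fun i => f i + g i).
Proof.
move=> [f0 [M hM]] [g0 [N hN]]; split; first by move=> i; rewrite addr_ge0.
by exists (M + N) => A; rewrite big_split lerD.
Qed.

Lemma fset_sum_le (I : choiceType) (g : I -> R) (A B : {fset I}) :
  (forall i, 0 <= g i) -> A `<=` B -> \sum_(i <- A) g i <= \sum_(i <- B) g i.
Proof.
move=> g0 AB; rewrite (big_fsetID _ (mem A) B) /=.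
rewrite [X in _ <= X + _](_ : _ = \sum_(i <- A) g i).
  by rewrite lerDl sumr_ge0.
by apply: eq_fbigl => i; rewrite !inE /= andbC; case: (boolP (i \in A)) => // /(fsubsetP AB) ->.
Qed.

Lemma big_fsetM (V : nmodType) (I J : choiceType) (A : {fset I}) (B : {fset J})
  (F : I * J -> V) :
  \sum_(p <- A `*` B) F p = \sum_(i <- A) \sum_(k <- B) F (i, k).
Proof. by rewrite big_imfset2 //=; move=> [??] [??] _ _ /= [-> ->]. Qed.

Lemma bddX (I J : choiceType) (f : I -> R) (g : J -> R) :
  bdd f -> bdd g -> bdd (fun p : I * J => f p.1 * g p.2).
Proof.
move=> [f0 [M hM]] [g0 [N hN]]; split; first by move=> i; rewrite mulr_ge0.
exists (M * N) => A.
pose A1 := [fset p.1 | p in A]; pose A2 := [fset p.2 | p in A].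
apply: (@le_trans _ _ (\sum_(p <- A1 `*` A2) f p.1 * g p.2)).
  apply: fset_sum_le => [i|]; first by rewrite mulr_ge0.
  apply/fsubsetP => p pA; rewrite in_fsetM; apply/andP; split;
    by apply/imfsetP; exists p.
rewrite big_fsetM /=.
under eq_bigr do rewrite -mulr_sumr.
rewrite -mulr_suml ler_pM ?sumr_ge0 //.
Qed.

Lemma bdd_inj (I J : choiceType) (j : I -> J) (g : J -> R) :
  injective j -> bdd g -> bdd (g \o j).
Proof.
move=> inj_j [g0 [M hM]]; split=> [i|]; first exact: g0.
exists M => A; apply: le_trans (hM [fset j i | i in A]).
by rewrite big_imfset //= => ? ? _ _ /inj_j.
Qed.

(** Take [A] with partial sum within [e] of the supremum: the sum over the disjoint union of [A] and
    [B] cannot exceed that supremum. *)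
Lemma bdd_tail (I : choiceType) (g : I -> R) : bdd g ->
  forall e, 0 < e -> exists A : {fset I}, forall B : {fset I}, [disjoint A & B]%fset ->
    \sum_(i <- B) g i < e.
Proof.
move=> [g0 [M hM]] e e0; pose S := [set x | exists A : {fset I}, x = \sum_(i <- A) g i].
have hS : has_sup S.
  split; first by exists (\sum_(i <- fset0) g i); exists fset0.
  by exists M => _ [A ->].
have [_ [A ->] hA] := sup_adherent e0 hS; exists A => B AB.
have : \sum_(i <- A `|` B) g i <= sup S by apply: ub_le_sup; [case: hS | exists (A `|` B)].
rewrite (big_fsetID _ (mem A) (A `|` B)) /=.
rewrite [X in X + _](_ : _ = \sum_(i <- A) g i); last first.
  apply: eq_fbigl => i; rewrite !inE /= andbC.
  by case: (boolP (i \in A)).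
rewrite [X in _ + X](_ : _ = \sum_(i <- B) g i); last first.
  apply: eq_fbigl => i; rewrite !inE /=.
  case: (boolP (i \in B)) => iB; rewrite ?orbT ?orbF /=; last by case: (i \in A).
  by apply: contraTN AB => iA; apply/negP => /fdisjointP/(_ _ iA)/negP.
by move: hA; lra.
Qed.

End summation.

Section summation2.
Local Open Scope fset_scope.
Local Open Scope ring_scope.
Variable R : realType.

Lemma dsum_exists_ge0 (I : choiceType) (g : I -> R) : bdd g ->
  exists l : R, dsum (fun i => (g i)%:C) l%:C.
Proof.
move=> hg; have [g0 [M hM]] := hg.
pose S := [set x | exists A : {fset I}, x = \sum_(i <- A) g i].
have hS : has_sup S.
  split; first by exists (\sum_(i <- fset0) g i); exists fset0.
  by exists M => _ [A ->].
exists (sup S) => e e0.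
have [_ [A ->] hA] := sup_adherent e0 hS; exists A => B AB.
rewrite -rmorph_sum -rmorphB nC_real.
have h1 : \sum_(i <- B) g i <= sup S by apply: ub_le_sup; [case: hS | exists B].
have h2 := fset_sum_le g0 AB.
rewrite ler0_norm; lra.
Qed.

Lemma dsum_exists_real (I : choiceType) (g : I -> R) : bdd (fun i => `|g i|) ->
  exists l : R, dsum (fun i => (g i)%:C) l%:C.
Proof.
move=> hg; have [l1 h1] := dsum_exists_ge0 hg.
have hg' : bdd (fun i => g i + `|g i|).
  apply: bdd_le (bddD hg hg) => i; first by have := ler_norm (- g i); rewrite normrN; lra.
  by rewrite lerD2r ler_norm.
have [l2 h2] := dsum_exists_ge0 hg'.
exists (l2 - l1); rewrite rmorphB; apply: dsum_ext (dsumB h2 h1) => i.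
by rewrite rmorphD addrK.
Qed.

Lemma dsum_exists (I : choiceType) (f : I -> R[i]) : asum f -> exists l, dsum f l.
Proof.
move=> hf.
have [a ha] := @dsum_exists_real I (fun i => complex.Re (f i))
  (bdd_le (fun i => normr_ge0 _) (fun i => nC_Re _) hf).
have [b hb] := @dsum_exists_real I (fun i => complex.Im (f i))
  (bdd_le (fun i => normr_ge0 _) (fun i => nC_Im _) hf).
exists (a%:C + 'i * b%:C); apply: dsum_ext (dsumD ha (dsumZ 'i%C hb)) => i.
exact: esym (complexE (f i)).
Qed.

Lemma asumD (I : choiceType) (f g : I -> R[i]) :
  asum f -> asum g -> asum (fun i => f i + g i).
Proof. by move=> hf hg; apply: bdd_le (bddD hf hg) => i; rewrite ?nC_ge0 ?nCD. Qed.

Lemma asumN (I : choiceType) (f : I -> R[i]) : asum f -> asum (fun i => - f i).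
Proof. by rewrite /asum; under [X in _ -> bdd X]funext do rewrite nCN. Qed.

Lemma asumB (I : choiceType) (f g : I -> R[i]) :
  asum f -> asum g -> asum (fun i => f i - g i).
Proof. by move=> hf /asumN; apply: asumD. Qed.

Lemma asum_le (I : choiceType) (f : I -> R[i]) (g : I -> R) :
  (forall i, nC (f i) <= g i) -> bdd g -> asum f.
Proof. by move=> fg; apply: bdd_le => // i; exact: nC_ge0. Qed.

Lemma dsum_bound (I : choiceType) (f : I -> R[i]) l M :
  (forall A : {fset I}, nC (\sum_(i <- A) f i) <= M) -> dsum f l -> nC l <= M.
Proof.
move=> hM hl; rewrite leNgt; apply/negP => Ml.
have [A hA] := hl (nC l - M) ltac:(lra).
have := hA A (fsubset_refl _); have := hM A.
have := nCB (\sum_(i <- A) f i) (\sum_(i <- A) f i - l).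
by rewrite (_ : _ - (_ - l) = l); [lra | ring].
Qed.

Lemma dsum_inj (I J : choiceType) (j : I -> J) (g : J -> R[i]) l :
  injective j -> (forall y, (forall x, y != j x) -> g y = 0) ->
  dsum (g \o j) l <-> dsum g l.
Proof.
move=> inj_j g0; split => h e e0; have [A hA] := h e e0.
  exists [fset j i | i in A] => B AB.
  have [A' hA' eA'] : exists2 A' : {fset I}, A `<=` A' & forall i, (i \in A') = (j i \in B).
    pose T := [set i | j i \in B]%classic.
    have fT : finite_set T.
      apply: (@sub_finite_set _ _ (j @^-1` [set` B]%classic)) => //.
      apply: finite_preimage => //; first by move=> ? ? _ _ /inj_j.
    exists (fset_set T) => [|i]; last by rewrite in_fset_set //; apply/idP/idP; rewrite ?inE /T /= ?asboolE.
    apply/fsubsetP => i iA; rewrite in_fset_set //; apply/mem_set.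
    by apply: (fsubsetP AB); apply/imfsetP; exists i.
  have := hA A' hA'; congr (nC (_ - _) < e).
  rewrite -(@big_imfset _ _ _ _ _ imfset_key j (mem A') g) /=; last by move=> ? ? _ _ /inj_j.
  rewrite (@big_fset_incl _ _ _ _ [fset j x | x in A'] B g) //=.
    by apply/fsubsetP => y /imfsetP[x /= xA ->]; rewrite -eA'.
  move=> y yB yn; apply: g0 => x; apply: contra yn => /eqP yx.
  by apply/imfsetP; exists x => //=; rewrite eA' -yx.
pose T := [set i | j i \in A]%classic.
have fT : finite_set T.
  apply: (@sub_finite_set _ _ (j @^-1` [set` A]%classic)) => //.
  by apply: finite_preimage => //; move=> ? ? _ _ /inj_j.
exists (fset_set T) => B TB.
have := hA (A `|` [fset j i | i in B]) (fsubsetUl _ _); congr (nC (_ - _) < e).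
have <- : \sum_(y <- [fset j i | i in B]) g y = \sum_(i <- B) (g \o j) i.
  by rewrite big_imfset //= => ? ? _ _ /inj_j.
apply/esym/big_fset_incl; first exact: fsubsetUr.
move=> y; rewrite inE => /orP[yA|-> //] yn; apply: g0 => x.
apply: contra yn => /eqP yx; apply/imfsetP; exists x => //=.
by apply: (fsubsetP TB); rewrite in_fset_set //; apply/mem_set; rewrite /T /= -yx.
Qed.

(** For a finite set [B] of rows one finite set [C] of columns approximates the total of their row
    sums, and it can be enlarged until the rectangle contains [A]. *)
Lemma dsum_fubini (I J : choiceType) (F : I * J -> R[i]) l (g : I -> R[i]) :
  dsum F l -> (forall i, dsum (fun k => F (i, k)) (g i)) -> dsum g l.
Proof.
move=> hF hg e e0; have e2 : 0 < e / 2 by rewrite divr_gt0.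
have [A hA] := hF _ e2.
exists [fset p.1 | p in A] => B AB.
have [C0 hC] := dsum_bigsum (enum_fset B) hg e2.
pose C := C0 `|` [fset p.2 | p in A].
have h1 := hC C (fsubsetUl _ _).
have h2 : nC (\sum_(p <- B `*` C) F p - l) < e / 2.
  apply: hA; apply/fsubsetP => p pA; rewrite in_fsetM; apply/andP; split.
    by apply: (fsubsetP AB); apply/imfsetP; exists p.
  by rewrite inE; apply/orP; right; apply/imfsetP; exists p.
have E : \sum_(p <- B `*` C) F p = \sum_(k <- C) \sum_(i <- B) F (i, k).
  by rewrite big_fsetM exchange_big.
rewrite E in h2; rewrite nC_distC in h1.
have := nCD (\sum_(i <- B) g i - \sum_(k <- C) \sum_(i <- B) F (i, k))
            (\sum_(k <- C) \sum_(i <- B) F (i, k) - l).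
rewrite addrA subrK => h; apply: (le_lt_trans h).
by rewrite (splitr e); apply: ltrD.
Qed.

Lemma cv_norm_le (T : Type) (F : set_system T) {FF : ProperFilter F}
    (u : T -> R[i]) l (M : R) :
  cv F u l -> (\forall t \near F, nC (u t) <= M) -> nC l <= M.
Proof.
move=> hu hM; rewrite leNgt; apply/negP => Ml.
have e0 : 0 < nC l - M by lra.
have [t [h1 h2]] := filter_ex (filterI (hu _ e0) hM).
have := nCD (l - u t) (u t); rewrite subrK nC_distC; lra.
Qed.

(** Dominated convergence for unordered sums. It also produces the limit, which is how limits at s =
    1 are obtained without knowing their values. *)
Lemma tannery (T : Type) (F : set_system T) {FF : ProperFilter F} (I : choiceType)
    (f : T -> I -> R[i]) (f0 : I -> R[i]) (g : I -> R) (l : T -> R[i]) :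
  bdd g -> (forall i, cv F (f^~ i) (f0 i)) ->
  (\forall t \near F, forall i, nC (f t i) <= g i) ->
  (\forall t \near F, dsum (f t) (l t)) ->
  exists2 l0, dsum f0 l0 & cv F l l0.
Proof.
move=> hg hf hfg hl.
have f0g i : nC (f0 i) <= g i.
  by apply: cv_norm_le (hf i) _; apply: filterS hfg => t /(_ i).
have [l0 hl0] := dsum_exists (asum_le f0g hg).
exists l0 => // e e0; have e4 : 0 < e / 4 by lra.
have [A hA] := bdd_tail hg e4.
have tail (f1 : I -> R[i]) l1 : (forall i, nC (f1 i) <= g i) -> dsum f1 l1 ->
    nC (l1 - \sum_(i <- A) f1 i) <= e / 4.
  move=> f1g h1.
  (* The defect [l1 - \sum_(i <- A) f1 i] is itself the sum of [f1] off [A], hence bounded by the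
     tail of [g]. *)
  have h2 : dsum (fun i => if i \in A then 0 else f1 i) (l1 - \sum_(i <- A) f1 i).
    move=> d d0; have [B0 hB0] := h1 d d0; exists (A `|` B0) => B AB.
    have := hB0 B (fsubset_trans (fsubsetUr _ _) AB); congr (nC _ < d).
    rewrite (big_fsetID _ (mem A) B) /= [in RHS](big_fsetID _ (mem A) B) /=.
    rewrite (_ : [fset i in B | (mem A) i] = A); last first.
      apply/fsetP => i; rewrite !inE /= andbC; case: (boolP (i \in A)) => //= iA.
      by apply: (fsubsetP AB); rewrite inE iA.
    rewrite [X in _ = X + _ - _]big_seq [X in _ = X + _ - _]big1 ?add0r; last by move=> i ->.
    rewrite [X in _ = X - _](_ : _ = \sum_(i <- [fset i in B | ~~ (mem A) i]) f1 i).
      ring.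
    apply: eq_big_seq => i; rewrite !inE /= => /andP[_ /negbTE iA].
    by move: iA; rewrite /= => ->.
  apply: dsum_bound h2 => B.
  rewrite (big_fsetID _ (mem A) B) /= big_seq big1 ?add0r; last first.
    by move=> i; rewrite !inE /= => /andP[_ ->].
  apply: le_trans (nC_sum _ _ _) _.
  apply: (@le_trans _ _ (\sum_(i <- [fset i in B | ~~ (mem A) i]) g i)).
    by apply: ler_sum => i _; case: ifP => _; rewrite ?nC0 ?f1g // (le_trans _ (f1g i)) ?nC_ge0.
  apply/ltW/hA; apply/fdisjointP => i iA; rewrite !inE /= iA /= andbF //.
have hs : \forall t \near F, nC (\sum_(i <- A) f t i - \sum_(i <- A) f0 i) < e / 4.
  exact: (cv_sum (enum_fset A) hf).
near=> t.
have t1 := tail _ _ f0g hl0.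
have t2 : nC (l t - \sum_(i <- A) f t i) <= e / 4.
  apply: tail; [by near: t | by near: t].
have t3 : nC (\sum_(i <- A) f t i - \sum_(i <- A) f0 i) < e / 4 by near: t.
rewrite nC_distC in t1.
have := nCD (l t - \sum_(i <- A) f t i) (\sum_(i <- A) f t i - \sum_(i <- A) f0 i).
rewrite addrA subrK => h1.
have := nCD (l t - \sum_(i <- A) f0 i) (\sum_(i <- A) f0 i - l0).
rewrite addrA subrK; lra.
Unshelve. all: end_near.
Qed.

Lemma sum_fset_iota (J : choiceType) (V : nmodType) (f : nat -> J) (h : J -> V) n :
  injective f ->
  \sum_(y <- [fset f k | k in iota 0 n]) h y = \sum_(0 <= k < n) h (f k).
Proof.
move=> f_inj; rewrite big_imfset /=; last by move=> ? ? _ _ /f_inj.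
by rewrite /index_iota subn0; apply: perm_big; rewrite undup_id ?iota_uniq.
Qed.

(** Absolute summability provides some sum; it is evaluated along the intervals [-M, M], where the
    partial sums are [G (- M) - G (M + 1)]. *)
Lemma dsum_telescope_int (h G : int -> R[i]) : asum h ->
  (forall d, h d = G d - G (d + 1)) ->
  (forall e : R, 0 < e -> exists N : nat, forall d, (N <= `|d|)%N -> nC (G d) < e) ->
  dsum h 0.
Proof.
move=> ah hG G0; have [l hl] := dsum_exists ah.
suff -> : 0 = l by [].
apply/esym/eqP; rewrite -nC_eq0; apply/negPn/negP => n0.
have e0 : 0 < nC l / 3 by rewrite divr_gt0 // lt_neqAle eq_sym n0 nC_ge0.
have [A hA] := hl _ e0; have [N hN] := G0 _ e0.
pose M := (N + \sum_(d <- A) `|d|)%N.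
pose B := [fset (k%:Z - M%:Z) | k in iota 0 (M + M).+1].
have AB : A `<=` B.
  apply/fsubsetP => d dA; have : (`|d| <= \sum_(d <- A) `|d|)%N.
    by rewrite (big_fsetD1 d) //= leq_addr.
  move: d {dA} => /= d dM; have dM' : (`|d| <= M)%N by rewrite (leq_trans dM) ?leq_addl.
  move: M dM' {dM} @B => M dM B; 
  have E : ((absz (d + M%:Z))%:Z = d + M%:Z)%R by lia.
  apply/imfsetP; exists (absz (d + M%:Z)); last by rewrite E addrK.
  by rewrite /= -[_ :: _]/(iota 0 (M + M).+1) mem_iota; lia.
have := hA B AB; rewrite sum_fset_iota; last by move=> ? ?; lia.
have -> : \sum_(0 <= k < (M + M).+1) h (k%:Z - M%:Z) = G (- M%:Z) - G (M%:Z + 1).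
  have -> : forall n, \sum_(0 <= k < n) h (k%:Z - M%:Z) = G (- M%:Z) - G (n%:Z - M%:Z).
    elim => [|n ih]; first by rewrite big_geq // sub0r subrr.
    rewrite big_nat_recr //= ih hG addrA subrK.
    by congr (_ - G _); lia.
  by congr (_ - G _); lia.
have := hN (- M%:Z) ltac:(lia); have := hN (M%:Z + 1) ltac:(lia).
set a := G _; set b := G _; move=> h1 h2 h3.
have := nCD (l - (b - a)) (b - a); rewrite subrK nC_distC.
have := nCB b a; lra.
Qed.

Lemma dsum_telescope_nat (h G : nat -> R[i]) : asum h ->
  (forall d, h d = G d - G d.+1) ->
  (forall e : R, 0 < e -> exists N : nat, forall d, (N <= d)%N -> nC (G d) < e) ->
  dsum h (G 0%N).
Proof.
move=> ah hG G0; have [l hl] := dsum_exists ah.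
suff -> : G 0%N = l by [].
apply/eqP; rewrite -subr_eq0 -nC_eq0; apply/negPn/negP => n0.
have e0 : 0 < nC (G 0%N - l) / 3 by rewrite divr_gt0 // lt_neqAle eq_sym n0 nC_ge0.
have [A hA] := hl _ e0; have [N hN] := G0 _ e0.
pose M := (N + \sum_(d <- A) d)%N.
pose B := [fset k | k in iota 0 M.+1].
have AB : A `<=` B.
  apply/fsubsetP => d dA; have : (d <= \sum_(d <- A) d)%N.
    by rewrite (big_fsetD1 d) //= leq_addr.
  move=> dM; apply/imfsetP; exists d => //.
  by rewrite /= -[_ :: _]/(iota 0 M.+1) mem_iota /M; move: dM; lia.
have := hA B AB; rewrite sum_fset_iota //.
have -> : forall n, \sum_(0 <= k < n) h k = G 0%N - G n.
  elim => [|n ih]; first by rewrite big_geq // subrr.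
  by rewrite big_nat_recr //= ih hG addrA subrK.
have := hN M.+1 ltac:(lia).
set a := G _; set b := G _; move=> h1 h3.
have := nCD (b - a - l) a; rewrite (_ : b - a - l + a = b - l); last by ring.
lra.
Qed.

Lemma dsum_telescope_pairs (I : choiceType) (h : I * int -> R[i]) (G : I -> int -> R[i]) : asum h ->
  (forall c d, h (c, d) = G c d - G c (d + 1)) ->
  (forall c (e : R), 0 < e -> exists N : nat, forall d, (N <= `|d|)%N -> nC (G c d) < e) ->
  dsum h 0.
Proof.
move=> ah hG G0; have [l hl] := dsum_exists ah.
have h0 : @dsum R I (fun=> 0) l.
  apply: (@dsum_fubini I int h l (fun=> 0) hl) => c; apply: dsum_telescope_int (hG c) (G0 c).
  by apply: (@bdd_inj _ _ _ (fun d => (c, d)) (fun p => nC (h p))) => // ? ? [].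
by rewrite (dsum_uniq (@dsum0 R I) h0).
Qed.

End summation2.

(** * Totients and numbers of divisors *)

Lemma leq_totient_pmul p d : prime p -> (0 < d)%N -> (totient d <= totient (p * d))%N.
Proof.
move=> pp d0; rewrite -(partnC p d0) p_part; set k := logn p d; set d' := (d`__)%N.
have cop j : coprime (p ^ j) d'.
  by case: j => [|j]; rewrite ?coprime1n // coprime_pexpl // prime_coprime // /d' -p'natE ?part_pnat // part_gt0.
rewrite mulnA -expnS !totient_coprime // leq_mul2r; apply/orP; right.
clearbody k; case: k => [|k]; first by rewrite totient_gt0 expn_gt0 prime_gt0.
by rewrite !totient_pfactor // leq_mul2l leq_pexp2l ?prime_gt0 // orbT.
Qed.

Lemma leq_totient_dvd d c : (0 < c)%N -> (d %| c)%N -> (totient d <= totient c)%N.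
Proof.
move=> c0 /dvdnP[k ek]; move: c0; rewrite ek muln_gt0 => /andP[].
elim/ltn_ind: k {ek} => k ih k0 d0.
have [k1|k1] := leqP k 1; first by rewrite (_ : k = 1%N) ?mul1n //; lia.
have pp := pdiv_prime k1; have e : (k = pdiv k * (k %/ pdiv k))%N.
  by rewrite mulnC divnK // pdiv_dvd.
have q0 : (0 < k %/ pdiv k)%N by rewrite divn_gt0 ?pdiv_gt0 // dvdn_leq ?pdiv_dvd.
rewrite e -mulnA; apply: leq_trans (leq_totient_pmul pp _); last by rewrite muln_gt0 q0.
by apply: ih => //; rewrite ltn_Pdiv ?prime_gt1.
Qed.

Definition ndiv c := size (divisors c).

(** In c = sum of totient d over d dividing c, every term is at most totient c. This bounds the
    number of units modulo c from below. *)
Lemma leq_totient_ndiv c : (0 < c)%N -> (c <= totient c * ndiv c)%N.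
Proof.
move=> c0; rewrite -{1}(cyclic.sum_totient_dvd c).
apply: (@leq_trans (\sum_(d < c.+1 | d %| c) totient c)%N).
  by apply: leq_sum => d dc; exact: leq_totient_dvd.
rewrite sum_nat_const mulnC leq_mul2l /ndiv; apply/orP; right.
rewrite cardE -(size_map val); apply: uniq_leq_size.
  by rewrite map_inj_uniq ?enum_uniq //; exact: val_inj.
by move=> x /mapP[d]; rewrite mem_enum => dc ->; rewrite -dvdn_divisors.
Qed.

(** * Kloosterman sums *)

Section finite_ring.
Local Open Scope set_scope.
Local Open Scope ring_scope.
Variables (R : realType) (A : finComUnitRingType) (psi : A -> R[i]).
Hypothesis psiD : forall x y, psi (x + y) = psi x * psi y.
Hypothesis psi_norm : forall x, nC (psi x) = 1.
Hypothesis psi_orth : forall y, \sum_x psi (x * y) = (#|A| * (y == 0))%:R.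

Local Notation U := (fun u : A => u \is a GRing.unit).

Definition kl (m l : A) : R[i] := \sum_(u | U u) psi (m / u + l * u).

Definition ann (t : A) : nat := #|[set a : A | t * a == 0]|.

Local Notation two := (2%:R : A).

Lemma psi0 : psi 0 = 1.
Proof.
have := psiD 0 0; rewrite addr0 => /eqP; rewrite -subr_eq0 -{1}[psi 0]mulr1 -mulrBr.
rewrite mulf_eq0 -nC_eq0 psi_norm oner_eq0 /= subr_eq0 => /eqP <- //.
Qed.

Lemma psiN x : psi (- x) = conjc (psi x).
Proof.
have p0 : psi x != 0 by rewrite -nC_eq0 psi_norm oner_eq0.
apply: (mulfI p0); rewrite -psiD subrr psi0.
by rewrite -sqr_normc nCE psi_norm expr1n.
Qed.

Lemma kl_scale (m l v : A) : U v -> kl (m * v) (l / v) = kl m l.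
Proof.
move=> Uv; rewrite /kl [RHS](reindex (fun u => u / v)) /=; last first.
  by exists (fun u => u * v) => u _; rewrite ?mulrK ?divrK.
apply: eq_big => u; first by rewrite unitrMl ?unitrV.
move=> Uu; rewrite invrM ?unitrV // invrK; congr (psi (_ + _)).
  by rewrite mulrA mulrAC.
by rewrite mulrA mulrAC.
Qed.

(** Quadruples ((u, v), (u', v')) as they arise from the square of |kl|^2; u and u' carry the plus
    signs. *)
Definition quad := (A * A * (A * A))%type.
Definition qU (q : quad) := [&& U q.1.1, U q.1.2, U q.2.1 & U q.2.2].
Definition qa (q : quad) := q.1.1^-1 - q.1.2^-1 + (q.2.1^-1 - q.2.2^-1).
Definition qb (q : quad) := q.1.1 - q.1.2 + (q.2.1 - q.2.2).

Definition quad_sol := [set q : quad | [&& qU q, qa q == 0 & qb q == 0]].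

Lemma kl_norm2 m l :
  kl m l * conjc (kl m l) =
  \sum_(q : A * A | U q.1 && U q.2) psi (m * (q.1^-1 - q.2^-1) + l * (q.1 - q.2)).
Proof.
rewrite /kl rmorph_sum mulr_suml.
under eq_bigr do rewrite mulr_sumr.
rewrite pair_big /=; apply: eq_bigr => -[u v] _ /=.
transitivity (psi (m / u + l * u) * psi (- (m / v + l * v))); last by rewrite -psiD; congr psi; ring.
by congr (_ * _); exact: esym (psiN _).
Qed.

Lemma kl_norm4 m l :
  (nC (kl m l) ^+ 4)%:C = \sum_(q : quad | qU q) psi (m * qa q + l * qb q).
Proof.
have -> : (nC (kl m l) ^+ 4)%:C = (kl m l * conjc (kl m l)) ^+ 2.
  by rewrite -sqr_normc nCE -exprM rmorphXn.
rewrite kl_norm2 expr2 mulr_suml.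
under eq_bigr do rewrite mulr_sumr.
rewrite pair_big /=; apply: eq_big => -[[u v] [u' v']] /=.
  by rewrite /qU /= -andbA.
by move=> _; rewrite -psiD /qa /qb /=; congr psi; ring.
Qed.

(** Summing the expanded fourth power over m and over l detects [qa q = 0] and [qb q = 0] by
    orthogonality. *)
Lemma kl_moment4 :
  \sum_m \sum_l nC (kl m l) ^+ 4 =
  (#|A| ^ 2 * #|quad_sol|)%:R.
Proof.
apply: (@complexI R); rewrite rmorph_sum /=.
under eq_bigr do rewrite rmorph_sum /=.
under eq_bigr do under eq_bigr do rewrite kl_norm4.
under eq_bigr do rewrite exchange_big /=.
rewrite exchange_big /=.
transitivity (\sum_(q : quad | qU q) ((#|A| ^ 2 * ((qa q == 0) && (qb q == 0)))%:R : R[i])).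
  apply: eq_bigr => q _.
  under eq_bigr do under eq_bigr do rewrite psiD.
  under eq_bigr do rewrite -mulr_sumr psi_orth.
  rewrite -mulr_suml psi_orth -natrM; congr (_%:R).
  by case: (qa q == 0); case: (qb q == 0); rewrite /= ?(muln0, muln1, mul0n, mul1n) // mulnn.
rewrite -natr_sum rmorph_nat; congr (_%:R).
rewrite -big_distrr /=; congr (_ * _)%N.
rewrite -sum1dep_card [RHS]big_mkcondr /= ; apply: eq_bigr => q _.
by case: (_ && _).
Qed.

Lemma card_fiber (t w : A) : (#|[set a : A | (t * a == w)%R]| <= ann t)%N.
Proof.
have [->|[a0]] := set_0Vmem [set a : A | (t * a == w)%R]; first by rewrite cards0.
rewrite inE => /eqP h0.
have inj : injective (fun a => a - a0) by move=> a b /addIr.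
rewrite -(card_imset _ inj); apply: subset_leq_card; apply/fintype.subsetP => b /imsetP[a].
by rewrite !inE => /eqP ha ->; rewrite mulrBr ha h0 subrr.
Qed.

(** Multiplication by [y] maps the annihilator of [x * y] into that of [x], with fibres of at most
    [ann y] elements. *)
Lemma ann_mul (x y : A) : (ann (x * y)%R <= ann x * ann y)%N.
Proof.
rewrite {1}/ann -sum1dep_card.
rewrite (partition_big (fun a => y * a) (fun b => x * b == 0)) /=; last by move=> a; rewrite mulrA.
rewrite {1}/ann -sum1dep_card mulnC big_distrr /=.
apply: leq_sum => b _; rewrite muln1 sum1dep_card; apply: leq_trans (card_fiber y b).
by apply: subset_leq_card; apply/fintype.subsetP => a; rewrite !inE => /andP[].
Qed.

(** Eliminating v' = u + u' - v turns the equation between inverses into (u + u') (v - u) (u' - v) =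
    0. In the variables x = u + u', y = v - u, a = u this reads x y (x - y - 2 a) = 0, which for
    fixed x and y has at most as many solutions a as the annihilator of 2 x y has elements. *)
Lemma card_quad :
  (#|quad_sol|
   <= ann two * (\sum_x ann x) ^ 2)%N.
Proof.
pose T := [set p : A * A * A | p.1.1 * p.1.2 * (p.1.1 - p.1.2 - 2%:R * p.2) == 0].
apply: (@leq_trans #|T|).
  pose f (q : quad) := (q.1.1 + q.2.1, q.1.2 - q.1.1, q.1.1).
  rewrite -(@card_in_imset _ _ f).
    apply: subset_leq_card; apply/fintype.subsetP => p /imsetP[[[u v] [u' v']]].
    rewrite !inE /qU /qa /qb /= => /andP[/and4P[Uu Uv Uu' Uv'] /andP[/eqP ha /eqP hb]] ->.
    rewrite /f /=; apply/eqP.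
    have e : v' = u + u' - v by apply/eqP; rewrite -subr_eq0 -oppr_eq0 -hb; apply/eqP; ring.
    have {}ha : (u + u') * (v * v') = (v + v') * (u * u').
      have := congr1 (fun x => x * (u * u') * (v * v')) ha.
      have -> : (u^-1 - v^-1 + (u'^-1 - v'^-1)) * (u * u') * (v * v') =
         (u^-1 * u) * u' * (v * v') - (v^-1 * v) * v' * (u * u')
          + (u'^-1 * u') * u * (v * v') - (v'^-1 * v') * v * (u * u') by ring.
      by rewrite !mulVr // !mul1r !mul0r => h; apply/eqP; rewrite -subr_eq0 -h; apply/eqP; ring.
    have e2 : v + v' = u + u' by rewrite e; ring.
    move: ha; rewrite e2 e => h; transitivity ((u + u') * (v * (u + u' - v)) - (u + u') * (u * u')).
      ring.
    by rewrite h subrr.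
  move=> [[u v] [u' v']] [[w z] [w' z']]; rewrite !inE /= => /and3P[_ _ /eqP h1] /and3P[_ _ /eqP h2].
  rewrite /f /= => -[e1 e2 e3]; move: h1 h2; rewrite /qb /= {}e3 in e1 e2 * => h1 h2.
  have e4 : u' = w' by apply: (addrI w).
  have e5 : v = z by apply: (addIr (- w)).
  subst u' v; congr (_, _, (_, _)); apply/oppr_inj/(addrI w')/(addrI (w - z)).
  by rewrite h1 h2.
apply: (@leq_trans (\sum_(p : A * A) ann (2%:R * (p.1 * p.2))%R)%N).
  rewrite -sum1dep_card (eq_bigl (fun p : A * A * A => p.1.1 * p.1.2 * (p.1.1 - p.1.2 - 2%:R * p.2) == 0)) //.
  rewrite -(pair_big_dep xpredT (fun xy a => xy.1 * xy.2 * (xy.1 - xy.2 - 2%:R * a) == 0) (fun _ _ => 1%N)) /=.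
  apply: leq_sum => -[x y] _ /=; rewrite sum1dep_card.
  apply: leq_trans (card_fiber (2%:R * (x * y)) (x * y * (x - y))).
  apply: subset_leq_card; apply/fintype.subsetP => a; rewrite !inE => /eqP h; apply/eqP.
  apply/eqP; rewrite -subr_eq0 -oppr_eq0 -h; apply/eqP; ring.
apply: (@leq_trans (\sum_(p : A * A) ann two * (ann p.1 * ann p.2))%N).
  apply: leq_sum => p _; apply: leq_trans (ann_mul _ _) _.
  by rewrite leq_mul2l ann_mul orbT.
rewrite -big_distrr /= leq_mul2l; apply/orP; right.
rewrite expnS expn1 big_distrl /=.
under [X in (_ <= X)%N]eq_bigr do rewrite big_distrr /=.
by rewrite pair_big.
Qed.

(* [kl m l] is invariant under (m, l) |-> (m v, l / v), so its fourth power
   occurs once per unit of the ring, up to [ann m], in the fourth moment. *)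
Lemma kl_bound m l :
  #|[set u : A | U u]|%:R * nC (kl m l) ^+ 4
   <= (ann m * (#|A| ^ 2 * (ann two * (\sum_x ann x) ^ 2)))%:R :> R.
Proof.
apply: (@le_trans _ _ ((ann m)%:R * \sum_x \sum_y nC (kl x y) ^+ 4)); last first.
  by rewrite kl_moment4 -natrM ler_nat !leq_mul2l card_quad !orbT.
have -> : #|[set u : A | U u]|%:R * nC (kl m l) ^+ 4 =
   \sum_(v | U v) nC (kl (m * v) (l / v)) ^+ 4.
  rewrite -sum1dep_card natr_sum mulr_suml; apply: eq_bigr => v Uv.
  by rewrite kl_scale // mul1r.
rewrite (partition_big (fun v => m * v) xpredT) //= mulr_sumr.
apply: ler_sum => x _.
apply: (@le_trans _ _ (\sum_(v | U v && (m * v == x)) \sum_y nC (kl x y) ^+ 4)).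
  apply: ler_sum => v /andP[_ /eqP <-].
  by rewrite (bigD1 (l / v)) //= lerDl sumr_ge0 // => ? _; rewrite exprn_ge0 ?nC_ge0.
rewrite sumr_const -[X in X <= _]mulr_natl ler_wpM2r //.
  by apply: sumr_ge0 => ? _; rewrite exprn_ge0 ?nC_ge0.
rewrite ler_nat; apply: leq_trans (card_fiber m x); apply: subset_leq_card.
by apply/fintype.subsetP => v; rewrite !inE => /andP[].
Qed.

End finite_ring.

(** * Convergence of p-series and of divisor sums *)

Section series.
Local Open Scope fset_scope.
Local Open Scope ring_scope.
Variable R : realType.

Lemma fsum_nat_le (f : nat -> R) M (A : {fset nat}) : (forall n, 0 <= f n) ->
  (forall n, \sum_(0 <= k < n) f k <= M) -> \sum_(k <- A) f k <= M.
Proof.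
move=> f0 fM; pose N := (\sum_(k <- A) k).+1.
apply: le_trans (fM N); rewrite -(sum_fset_iota f N (@inj_id nat)).
apply: fset_sum_le => //; apply/fsubsetP => k kA; apply/imfsetP; exists k => //=.
have : (k <= \sum_(k <- A) k)%N by rewrite (big_fsetD1 k) //= leq_addr.
by rewrite -[_ :: _]/(iota 0 N) mem_iota /N; lia.
Qed.

Lemma bdd_nat (f : nat -> R) M : (forall n, 0 <= f n) ->
  (forall n, \sum_(0 <= k < n) f k <= M) -> bdd f.
Proof. by move=> f0 fM; split=> //; exists M => A; exact: fsum_nat_le. Qed.

Lemma ln_leB1 (x : R) : 0 < x -> ln x <= x - 1.
Proof. by move=> x0; have := expR_ge1Dx (ln x); rewrite lnK ?posrE //; lra. Qed.

Lemma powR_shift (p : R) (x y : R) : 0 < x -> 0 < y ->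
  x `^ (1 - p) = y `^ (1 - p) * expR ((1 - p) * ln (x / y)).
Proof.
move=> x0 y0; rewrite /powR !gt_eqF // -expRD lnM ?posrE ?invr_gt0 // lnV ?posrE //.
by congr expR; ring.
Qed.

Lemma powR_div (p x : R) : 0 < x -> x `^ (- p) = x `^ (1 - p) / x.
Proof.
move=> x0; have e : - p = (1 - p) - 1 by ring.
rewrite {1}e powRB ?powRr1 ?ltW //.
by apply/implyP => _; rewrite gt_eqF.
Qed.

Lemma expR_aux1 (p t u E : R) : 1 <= p -> 1 + (1 - p) * t <= E -> t <= - u ->
  (p - 1) * u <= E - 1.
Proof. move=> *; nra. Qed.

Lemma expR_aux2 (p t u E : R) : 1 <= p -> 1 + (1 - p) * t <= E -> t <= u ->
  1 - E <= (p - 1) * u.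
Proof. move=> *; nra. Qed.

(** Here and in [powR_telescope_ge] the inequality 1 + x <= exp x stands in for comparison with an
    integral. *)
Lemma powR_telescope (p : R) (n : nat) : 1 <= p -> (0 < n)%N ->
  (p - 1) * n.+1%:R `^ (- p) <= n%:R `^ (1 - p) - n.+1%:R `^ (1 - p).
Proof.
move=> p1 n0.
have n0R : 0 < n%:R :> R by rewrite ltr0n.
have n1R : 0 < n.+1%:R :> R by rewrite ltr0n.
rewrite (powR_shift p n0R n1R) (powR_div _ n1R).
set a := _ `^ (1 - p); have a0 : 0 <= a by exact: powR_ge0.
have h1 := expR_ge1Dx ((1 - p) * ln (n%:R / n.+1%:R)).
have h2 : ln (n%:R / n.+1%:R) <= - n.+1%:R^-1 :> R.
  apply: le_trans (ln_leB1 _) _; first by rewrite divr_gt0.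
  rewrite -[X in X <= _](_ : - n.+1%:R^-1 = _) //.
  by rewrite -[n.+1]addn1 natrD; field; rewrite natr1 gt_eqF.
have h3 : (p - 1) * n.+1%:R^-1 <= expR ((1 - p) * ln (n%:R / n.+1%:R)) - 1.
  exact: expR_aux1 p1 h1 h2.
have := ler_wpM2l a0 h3; rewrite mulrBr mulr1 mulrCA mulrA.
by rewrite -[X in X <= _]mulrA.
Qed.

Lemma powR_telescope_ge (p : R) (n : nat) : 1 <= p -> (0 < n)%N ->
  n%:R `^ (1 - p) - n.+1%:R `^ (1 - p) <= (p - 1) * n%:R `^ (- p).
Proof.
move=> p1 n0.
have n0R : 0 < n%:R :> R by rewrite ltr0n.
have n1R : 0 < n.+1%:R :> R by rewrite ltr0n.
rewrite (powR_shift p n1R n0R) (powR_div _ n0R).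
set a := _ `^ (1 - p); have a0 : 0 <= a by exact: powR_ge0.
have h1 := expR_ge1Dx ((1 - p) * ln (n.+1%:R / n%:R)).
have h2 : ln (n.+1%:R / n%:R) <= n%:R^-1 :> R.
  apply: le_trans (ln_leB1 _) _; first by rewrite divr_gt0.
  by rewrite -natr1 mulrDl divff ?gt_eqF // mul1r addrAC subrr add0r.
have h3 : 1 - expR ((1 - p) * ln (n.+1%:R / n%:R)) <= (p - 1) * n%:R^-1.
  exact: expR_aux2 p1 h1 h2.
have := ler_wpM2l a0 h3; rewrite mulrBr mulr1 => h; apply: (le_trans h).
by rewrite mulrCA.
Qed.

Lemma bdd_pseries (p : R) : 1 < p -> bdd (fun n : nat => n%:R `^ (- p)).
Proof.
move=> p1; have p0 : 0 < p - 1 by rewrite subr_gt0.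
apply: (@bdd_nat _ (1 + (p - 1)^-1)) => [n|n]; first exact: powR_ge0.
have H : forall n, \sum_(0 <= k < n.+2) k%:R `^ (- p) <= 1 + (p - 1)^-1 * (1 - n.+1%:R `^ (1 - p)).
  elim=> [|k ih].
    rewrite !big_nat_recr //= big_geq // add0r powR0 ?powR1 ?add0r; last by rewrite oppr_eq0; lra.
    by rewrite subrr mulr0 addr0.
  rewrite big_nat_recr //=; apply: le_trans (lerD ih (_ : _ <= (p - 1)^-1 * (k.+1%:R `^ (1 - p) - k.+2%:R `^ (1 - p)))) _.
    by rewrite mulrC ler_pdivlMr // mulrC powR_telescope // ltW.
  by rewrite -addrA -mulrDr addrA subrK.
apply: (@le_trans _ _ (\sum_(0 <= k < n.+2) k%:R `^ (- p))).
  by rewrite !big_nat_recr //= -addrA lerDl addr_ge0 ?powR_ge0.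
apply: le_trans (H n) _; rewrite lerD2l ler_piMr ?invr_ge0 ?ltW // lerBlDr lerDl powR_ge0.
Qed.

(** The term at n is the sum of a^(-p) b^(-p) over factorisations n = a b, so finite partial sums
    are parts of a product of two p-series. *)
Lemma bdd_divisors (p : R) : 1 < p ->
  bdd (fun n : nat => (ndiv n)%:R * n%:R `^ (- p)).
Proof.
move=> p1; have [h0 [M hM]] := bddX (bdd_pseries p1) (bdd_pseries p1).
split=> [n|]; first by rewrite mulr_ge0 // powR_ge0.
exists M => A.
pose pairs := flatten [seq [seq (a, (n %/ a)%N) | a <- divisors n] | n <- enum_fset A & (0 < n)%N].
have up : uniq pairs.
  apply: (@allpairs_uniq_dep _ _ _ (fun n a => (a, (n %/ a)%N))).
  - by rewrite filter_uniq ?fset_uniq.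
  - by move=> n _; exact: divisors_uniq.
  - move=> v w /allpairsPdep[x [y [xA yx ->]]] /allpairsPdep[x' [y' [xA' yx' ->]]] /= [e1 e2].
    move: xA xA'; rewrite !mem_filter => /andP[x0 _] /andP[x0' _].
    move: yx yx'; rewrite -!dvdn_divisors // => yx yx'.
    by subst y'; rewrite (_ : x = x') // -(divnK yx) e2 divnK.
apply: le_trans (hM [fset x in pairs]).
rewrite (perm_big pairs) /=; last first.
  by apply: uniq_perm => [||x]; rewrite ?fset_uniq ?inE.
rewrite big_flatten /= big_map big_filter [X in _ <= X]big_mkcond /=.
apply: ler_sum => n _.
case: (posnP n) => [->|n0]; first by rewrite powR0 ?mulr0 // oppr_eq0; lra.
rewrite big_map /= (eq_big_seq (fun=> n%:R `^ (- p))).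
  by rewrite big_const_seq count_predT iter_addr_0 mulr_natl.
move=> a; rewrite -dvdn_divisors // => an.
by rewrite -powRM // -natrM mulnC divnK.
Qed.

End series.

(** * Exponentials and roots of unity *)

Section cexp.
Variable R : realType.
Implicit Types z w : R[i].

Lemma cexpD z w : cexp (z + w) = cexp z * cexp w.
Proof.
case: z w => [a b] [c d]; rewrite /cexp /= expRD cosD sinD.
by apply: complex_ext => /=; ring.
Qed.

Lemma twopiiE : twopii R = (2 * pi)%:C * 'i%C.
Proof. by apply: complex_ext => /=; rewrite -?(mulr_natl pi 2); ring. Qed.

Lemma cexp0 : cexp (0 : R[i]) = 1.
Proof.
rewrite /cexp /= expR0 cos0 sin0.
by apply: complex_ext => /=; ring.
Qed.

Lemma nC_cis (t : R) : nC (cos t +i* sin t) = 1.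
Proof. by rewrite /nC normc_def /= cos2Dsin2 sqrtr1. Qed.

Lemma nC_cexp z : nC (cexp z) = expR (complex.Re z).
Proof. by rewrite /cexp nCM nC_cis mulr1 nC_real ger0_norm ?expR_ge0. Qed.

Lemma e1D z w : e1 (z + w) = e1 z * e1 w :> R[i].
Proof. by rewrite /e1 mulrDr cexpD. Qed.

Lemma e10 : e1 0 = 1 :> R[i].
Proof. by rewrite /e1 mulr0 cexp0. Qed.

Lemma e1_realE (x : R) : e1 x%:C = cos (pi *+ 2 * x) +i* sin (pi *+ 2 * x).
Proof.
rewrite /e1 /cexp /twopii /= !(mul0r, mulr0, oppr0, add0r, addr0) expR0.
by apply: complex_ext => /=; ring.
Qed.

Lemma nC_e1_real (x : R) : nC (e1 x%:C) = 1.
Proof. by rewrite e1_realE nC_cis. Qed.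

Lemma e1N z : e1 (- z) = (e1 z)^-1 :> R[i].
Proof.
have h : e1 z * e1 (- z) = 1 by rewrite -e1D subrr e10.
have z0 : e1 z != 0 by apply: contra_eq_neq h => ->; rewrite mul0r eq_sym oner_neq0.
by apply: (mulfI z0); rewrite h mulfV.
Qed.

Lemma e1_conj (x : R) : e1 (- x%:C) = conjc (e1 x%:C).
Proof. by rewrite -rmorphN !e1_realE mulrN cosN sinN. Qed.

Lemma e1_nat (k : nat) : e1 k%:R = 1 :> R[i].
Proof.
elim: k => [|k ih]; first exact: e10.
rewrite -addn1 natrD e1D ih mul1r -[1%:R]/(1%:C) e1_realE mulr1 cos2pi sin2pi //.
Qed.

Lemma e1_int (k : int) : e1 k%:~R = 1 :> R[i].
Proof.
case: k => k; first exact: e1_nat.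
by rewrite NegzE rmorphN /= e1N -pmulrn e1_nat invr1.
Qed.

Definition om (c : nat) (k : int) : R[i] := e1 (k%:~R / c%:R).

Lemma om_real c k : om c k = e1 (k%:~R / c%:R)%:C.
Proof. by rewrite /om rmorphM fmorphV rmorph_int rmorph_nat. Qed.

Lemma omD c k l : om c (k + l) = om c k * om c l.
Proof. by rewrite /om rmorphD mulrDl e1D. Qed.

Lemma om0 c : om c 0 = 1.
Proof. by rewrite /om mul0r e10. Qed.

Lemma nC_om c k : nC (om c k) = 1.
Proof. by rewrite om_real nC_e1_real. Qed.

Lemma om_conj c k : om c (- k) = conjc (om c k).
Proof. by rewrite !om_real -e1_conj rmorphN mulNr rmorphN. Qed.

Lemma om_mulc c k : (0 < c)%N -> om c (c%:Z * k) = 1.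
Proof.
move=> c0; rewrite /om rmorphM /= mulrAC -pmulrn divff ?mul1r ?e1_int //.
by rewrite pnatr_eq0 -lt0n.
Qed.

Lemma om_mod c k l : (0 < c)%N -> (k = l %[mod c%:Z])%Z -> om c k = om c l.
Proof.
move=> c0 /eqP; rewrite eqz_mod_dvd => /dvdzP[q e].
by rewrite (_ : k = l + c%:Z * q) ?omD ?om_mulc ?mulr1 //; lia.
Qed.

Lemma omX c k (n : nat) : om c k ^+ n = om c (k * n%:Z).
Proof.
elim: n => [|n ih]; first by rewrite mulr0 om0.
by rewrite exprSr ih -omD; congr om; lia.
Qed.

(** With j the ceiling of c / (4 l), j l / c lies between 1/4 and 3/4 of a turn, so [om c l ^+ j]
    has nonpositive real part and distance at least 1 from 1; that distance is at most j times the
    one of [om c l]. *)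
Lemma chord_le c (l : nat) : (0 < l)%N -> (l.*2 <= c)%N ->
  l%:R / c%:R <= nC (1 - om c l).
Proof.
move=> l0 lc; pose j := ((c + 4 * l - 1) %/ (4 * l))%N.
have j1 : (c <= 4 * l * j)%N by rewrite /j; nia.
have j2 : (4 * l * j < c + 4 * l)%N.
  by rewrite /j; have := leq_trunc_div (c + 4 * l - 1) (4 * l); lia.
have c0 : 0 < c%:R :> R by rewrite ltr0n; lia.
have jc : nC (1 - om c l ^+ j) <= j%:R * nC (1 - om c l).
  rewrite -{1}(expr1n _ j) subrXX nCM mulrC ler_wpM2r ?nC_ge0 //.
  apply: le_trans (nC_sum _ _ _) _.
  rewrite -[X in _ <= X%:R]card_ord -sumr_const; apply: ler_sum => i _.
  by rewrite expr1n mul1r nCX nC_om expr1n.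
have h1 : 1 <= nC (1 - om c l ^+ j).
  apply: le_trans (nC_Re _); rewrite omX om_real e1_realE /=.
  set t := pi *+ 2 * _.
  have ct : cos t <= 0.
    rewrite -[t](subrK pi) cosDpi oppr_le0 cos_ge0_pihalf //.
    have e : t = pi * ((4 * l * j)%:R / (2 * c%:R)).
      rewrite /t rmorphM /= -!pmulrn -natrM mulr2n !natrM; field.
      by rewrite gt_eqF.
    have pi0 := pi_gt0 R.
    have b1 : 1 / 2 <= (4 * l * j)%:R / (2 * c%:R) :> R.
      have h : c%:R <= (4 * l * j)%:R :> R by rewrite ler_nat.
      rewrite ler_pdivlMr ?mulr_gt0 //; move: h; lra.
    have b2 : (4 * l * j)%:R / (2 * c%:R) <= 3 / 2 :> R.
      have h : (4 * l * j)%:R <= 3 * c%:R :> R by rewrite -natrM ler_nat; lia.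
      rewrite ler_pdivrMr ?mulr_gt0 //; move: h; lra.
    rewrite e; apply/andP; split; nra.
  by rewrite ger0_norm; lra.
have j0 : 0 < j%:R :> R by rewrite ltr0n; nia.
rewrite ler_pdivrMr //; apply: (@le_trans _ _ (l%:R * (j%:R * nC (1 - om c l)))).
  by rewrite ler_peMr // (le_trans h1).
rewrite mulrA -natrM mulrC ler_wpM2l ?nC_ge0 // ler_nat; lia.
Qed.

Lemma nC_1Bom c k : nC (1 - om c (- k)) = nC (1 - om c k).
Proof.
by rewrite om_conj -[RHS]nC_conj; congr nC; rewrite [RHS]rmorphB rmorph1.
Qed.

(** One summand for each side of the circle, so that summation over l gives two harmonic sums. *)
Lemma chord_inv c (l : nat) : (0 < l < c)%N ->
  (nC (1 - om c l))^-1 <= c%:R / l%:R + c%:R / (c - l)%:R.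
Proof.
move=> /andP[l0 lc]; have c0 : 0 < c%:R :> R by rewrite ltr0n; lia.
have l0R : 0 < l%:R :> R by rewrite ltr0n.
have cl0 : 0 < (c - l)%:R :> R by rewrite ltr0n; lia.
have [h|h] := leqP l.*2 c.
  have := chord_le l0 h => H; apply: (@le_trans _ _ (c%:R / l%:R)).
    by rewrite -[X in _ <= X]invf_div lef_pV2 // posrE ?divr_gt0 // (lt_le_trans _ H) // divr_gt0.
  by rewrite lerDl divr_ge0 // ltW.
have H : (c - l)%:R / c%:R <= nC (1 - om c l).
  have -> : nC (1 - om c l) = nC (1 - om c (- l%:Z)).
    exact: esym (nC_1Bom _ _).
  have -> : om c (- l%:Z) = om c (c - l)%N.
    by rewrite -[LHS]mul1r -(@om_mulc c 1) ?(leq_trans _ lc) // -omD; congr om; lia.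
  by apply: chord_le; lia.
apply: (@le_trans _ _ (c%:R / (c - l)%:R)).
  by rewrite -[X in _ <= X]invf_div lef_pV2 // posrE ?divr_gt0 // (lt_le_trans _ H) // divr_gt0.
by rewrite lerDr divr_ge0 // ltW.
Qed.

Lemma om_neq1 c (l : nat) : (0 < l < c)%N -> om c l != 1.
Proof.
move=> lc; rewrite eq_sym -subr_eq0 -nC_eq0; apply/negP => /eqP h.
have [l0 l1] := andP lc.
have [h1|h1] := leqP l.*2 c.
  have := @chord_le c l l0 h1; rewrite h leNgt divr_gt0 // ltr0n; lia.
have := @chord_le c (c - l)%N ltac:(lia) ltac:(lia).
have -> : om c (c - l)%N = (om c l)^*.
  by rewrite -om_conj -[RHS]mul1r -(@om_mulc c 1) ?(leq_trans _ l1) // -omD; congr om; lia.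
by rewrite -om_conj nC_1Bom h leNgt divr_gt0 // ltr0n; lia.
Qed.

Lemma om_sum c (k : int) : (0 < c)%N ->
  \sum_(x < c) om c (x%:Z * k) = (c * (c%:Z %| k)%Z)%:R.
Proof.
move=> c0; have [h|h] := boolP (c%:Z %| k)%Z.
  rewrite muln1 -[in RHS](card_ord c) -sumr_const; apply: eq_bigr => x _.
  by case/dvdzP: h => q ->; rewrite mulrA mulrC om_mulc.
rewrite muln0.
pose l := absz (k %% c%:Z)%Z.
have lE : (l%:Z = k %% c%:Z)%Z by rewrite /l; lia.
have e : om c k = om c l by apply: om_mod => //; rewrite lE modz_mod.
have lc : (0 < l < c)%N.
  apply/andP; split; last by have := @ltz_pmod k c%:Z; lia.
  by rewrite lt0n; apply: contra h => /eqP h; apply/dvdz_mod0P; lia.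
have n1 : 1 - om c k != 0 by rewrite subr_eq0 eq_sym e om_neq1.
apply: (mulfI n1); rewrite mulr0.
under eq_bigr do rewrite mulrC -omX.
by rewrite -[LHS]opprK -mulNr opprB -subrX1 omX mulrC om_mulc // subrr oppr0.
Qed.

End cexp.

(** The Bezout coefficient of d, not reduced modulo c; for d coprime to c it is an inverse of d
    modulo c. *)
Definition zinv (c : nat) (d : int) : int := (egcdz d c%:Z).1.

Lemma zinvP c d : coprimez d c%:Z -> (zinv c d * d = 1 %[mod c%:Z])%Z.
Proof.
rewrite /zinv => cop; case: egcdzP => u v + _ /=.
move=> e; apply/eqP; rewrite eqz_mod_dvd; apply/dvdzP; exists (- v).
have g1 : gcdz d c%:Z = 1 by exact/eqP.
by rewrite g1 in e; lia.
Qed.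

(** * The coefficients e(m d^-1 / c) *)

Section xi.
Variable R : realType.

(** Zero for d not coprime to c, so that sums over lower rows become sums over all pairs of
    integers. *)
Definition xi (m c : nat) (d : int) : R[i] :=
  if (0 < c)%N && coprimez d c%:Z then om R c (m%:Z * zinv c d) else 0.

Definition rsum m c : R[i] := \sum_(d < c) xi m c d.

Lemma nC_xi m c d : nC (xi m c d) <= 1.
Proof. by rewrite /xi; case: ifP => _; rewrite ?nC_om ?nC0. Qed.

Lemma xiE m c d (u : int) : (0 < c)%N -> (u * d = 1 %[mod c%:Z])%Z ->
  xi m c d = om R c (m%:Z * u).
Proof.
move=> c0 /eqP; rewrite eqz_mod_dvd => /dvdzP[q e].
have cop : coprimez d c%:Z by apply/coprimezP; exists (u, - q) => /=; lia.
rewrite /xi c0 cop /=; apply: om_mod => //; apply/eqP; rewrite eqz_mod_dvd.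
have /eqP := zinvP cop; rewrite eqz_mod_dvd => /dvdzP[q' e'].
apply/dvdzP; exists (m%:Z * (u * q' - zinv c d * q)).
have e1 : 1 = u * d - q * c%:Z by lia.
have e2 : 1 = zinv c d * d - q' * c%:Z by lia.
transitivity (m%:Z * (zinv c d * (u * d - q * c%:Z) - u * (zinv c d * d - q' * c%:Z))).
  by rewrite -e1 -e2; ring.
ring.
Qed.

End xi.

(** * Kloosterman sums modulo c *)

Section Zc.
Variables (R : realType) (c' : nat).
Local Notation c := c'.+2.
Local Notation A := 'I_c'.+2.

(** Moduli are written [c'.+2] because ordinals of that form carry a nontrivial ring; modulus 1 is
    treated apart in [kl_decomp]. *)
Definition psi (x : A) : R[i] := om R c (val x)%:Z.

Lemma psi_D x y : psi (x + y) = psi x * psi y.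
Proof. by rewrite /psi -omD; apply: om_mod => //=; rewrite -PoszD modz_nat modn_mod -modz_nat. Qed.

Lemma psi_1 x : nC (psi x) = 1. Proof. exact: nC_om. Qed.

Lemma psi_M x y : psi (x * y) = om R c ((val x)%:Z * (val y)%:Z).
Proof. by apply: om_mod => //=; rewrite -PoszM modz_nat modn_mod -modz_nat. Qed.

Lemma psi_orth y : \sum_x psi (x * y) = (#|A| * (y == 0))%:R.
Proof.
under eq_bigr do rewrite psi_M.
rewrite om_sum // card_ord; congr ((_ * nat_of_bool _)%:R).
rewrite dvdzE /= -val_eqE /=; apply/idP/eqP => [/dvdn_leq|->//].
by case: (posnP y) => // y0 /(_ isT); rewrite leqNgt ltn_ord.
Qed.

Lemma psi_int (k : int) : psi k%:~R = om R c k.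
Proof.
have h n : psi n%:R = om R c n.
  by apply: om_mod => //; rewrite Zp_nat /= modz_nat modn_mod -modz_nat.
case: k => n; first exact: h.
by rewrite NegzE mulrNz om_conj -pmulrn -h (psiN psi_D psi_1).
Qed.

Lemma unit_int (d : int) : ((d%:~R : A) \is a GRing.unit) = coprimez d c%:Z.
Proof.
rewrite coprimezE /=; case: d => n.
  by rewrite -pmulrn (@unitZpE c n) // coprime_sym.
by rewrite NegzE mulrNz unitrN -pmulrn (@unitZpE c n.+1) // abszN coprime_sym.
Qed.

Lemma xi_psi m (d : int) : xi R m c d =
  if (d%:~R : A) \is a GRing.unit then psi (m%:R / d%:~R) else 0.
Proof.
rewrite /xi unit_int /=; case: ifP => // cop.
have Ud : (d%:~R : A) \is a GRing.unit by rewrite unit_int.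
suff -> : (d%:~R : A)^-1 = (zinv c d)%:~R by rewrite pmulrn -intrM psi_int.
apply: (mulIr Ud); rewrite mulVr // -intrM.
have := zinvP cop => /eqP; rewrite eqz_mod_dvd => /dvdzP[q e].
have -> : zinv c d * d = 1 + q * c%:Z by lia.
by rewrite intrD intrM -[c%:~R]pmulrn (@pchar_Zp c) // mulr0 addr0.
Qed.

Local Notation klc := (kl psi).
Local Notation annA := (@ann A).

Lemma rsum_kl m : rsum R m c = klc m%:R 0.
Proof.
rewrite /rsum /kl [RHS]big_mkcond /=; apply: eq_bigr => d _.
by rewrite xi_psi -pmulrn natr_Zp mul0r addr0.
Qed.

(** Up to sign a periodic discrete antiderivative of [xi] minus its mean: the Fourier coefficient at
    [l] is divided by [1 - psi l], the factor that a unit step in [d] produces. *)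
Definition Bf m (d : int) : R[i] :=
  c%:R^-1 * \sum_(l : A | l != 0) klc m%:R (- l) * psi (l * d%:~R) / (1 - psi l).

Lemma psi_neq1 (l : A) : l != 0 -> 1 - psi l != 0.
Proof.
move=> l0; rewrite subr_eq0 eq_sym om_neq1 // ltn_ord andbT lt0n.
by apply: contra l0 => /eqP e; apply/eqP/val_inj.
Qed.

Lemma Bf_decomp m d : xi R m c d = rsum R m c / c%:R + Bf m d - Bf m (d + 1).
Proof.
have c0 : (c%:R : R[i]) != 0 by rewrite pnatr_eq0.
have -> : rsum R m c / c%:R + Bf m d - Bf m (d + 1) =
  c%:R^-1 * \sum_(l : A) klc m%:R (- l) * psi (l * d%:~R).
  rewrite -addrA /Bf -mulrBr -sumrB rsum_kl mulrC -mulrDr; congr (_ * _).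
  rewrite [RHS](bigD1 0) //= oppr0 mul0r (psi0 psi_D psi_1) mulr1; congr (_ + _).
  apply: eq_bigr => l l0; rewrite intrD mulrDr mulr1 psi_D.
  by field; exact: psi_neq1.
rewrite xi_psi; apply: (mulfI c0); rewrite mulVKf //.
under eq_bigr do rewrite /kl mulr_suml.
rewrite exchange_big /=.
have E (u : A) : \sum_(l : A) psi (m%:R / u + - l * u) * psi (l * d%:~R) =
   psi (m%:R / u) * (c * (d%:~R == u))%:R.
  rewrite -[X in (X * _)%:R](card_ord c) -subr_eq0 -psi_orth mulr_sumr.
  by apply: eq_bigr => l _; rewrite -!psi_D; congr psi; ring.
under eq_bigr do rewrite E.
case: ifP => Ud; last first.
  rewrite mulr0 big1 // => u Uu; case: eqP => [e|_]; last by rewrite muln0 mulr0.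
  by rewrite e Uu in Ud.
rewrite (bigD1 d%:~R) //= eqxx muln1 mulrC big1 ?addr0 // => u /andP[_].
by rewrite eq_sym => /negbTE ->; rewrite muln0 mulr0.
Qed.

(** For a in the annihilator, k a is a multiple of c, and the quotient, which is less than k,
    determines a. *)
Lemma ann_nat k : (0 < k)%N -> (annA k%:R <= k)%N.
Proof.
move=> k0; rewrite /ann -[X in (_ <= X)%N]card_ord.
have h (a : A) : (k * a %/ c < k)%N by rewrite ltn_divLR // ltn_mul2l k0 ltn_ord.
pose f (a : A) := Ordinal (h a).
rewrite -(@card_in_imset _ _ f); first exact: max_card.
move=> a b; rewrite !inE => /eqP ha /eqP hb [] e; apply/val_inj.
have dv (x : A) : k%:R * x = 0 -> (c %| k * x)%N.
  move=> /(congr1 val); rewrite mulr_natl Zp_mulrn /= mulnC => hx; exact/eqP.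
by apply/eqP; rewrite -(eqn_pmul2l k0) -(divnK (dv _ ha)) -(divnK (dv _ hb)) e.
Qed.

(** The sum counts pairs (x, a) with x a = 0. For g = gcd (x, c) one has x in g Z and a in (c / g)
    Z, which leaves at most (c / g) g = c pairs for each divisor g of c. *)
Lemma sum_ann : (\sum_(x : A) annA x <= c * ndiv c)%N.
Proof.
have -> : (\sum_(x : A) annA x = #|[set p : A * A | (p.1 * p.2 == 0)%R]%SET|)%N.
  rewrite -sum1dep_card.
  rewrite -(pair_big_dep xpredT (fun x a : A => (x * a == 0)%R) (fun _ _ => 1%N)) /=.
  by apply: eq_bigr => x _; rewrite sum1dep_card.
pose L := flatten [seq [seq ((g * x)%N, (c %/ g * a)%N) | x <- iota 0 (c %/ g), a <- iota 0 g]
  | g <- divisors c].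
have sL : size L = (c * ndiv c)%N.
  rewrite size_flatten /shape -map_comp sumnE big_map.
  rewrite (eq_big_seq (fun=> c)).
    by rewrite big_const_seq count_predT iter_addn_0 mulnC.
  by move=> g; rewrite -dvdn_divisors //= => gc; rewrite size_allpairs !size_iota divnK.
rewrite -sL cardE -(size_map (fun p : A * A => (val p.1, val p.2))).
apply: uniq_leq_size.
  by rewrite map_inj_uniq ?enum_uniq // => -[x a] [y b] /= [/val_inj -> /val_inj ->].
move=> _ /mapP[[x a] + ->] /=; rewrite mem_enum inE /= => /eqP /(congr1 val) /= xa.
have {}xa : (c %| x * a)%N by exact/eqP.
pose g := gcdn x c.
have g0 : (0 < g)%N by rewrite gcdn_gt0 orbT.
have gx : (g %| x)%N by exact: dvdn_gcdl.
have gc : (g %| c)%N by exact: dvdn_gcdr.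
have q0 : (0 < c %/ g)%N by rewrite divn_gt0 // dvdn_leq.
have ca : (c %/ g %| a)%N.
  have cop : coprime (c %/ g) (x %/ g).
    rewrite /coprime -(eqn_pmul2r g0) muln_gcdl !divnK // mul1n gcdnC //.
  by rewrite -(Gauss_dvdr _ cop) -(dvdn_pmul2r g0) divnK // mulnAC divnK.
apply/flatten_mapP; exists g; first by rewrite -dvdn_divisors.
apply/allpairsP; exists ((x %/ g)%N, (a %/ (c %/ g))%N); split=> /=.
- by rewrite mem_iota /= add0n ltn_divRL // divnK.
- by rewrite mem_iota /= add0n ltn_divLR // mulnC divnK.
- by rewrite [(g * _)%N]mulnC [(c %/ g * _)%N]mulnC !divnK.
Qed.

Lemma card_unitsE : #|[set u : A | u \is a GRing.unit]%SET| = totient c.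
Proof.
by rewrite -(@card_units_Zp c) // /units_Zp cardsT card_sub cardsE.
Qed.

(** Up to 2 m, the count of quadruples gives c^4 times the square of [ndiv c]; dividing by the
    number of units, which is at least c / [ndiv c], costs the third divisor factor. *)
Lemma kl_bound4 m (l : A) : (0 < m)%N ->
  nC (klc m%:R l) ^+ 4 <= (2 * m * c ^ 3 * ndiv c ^ 3)%:R :> R.
Proof.
move=> m0; have := kl_bound psi_D psi_1 psi_orth m%:R l.
rewrite card_unitsE card_ord => h.
have c0 : 0 < c%:R :> R by rewrite ltr0n.
have h2 : (annA m%:R%R * (c ^ 2 * (annA 2%:R%R * (\sum_x annA x) ^ 2)) <= m * (c ^ 2 * (2 * (c * ndiv c) ^ 2)))%N.
  apply: leq_mul; first exact: ann_nat.
  apply: leq_mul => //; apply: leq_mul; first exact: ann_nat.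
  by rewrite leq_exp2r // sum_ann.
rewrite -(ler_pM2l c0); set y := nC _ ^+ 4 in h *.
have y0 : 0 <= y by rewrite exprn_ge0 ?nC_ge0.
apply: (@le_trans _ _ ((totient c * ndiv c)%:R * y)).
  by rewrite ler_wpM2r // ler_nat leq_totient_ndiv.
rewrite natrM mulrAC; apply: (@le_trans _ _ ((m * (c ^ 2 * (2 * (c * ndiv c) ^ 2)))%:R * (ndiv c)%:R)).
  by rewrite ler_wpM2r // (le_trans h) // ler_nat.
by rewrite -!natrM ler_nat; apply/eq_leq; ring.
Qed.

End Zc.

Section kl_final.
Variable R : realType.

(** The exponent is 3/4 from [kl_bound1] plus 1/8, which pays for the harmonic sum over
    frequencies. *)
Definition Ekl (c : nat) : R := c%:R `^ (7 / 8) * (ndiv c)%:R.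

Lemma Ekl_ge0 c : 0 <= Ekl c.
Proof. by rewrite mulr_ge0 // powR_ge0. Qed.

(** 31/16 lies between 15/8, the threshold for [Ekl], and 2; the remaining 1/16 goes to the sum over
    d in [q_prod_le]. *)
Lemma bdd_Ekl : bdd (fun c : nat => Ekl c * c%:R `^ (- (31 / 16))).
Proof.
have p1 : 1 < 17 / 16 :> R by lra.
apply: bdd_le (bdd_divisors p1) => c; first by rewrite mulr_ge0 ?Ekl_ge0 // powR_ge0.
rewrite /Ekl; case: c => [|c].
  by rewrite !powR0 ?mulr0 //; apply/eqP; lra.
rewrite mulrAC -powRD; last by apply/implyP => _; rewrite pnatr_eq0.
by rewrite mulrC (_ : 7 / 8 - 31 / 16 = - (17 / 16)) //; lra.
Qed.

(** Write 1 / l = l^(-9/8) l^(1/8): the first factor is summable and the second is at most n^(1/8).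
    The term l = 0 is 0. *)
Lemma sum_inv_le : exists2 P : R, 0 <= P & forall n : nat,
  \sum_(0 <= l < n.+1) l%:R^-1 <= P * n%:R `^ (1 / 8).
Proof.
have p1 : 1 < 9 / 8 :> R by lra.
have [h0 [P hP]] := bdd_pseries p1; exists P => [|n].
  by have := hP fset0; rewrite big_seq_fset0.
apply: (@le_trans _ _ (\sum_(0 <= l < n.+1) l%:R `^ (- (9 / 8)) * n%:R `^ (1 / 8))).
  rewrite big_nat_cond [X in _ <= X]big_nat_cond; apply: ler_sum => l /andP[/andP[_ ln] _].
  case: l ln => [|l] ln; first by rewrite invr0 mulr_ge0 ?powR_ge0.
  have -> : l.+1%:R^-1 = l.+1%:R `^ (- (9 / 8)) * l.+1%:R `^ (1 / 8) :> R.
    rewrite -powRD; last by apply/implyP => _; rewrite pnatr_eq0.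
    rewrite (_ : - (9 / 8) + 1 / 8 = -1); last by lra.
    by rewrite powR_inv1.
  by rewrite ler_wpM2l ?powR_ge0 // ge0_ler_powR ?nnegrE ?ler_nat //; lra.
rewrite -mulr_suml ler_wpM2r ?powR_ge0 //.
by have := hP [fset x | x in iota 0 n.+1]%fset; rewrite (sum_fset_iota _ _ (@inj_id nat)).
Qed.

Lemma kl_bound1 c' m (l : 'I_c'.+2) : (0 < m)%N ->
  nC (kl (@psi R c') m%:R l) <= 2 * m%:R * c'.+2%:R `^ (3 / 4) * (ndiv c'.+2)%:R.
Proof.
move=> m0; set c := c'.+2; set t := (ndiv c)%:R.
have t1 : 1 <= t by rewrite ler1n /ndiv -has_predT; apply/hasP; exists 1%N; rewrite // -dvdn_divisors.
have m1 : 1 <= m%:R :> R by rewrite ler1n.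
have p0 : 0 <= c%:R `^ (3 / 4) :> R by exact: powR_ge0.
have := @kl_bound4 R c' m l m0; rewrite -/c => h.
rewrite -(@ler_pXn2r _ 4) ?nnegrE ?nC_ge0 ?mulr_ge0 ?ler0n //.
apply: le_trans h _.
have -> : (2 * m * c ^ 3 * ndiv c ^ 3)%:R = 2 * m%:R * c%:R ^+ 3 * t ^+ 3 :> R.
  by rewrite /t -!natrX -!natrM.
rewrite !exprMn.
have -> : (c%:R `^ (3 / 4)) ^+ 4 = c%:R ^+ 3 :> R.
  rewrite -powR_mulrn // -powRrM -(@powR_mulrn _ c%:R) //.
  by rewrite (_ : 3 / 4 * 4%:R = 3%:R) //; field.
have c3 : 0 <= c%:R ^+ 3 :> R by rewrite exprn_ge0.
have t0 : 0 <= t := le_trans ler01 t1.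
have m0R : 0 <= m%:R :> R by [].
apply: ler_pM; [by rewrite !mulr_ge0 | by rewrite exprn_ge0 | | by rewrite ler_weXn2l].
rewrite ler_wpM2r //; apply: ler_pM => //; first by rewrite -natrX ler_nat.
by rewrite -{1}[m%:R]expr1 ler_weXn2l.
Qed.

(* Finite Fourier inversion in d: frequency 0 gives the mean [rsum m c / c], and
   the other frequencies are differences in d. *)
Lemma kl_decomp m : (0 < m)%N -> exists K : R, exists B : nat -> int -> R[i],
  [/\ 0 <= K,
     forall c d, (0 < c)%N -> xi R m c d = rsum R m c / c%:R + B c d - B c (d + 1),
     forall c d, (0 < c)%N -> nC (B c d) <= K * Ekl c &
     forall c, (0 < c)%N -> nC (rsum R m c) <= K * Ekl c].
Proof.
move=> m0; have [P P0 hP] := sum_inv_le.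
(* The first summand of [K] serves [B], the second [rsum]. Modulo 1 every value of [xi] is 1 and
   equals the mean, so nothing is left for [B]. *)
pose K := 2 * m%:R * (2 * P) + 2 * m%:R.
pose B c := if c is c'.+2 then @Bf R c' m else fun=> 0.
have K0 : 0 <= K by rewrite !addr_ge0 // !mulr_ge0.
have E1 : Ekl 1 = 1 by rewrite /Ekl powR1 mul1r.
have m1 : 1 <= m%:R :> R by rewrite ler1n.
have xi1 d : xi R m 1 d = 1.
  rewrite /xi coprimezE coprimen1 /= /om divr1 e1_int //.
have r1 : rsum R m 1 = 1 by rewrite /rsum big_ord1 xi1.
have K1 : 1 <= K by rewrite /K; have := mulr_ge0 (ler0n R m) P0; nra.
have cpow (c' : nat) : c'.+2%:R `^ (3 / 4) <= c'.+2%:R `^ (7 / 8) :> R.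
  by rewrite ler_powR ?ler1n //; lra.
exists K, B; split => //.
- case=> [//|[|c']] d _; last exact: Bf_decomp.
  by rewrite xi1 r1 divr1 addrK.
- case=> [//|[|c']] d _; first by rewrite nC0 mulr_ge0 ?Ekl_ge0.
  rewrite /B /Bf nCM nCV nC_nat; set c := c'.+2.
  have c0 : 0 < c%:R :> R by rewrite ltr0n.
  set M : R := 2 * m%:R * c%:R `^ (3 / 4) * (ndiv c)%:R.
  have M0 : 0 <= M by rewrite !mulr_ge0 ?powR_ge0.
  rewrite mulrC ler_pdivrMr //; apply: le_trans (nC_sum _ _ _) _.
  apply: (@le_trans _ _ (\sum_(l < c) M * (c%:R / l%:R + c%:R / (c - l)%:R))).
    rewrite big_mkcond /=; apply: ler_sum => l _.
    have [l0|l0] := altP eqP; first by rewrite mulr_ge0 // addr_ge0 // divr_ge0.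
    rewrite 2!nCM psi_1 mulr1 nCV ler_pM ?invr_ge0 ?nC_ge0 ?kl_bound1 //.
    apply: chord_inv; rewrite ltn_ord andbT lt0n.
    by apply: contra l0 => /eqP e; apply/eqP/val_inj.
  rewrite -mulr_sumr big_split /= -!mulr_sumr.
  have h1 : \sum_(l < c) l%:R^-1 <= P * c%:R `^ (1 / 8) :> R.
    by apply: le_trans (hP c); rewrite big_mkord [X in _ <= X]big_ord_recr /= lerDl invr_ge0.
  have h2 : \sum_(l < c) (c - l)%:R^-1 <= P * c%:R `^ (1 / 8) :> R.
    apply: le_trans (hP c); rewrite big_mkord [X in _ <= X]big_ord_recl /= invr0 add0r.
    rewrite (reindex_inj rev_ord_inj) /=; apply: ler_sum => i _.
    by rewrite (_ : (c - (c - i.+1))%N = bump 0 i) //; have := ltn_ord i; rewrite /bump; lia.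
  apply: (@le_trans _ _ (M * (c%:R * (P * c%:R `^ (1 / 8)) + c%:R * (P * c%:R `^ (1 / 8))))).
    by rewrite ler_wpM2l // lerD // ler_wpM2l.
  have -> : M * (c%:R * (P * c%:R `^ (1 / 8)) + c%:R * (P * c%:R `^ (1 / 8))) =
     2 * m%:R * (2 * P) * (c%:R `^ (3 / 4) * c%:R `^ (1 / 8) * (ndiv c)%:R) * c%:R by rewrite /M; ring.
  rewrite -powRD; last by apply/implyP => _; rewrite gt_eqF.
  rewrite (_ : 3 / 4 + 1 / 8 = 7 / 8) -/(Ekl c); last by lra.
  by rewrite ler_wpM2r // ler_wpM2r ?Ekl_ge0 // /K lerDl mulr_ge0.
- case=> [//|[|c']] _; first by rewrite r1 nC1 E1 mulr1.
  rewrite rsum_kl; apply: le_trans (kl_bound1 _ m0) _.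
  apply: (@le_trans _ _ (2 * m%:R * Ekl c'.+2)).
    by rewrite -[X in X <= _]mulrA ler_wpM2l ?mulr_ge0 // ler_wpM2r.
  by rewrite ler_wpM2r ?Ekl_ge0 // /K lerDr !mulr_ge0.
Qed.

End kl_final.

(** * Ramanujan sums *)

Section ramanujan.
Local Open Scope fset_scope.
Local Open Scope ring_scope.
Variable R : realType.

Lemma dsum_finite (I : choiceType) (f : I -> R[i]) (s : seq I) : uniq s ->
  (forall i, i \notin s -> f i = 0) -> dsum f (\sum_(i <- s) f i).
Proof.
move=> us f0 e e0; exists [fset i in s] => B sB.
rewrite (_ : \sum_(i <- s) f i = \sum_(i <- [fset i in s]) f i); last first.
  by apply: perm_big; apply: uniq_perm; rewrite ?fset_uniq // => i; rewrite !inE.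
rewrite (big_fset_incl _ sB) ?subrr ?nC0 // => i _; rewrite !inE; exact: f0.
Qed.

Lemma dsumX (I J : choiceType) (f : I -> R[i]) (g : J -> R[i]) a b :
  asum f -> asum g -> dsum f a -> dsum g b ->
  dsum (fun p : I * J => f p.1 * g p.2) (a * b).
Proof.
move=> af ag fa gb.
have [l hl] : exists l, dsum (fun p : I * J => f p.1 * g p.2) l.
  by apply: dsum_exists; apply: asum_le (bddX af ag) => p; rewrite nCM.
suff -> : a * b = l by [].
have h1 : dsum (fun i => f i * b) l by apply: (dsum_fubini hl) => i; exact: dsumZ (f i) gb.
have h2 : dsum (fun i => f i * b) (a * b).
  by rewrite mulrC; apply: dsum_ext (dsumZ b fa) => i; rewrite mulrC.
exact: dsum_uniq h2 h1.
Qed.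

(** Replacing units by their inverses gives the Ramanujan sum in its usual form. *)
Lemma rsumE m c : rsum R m c = \sum_(0 <= d < c | coprime d c) om R c (m * d)%N.
Proof.
case: c => [|[|c']].
- by rewrite /rsum big_ord0 big_geq.
- rewrite /rsum big_ord1 big_mkord big_mkcond big_ord1 /xi coprimezE coprimen1 /=.
  by rewrite muln0 om0 /om divr1 e1_int.
rewrite rsum_kl /kl big_mkord (reindex_inj (can_inj (@GRing.invrK 'I_c'.+2))) /=.
apply: eq_big => u.
  by rewrite unitrV -(natr_Zp u) (@unitZpE c'.+2) // Zp_nat /= modn_small // coprime_sym.
rewrite unitrV => Uu; rewrite mul0r addr0 invrK psi_M.
apply: om_mod => //; rewrite Zp_nat /= PoszM -modzMml.
by rewrite modz_nat modn_mod -modz_nat modzMml.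
Qed.

(** Each x / N is in exactly one way a reduced fraction d / c with c dividing N. *)
Lemma sum_reduced_fractions (V : nmodType) (F : nat -> V) N : (0 < N)%N ->
  \sum_(0 <= x < N) F x =
  \sum_(c <- divisors N) \sum_(0 <= d < c | coprime d c) F (N %/ c * d)%N.
Proof.
move=> N0.
pose L := flatten [seq [seq (N %/ c * d)%N | d <- [seq d <- index_iota 0 c | coprime d c]] | c <- divisors N].
have dv c : c \in divisors N -> (0 < c)%N /\ (N %/ c * c = N)%N.
  by rewrite -dvdn_divisors // => cN; rewrite divnK // (dvdn_gt0 N0).
have gc c d : c \in divisors N -> coprime d c -> (gcdn (N %/ c * d) N = N %/ c)%N.
  by move=> /dv[c0 e] cop; rewrite -[X in gcdn _ X]e -muln_gcdr (eqP cop) muln1.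
have uL : uniq L.
  apply: (@allpairs_uniq_dep _ _ _ (fun c d => (N %/ c * d)%N)) => [||v w].
  - exact: divisors_uniq.
  - by move=> c _; rewrite filter_uniq ?iota_uniq.
  - move=> /allpairsPdep[c [d [cN + ->]]] /allpairsPdep[c' [d' [cN' + ->]]] /=.
    rewrite !mem_filter => /andP[cop _] /andP[cop' _] e.
    have e1 : (N %/ c = N %/ c')%N by rewrite -(gc _ _ cN cop) e gc.
    have [c0 ec] := dv _ cN; have [c0' ec'] := dv _ cN'.
    have q0 : (0 < N %/ c')%N by have := N0; rewrite -{1}ec' muln_gt0 => /andP[].
    have ecc : c = c' by apply/eqP; rewrite -(eqn_pmul2l q0) -{1}e1 ec ec'.
    by subst c'; congr (Tagged _ _); apply/eqP; rewrite -(eqn_pmul2l q0) e.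
have pL : perm_eq (index_iota 0 N) L.
  apply: uniq_perm => // [|x]; first exact: iota_uniq.
  rewrite mem_index_iota /=; apply/idP/flatten_mapP => [xN|[c cN /mapP[d]]].
    pose g := gcdn x N; have g0 : (0 < g)%N by rewrite gcdn_gt0 N0 orbT.
    have gN : (g %| N)%N by exact: dvdn_gcdr.
    have gx : (g %| x)%N by exact: dvdn_gcdl.
    have Ng : (N %/ (N %/ g) = g)%N by rewrite divnA // mulKn.
    exists (N %/ g)%N; first by rewrite -dvdn_divisors // dvdn_div.
    apply/mapP; exists (x %/ g)%N; last by rewrite Ng mulnC divnK.
    rewrite mem_filter mem_index_iota /= ltn_divRL // divnK // xN andbT.
    by rewrite /coprime -(eqn_pmul2r g0) muln_gcdl !divnK // mul1n.
  rewrite mem_filter mem_index_iota => /andP[_ dc] ->.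
  have [c0 e] := dv _ cN; rewrite -[X in (_ < X)%N]e ltn_pmul2l //.
  by have := N0; rewrite -{1}e muln_gt0 => /andP[].
rewrite (perm_big _ pL) /L big_flatten big_map /=; apply: eq_bigr => c _.
by rewrite big_map big_filter.
Qed.

(** By [sum_reduced_fractions] the left side is the sum of e(m x / N) over all x modulo N. *)
Lemma rsum_divisors m N : (0 < N)%N ->
  \sum_(c <- divisors N) rsum R m c = (N * (N %| m)%N)%:R.
Proof.
move=> N0; have := @om_sum R N m N0; rewrite -(big_mkord xpredT (fun x => om R N (x%:Z * m%:Z))).
rewrite sum_reduced_fractions // => h; rewrite -[RHS]h; apply: eq_big_seq => c.
rewrite -dvdn_divisors // => cN; rewrite rsumE; apply: eq_bigr => d _.
rewrite /om; congr e1; have c0 : (0 < c)%N by rewrite (dvdn_gt0 N0).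
have e : (N = N %/ c * c)%N by rewrite divnK.
have c0R : (c%:R : R[i]) != 0 by rewrite pnatr_eq0 -lt0n.
have N0R : (N%:R : R[i]) != 0 by rewrite pnatr_eq0 -lt0n.
rewrite -PoszM -!pmulrn !natrM; apply: (mulIf c0R); apply: (mulIf N0R).
by rewrite divfK // [RHS]mulrAC divfK // {1}e !natrM; ring.
Qed.

Lemma rsum_series m : (0 < m)%N ->
  exists L : R[i], dsum (fun c : nat => rsum R m c / c%:R ^+ 2) L.
Proof.
move=> m0; have [K [B [K0 _ _ hr]]] := kl_decomp R m0.
apply: dsum_exists; apply: asum_le (bddZ K0 (bdd_Ekl R)) => -[|c].
  by rewrite expr0n invr0 mulr0 nC0 !mulr_ge0 ?Ekl_ge0 ?powR_ge0.
rewrite nCM nCV nCX nC_nat mulrA; apply: ler_pM; rewrite ?nC_ge0 ?invr_ge0 ?exprn_ge0 //.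
  exact: hr.
rewrite -powR_invn // ler_powR ?ler1n //; lra.
Qed.

(** [Z] is zeta(2). In the product of the two series the coefficient of N^-2 is the sum of
    [rsum R m c] over c dividing N, which is N or 0; what remains is the sum of 1 / N over N
    dividing m. *)
Lemma rsum_sigma m L : (0 < m)%N ->
  dsum (fun c : nat => rsum R m c / c%:R ^+ 2) L ->
  forall Z, dsum (fun k : nat => (k.+1%:R ^+ 2)^-1) Z ->
  m%:R * (L * Z) = (\sum_(d <- divisors m) d)%:R.
Proof.
move=> m0 hL Z hZ.
pose f (c : nat) := rsum R m c.+1 / c.+1%:R ^+ 2.
pose g (k : nat) : R[i] := (k.+1%:R ^+ 2)^-1.
have hf : dsum f L.
  apply: (proj2 (@dsum_inj R nat nat succn _ L succn_inj _) hL).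
  by move=> [_|c /(_ c)]; [rewrite expr0n invr0 mulr0 | rewrite eqxx].
have ag : asum g.
  have p2 : 1 < 2 :> R by lra.
  apply: asum_le (bdd_inj succn_inj (bdd_pseries p2)) => k /=.
  by rewrite /g nCV nCX nC_nat -powR_invn.
have af : asum f.
  have [K [B [K0 _ _ hr]]] := kl_decomp R m0.
  apply: asum_le (bddZ K0 (bdd_inj succn_inj (bdd_Ekl R))) => c /=.
  rewrite /f nCM nCV nCX nC_nat mulrA; apply: ler_pM; rewrite ?nC_ge0 ?invr_ge0 ?exprn_ge0 //.
    exact: hr.
  rewrite -powR_invn // ler_powR ?ler1n //; lra.
have hF := dsumX af ag hf hZ.
(* The product series regrouped by N = c k, with coordinates N and c. *)
pose F' (q : nat * nat) : R[i] :=
  if (0 < q.1)%N && (q.2 %| q.1)%N then rsum R m q.2 / q.1%:R ^+ 2 else 0.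
pose j (p : nat * nat) := ((p.1.+1 * p.2.+1)%N, p.1.+1).
have j_inj : injective j.
  move=> [a b] [c d] /eqP; rewrite /j xpair_eqE eqSS /= => /andP[+ /eqP ac].
  by rewrite ac eqn_pmul2l // eqSS => /eqP ->.
have hF' : dsum F' (L * Z).
  apply: (proj1 (dsum_inj _ j_inj _)) => [[N c] h|].
    rewrite /F' /=; case: ifP => // /andP[N0 /dvdnP[k e]].
    move: N0; rewrite e muln_gt0 => /andP[k0 c0].
    have := h (c.-1, k.-1); rewrite /j /= !prednK // mulnC -e eqxx //.
  apply: dsum_ext hF => -[c k]; rewrite /comp /F' (_ : _ && _ = true) /f /g; last by rewrite /j dvdn_mulr.
  rewrite -[LHS]/(rsum R m c.+1 / c.+1%:R ^+ 2 * (k.+1%:R ^+ 2)^-1).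
  rewrite -[RHS]/(rsum R m c.+1 / (c.+1 * k.+1)%N%:R ^+ 2).
  by rewrite [in RHS]natrM [in RHS]exprMn [in RHS]invfM [in RHS]mulrA.
pose h (N : nat) : R[i] := (N %| m)%N%:R / N%:R.
have hh : dsum h (L * Z).
  apply: (dsum_fubini hF') => N.
  have := @dsum_finite _ (fun c => F' (N, c)) (divisors N) (divisors_uniq N).
  rewrite (_ : \sum_(c <- divisors N) F' (N, c) = h N).
    apply => c; rewrite /F' /=; case: posnP => //= N0.
    by rewrite dvdn_divisors // => /negbTE ->.
  rewrite /h; case: (posnP N) => [->|N0].
    by rewrite big_seq big1 ?invr0 ?mulr0 // => c _; rewrite /F'.
  rewrite (eq_big_seq (fun c => rsum R m c / N%:R ^+ 2)); last first.
    by move=> c; rewrite -dvdn_divisors // /F' /= N0 => ->.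
  rewrite -mulr_suml rsum_divisors // natrM.
  have N0R : (N%:R : R[i]) != 0 by rewrite pnatr_eq0 -lt0n.
  by field.
have hh' := @dsum_finite _ h (divisors m) (divisors_uniq m).
rewrite (dsum_uniq hh (hh' _)); last first.
  by move=> N; rewrite -dvdn_divisors // /h => /negbTE ->; rewrite mul0r.
have pm : perm_eq (divisors m) [seq (m %/ d)%N | d <- divisors m].
  have inv d : d \in divisors m -> (m %/ (m %/ d) = d)%N.
    by rewrite -dvdn_divisors // => dm; rewrite divnA // mulKn.
  apply: uniq_perm; first exact: divisors_uniq.
    rewrite map_inj_in_uniq ?divisors_uniq // => x y /inv {2}<- /inv {2}<- -> //.
  move=> d; apply/idP/mapP => [dm|[x + ->]].
    exists (m %/ d)%N; last by rewrite inv.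
    by rewrite -dvdn_divisors // dvdn_div // dvdn_divisors.
  by rewrite -!dvdn_divisors //; exact: dvdn_div.
rewrite (perm_big _ pm) big_map natr_sum mulr_sumr; apply: eq_big_seq => d.
rewrite -dvdn_divisors // /h => dm; rewrite dvdn_div // mul1r.
have q0 : ((m %/ d)%:R : R[i]) != 0.
  by rewrite pnatr_eq0 -lt0n divn_gt0 ?(dvdn_gt0 m0) // dvdn_leq.
by apply: (mulIf q0); rewrite divfK // -natrM mulnC divnK.
Qed.

(* The value of zeta(2) cancels between the two instances of rsum_sigma. *)
Lemma rsum_hecke n L1 Ln : (0 < n)%N ->
  dsum (fun c : nat => rsum R 1 c / c%:R ^+ 2) L1 ->
  dsum (fun c : nat => rsum R n c / c%:R ^+ 2) Ln ->
  n%:R * Ln = (\sum_(d <- divisors n) d)%:R * L1.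
Proof.
move=> n0 h1 hn.
have [Z hZ] : exists Z, dsum (fun k : nat => ((k.+1%:R : R[i]) ^+ 2)^-1) Z.
  have p2 : 1 < 2 :> R by lra.
  apply: dsum_exists; apply: asum_le (bdd_inj succn_inj (bdd_pseries p2)) => k /=.
  by rewrite nCV nCX nC_nat -powR_invn.
have e1 : L1 * Z = 1.
  by have := rsum_sigma (ltn0Sn 0) h1 hZ; rewrite mul1r => ->; rewrite big_seq1.
by rewrite -(rsum_sigma n0 hn hZ) -[LHS]mulr1 -e1; ring.
Qed.

End ramanujan.

(** * Gamma function and powers *)

Section gamma.
Variable R : realType.
Local Notation mu := (@lebesgue_measure R).
Local Notation D := (`]0, +oo[%classic : set R).

Definition gint (p t : R) : R := t `^ p * expR (- t).
(* Gamma (p + 1). *)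
Definition rgamma (p : R) : R := \int[mu]_(t in D) gint p t.

Lemma cgamma_real (p : R) : cgamma (p%:C + 1) = (rgamma p)%:C.
Proof.
rewrite /cgamma /rgamma /gint /= addr0 addrK.
under eq_Rintegral do rewrite mul0r cos0 mulr1.
congr (_ +i* _); under eq_Rintegral do rewrite mul0r sin0 mulr0.
by rewrite /Rintegral integral0.
Qed.

(** From t^N <= 2^N N! exp (t / 2); the last factor 2 cancels the rate in the density
    [exponential_pdf (2^-1)], whose integrability is used for domination. *)
Definition gbound (N : nat) : R := 2 ^+ N * N`!%:R * 2.

Lemma gint_ge0 p t : 0 <= gint p t.
Proof. by rewrite mulr_ge0 ?powR_ge0 ?expR_ge0. Qed.

Lemma gint_le (N : nat) (p t : R) : 0 <= p -> p <= N.+1%:R -> 0 < t ->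
  gint p t <= gbound N.+1 * exponential_pdf (2^-1) t.
Proof.
move=> p0 pN t0; rewrite exponential_pdfE; last exact: ltW.
have h1 : t `^ p <= 1 + t ^+ N.+1.
  have [t1|t1] := leP t 1.
    have : t `^ p <= 1 `^ p by rewrite ge0_ler_powR // nnegrE // ltW.
    have := exprn_ge0 N.+1 (ltW t0); rewrite powR1 /=; lra.
  have : t `^ p <= t `^ N.+1%:R by rewrite ler_powR // ltW.
  by rewrite powR_mulrn; [lra | exact: ltW].
have t2 : 0 <= t / 2 by rewrite divr_ge0 // ltW.
have h2 := expR_ge1Dxn N t2.
have F0 : 0 < N.+1`!%:R :> R by rewrite ltr0n fact_gt0.
have F1 : 1 <= 2 ^+ N.+1 * N.+1`!%:R :> R.
  by rewrite -natrX -natrM ler1n muln_gt0 expn_gt0 fact_gt0.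
have h3 : t `^ p <= 2 ^+ N.+1 * N.+1`!%:R * expR (t / 2).
  apply: le_trans h1 _; apply: le_trans (ler_wpM2l (ltW (lt_le_trans ltr01 F1)) h2).
  rewrite mulrDr mulr1 lerD // expr_div_n.
  rewrite [X in _ <= X](_ : _ = t ^+ N.+1) //.
  by field; rewrite !gt_eqF // exprn_gt0.
rewrite /gint /gbound; apply: le_trans (ler_wpM2r (expR_ge0 _) h3) _.
rewrite -[X in X <= _]mulrA -expRD (_ : t / 2 + - t = - 2^-1 * t); last by field.
by rewrite -[X in _ <= X]mulrA (mulrA 2) divff // mul1r.
Qed.

Lemma measurable_gint p : measurable_fun D (gint p).
Proof.
apply: measurable_funTS; apply: measurable_realfun.measurable_funM; first exact: measurable_realfun.measurable_powR.
by apply: measurableT_comp => //; exact: measurable_realfun.oppr_measurable.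
Qed.

Lemma integrable_bound (C : R) : mu.-integrable D (EFin \o (fun t => C * exponential_pdf (2^-1) t)).
Proof.
apply: (@integrableS _ _ _ mu setT) => //.
under [X in _.-integrable _ X]funext do rewrite /= EFinM.
apply: integrableZl => //; by apply: integrable_exponential_pdf; rewrite ?invr_ge0 ?invr_gt0.
Qed.

Lemma integrable_gint p : 0 <= p -> mu.-integrable D (EFin \o gint p).
Proof.
move=> p0; have [N pN] : exists N : nat, p <= N.+1%:R.
  exists (Num.truncn p); exact/ltW/truncnS_gt.
apply: le_integrable (integrable_bound (gbound N.+1)) => //.
  by apply/measurable_realfun.measurable_EFinP; exact: measurable_gint.
move=> t; rewrite /= in_itv /= andbT => t0; rewrite lee_fin ger0_norm ?gint_ge0 //.
by apply: le_trans (gint_le p0 pN t0) (ler_norm _).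
Qed.

(** Only the interval [A, A + 1] of the integral is kept. Since A is free, the bound beats any given
    geometric growth in p. *)
Lemma rgamma_ge (A p : R) : 1 <= A -> 0 <= p -> A `^ p * expR (- (A + 1)) <= rgamma p.
Proof.
move=> A1 p0; set c := _ * _.
have A0 : 0 < A by apply: lt_le_trans A1.
have c0 : 0 <= c by rewrite mulr_ge0 ?powR_ge0 ?expR_ge0.
have ig := integrable_gint p0.
pose B := `[A, A + 1]%classic : set R.
have sub : B `<=` D.
  by move=> t; rewrite /B /= !in_itv /= andbT => /andP[At _]; exact: lt_le_trans A0 At.
have mg := measurable_int _ ig.
have mB : (lebesgue_measure B = 1%:E)%E.
  rewrite /B lebesgue_measure_itv /= lte_fin ltrDl ltr01.
  by rewrite -EFinB (addrC A) addrK.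
have H : (c%:E <= \int[mu]_(t in D) (gint p t)%:E)%E.
  have -> : c%:E = (\int[mu]_(t in B) (cst c%:E) t)%E.
    by rewrite integral_cst; [rewrite [X in (_ * X)%E]mB mule1 | exact: measurable_itv].
  apply: (@le_trans _ _ (\int[mu]_(t in B) (gint p t)%:E)%E); last first.
    apply: ge0_subset_integral => //; first exact: measurable_itv.
    by move=> t _; rewrite lee_fin gint_ge0.
  apply: ge0_le_integral => //; first exact: measurable_itv.
  - exact: measurable_funS mg.
  - move=> t; rewrite /B /= in_itv /= => /andP[At tA]; rewrite lee_fin /c /gint.
    apply: ler_pM; rewrite ?powR_ge0 ?expR_ge0 //.
      by apply: ge0_ler_powR => //; rewrite nnegrE; [exact: ltW | exact: ltW (lt_le_trans A0 At)].
    by rewrite ler_expR lerN2.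
rewrite /rgamma /Rintegral -lee_fin fineK //.
by apply: integrable_fin_num ig; exact: measurable_itv.
Qed.

Lemma rgamma_gt0 p : 0 <= p -> 0 < rgamma p.
Proof.
move=> p0; apply: lt_le_trans (rgamma_ge (lexx 1) p0).
by rewrite powR1 mul1r expR_gt0.
Qed.

Lemma continuous_rgamma p : 0 < p -> {for p, continuous rgamma}.
Proof.
move=> p0.
pose N := Num.truncn (p + 1); have pN : p + 1 <= N.+1%:R by exact/ltW/truncnS_gt.
have := @continuity_under_integral R _ _ mu gint D _ 0 (p + 1) _ _
  (fun t => gbound N.+1 * exponential_pdf (2^-1) t) (integrable_bound _) _ p.
apply => //.
- move=> x; rewrite /= in_itv /= => /andP[x0 _]; exact/integrable_gint/ltW.
- apply: aeW => t; rewrite /= in_itv /= andbT => t0 x _.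
  rewrite /gint; apply: cvgMl.
  rewrite /powR gt_eqF //; apply: continuous_comp; last exact: continuous_expR.
  exact: mulrr_continuous.
- move=> x; rewrite /= in_itv /= => /andP[x0 x1]; apply: aeW => t.
  rewrite /= in_itv /= andbT => t0; rewrite ger0_norm ?gint_ge0 //.
  by apply: gint_le => //; [exact: ltW | apply: le_trans pN; exact: ltW].
- by apply/mem_set; rewrite /= in_itv /= p0 ltrDl ltr01.
Qed.

End gamma.

(** * Mean value bounds for complex functions of a real variable *)

Section real_derivatives.
Variable R : realType.
Implicit Types f g : R -> R.

Lemma rD_eq f (x d d' : R) : is_derive x 1 f d -> d = d' -> is_derive x 1 f d'.
Proof. by move=> h <-. Qed.

Lemma rD_mul f g (x df dg : R) : is_derive x 1 f df -> is_derive x 1 g dg ->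
  is_derive x 1 (fun y => f y * g y) (df * g x + f x * dg).
Proof.
move=> hf hg; apply: rD_eq (is_deriveM hf hg) _.
by rewrite /GRing.scale /= addrC mulrC [X in _ = _ + X]mulrC; ring.
Qed.

Lemma rD_add f g (x df dg : R) : is_derive x 1 f df -> is_derive x 1 g dg ->
  is_derive x 1 (fun y => f y + g y) (df + dg).
Proof. by move=> hf hg; apply: is_deriveD. Qed.

Lemma rD_cst (a x : R) : is_derive x 1 (fun=> a) 0.
Proof. exact: is_derive_cst. Qed.

Lemma rD_id (x : R) : is_derive x 1 (fun y => y) 1.
Proof. exact: is_derive_id. Qed.

Lemma rD_comp f g (x df dg : R) : is_derive x 1 g dg -> is_derive (g x) 1 f df ->
  is_derive x 1 (fun y => f (g y)) (df * dg).
Proof.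
by move=> hg hf; exact: is_derive1_comp hf hg.
Qed.

Lemma rD_scale f (a x df : R) : is_derive x 1 f df -> is_derive x 1 (fun y => a * f y) (a * df).
Proof.
by move=> hf; have := rD_mul (rD_cst a x) hf; rewrite mul0r add0r.
Qed.

Lemma rD_bound f (df : R -> R) (a b M : R) : a <= b ->
  (forall x : R, is_derive x 1 f (df x)) -> (forall x, a <= x <= b -> `|df x| <= M) ->
  `|f b - f a| <= M * (b - a).
Proof.
move=> ab hf hM.
have hf' x : x \in `]a, b[ -> is_derive x 1 f (df x) by move=> _.
have cf : {within `[a, b], continuous f}.
  by apply: derivable_within_continuous => x _; case: (hf x).
have [c cab ->] := MVT_segment ab hf' cf.
rewrite normrM (ger0_norm (_ : 0 <= b - a)) ?subr_ge0 // ler_wpM2r ?subr_ge0 //.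
by apply: hM; move: cab; rewrite in_itv.
Qed.

(** Componentwise, since the mean value theorem is applied to real and imaginary parts separately;
    this costs the factor 2 in [cD_bound]. *)
Definition cD (f f' : R -> R[i])   := forall x : R,
  is_derive x 1 (fun y => complex.Re (f y)) (complex.Re (f' x)) /\
  is_derive x 1 (fun y => complex.Im (f y)) (complex.Im (f' x)).

Lemma cD_bound (f f' : R -> R[i]) (a b M : R) : a <= b -> cD f f' ->
  (forall x, a <= x <= b -> nC (f' x) <= M) ->
  nC (f b - f a) <= 2 * M * (b - a).
Proof.
move=> ab hf hM.
have h1 := @rD_bound (fun y => complex.Re (f y)) (fun y => complex.Re (f' y)) a b M ab
  (fun x => proj1 (hf x)) (fun x xab => le_trans (nC_Re _) (hM x xab)).
have h2 := @rD_bound (fun y => complex.Im (f y)) (fun y => complex.Im (f' y)) a b M ab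
  (fun x => proj2 (hf x)) (fun x xab => le_trans (nC_Im _) (hM x xab)).
have := nC_le (f b - f a); rewrite !raddfB /=; lra.
Qed.

End real_derivatives.

(** * Powers of i / (t + i V) *)

Section phi.
Variable R : realType.

(** For V > 0 the principal logarithm of i / (t + i V), a number with positive real part. *)
Definition lam (V t : R) : R[i] := (- 2^-1 * ln (V ^+ 2 + t ^+ 2)) +i* atan (t / V).
(* (i / (t + i V)) ^ p, with a logarithm that is smooth in t. *)
Definition phi (p V t : R) : R[i] := cexp (p%:C * lam V t).

Lemma V2t2_gt0 (V t : R) : 0 < V -> 0 < V ^+ 2 + t ^+ 2.
Proof. by move=> V0; rewrite ltr_pwDl ?exprn_gt0 ?sqr_ge0. Qed.

Lemma cexp_realM (p : R) (z : R[i]) : cexp (p%:C * z) =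
  expR (p * complex.Re z) * cos (p * complex.Im z) +i*
  (expR (p * complex.Re z) * sin (p * complex.Im z)).
Proof.
case: z => a b; rewrite /cexp /= !mul0r subr0 addr0.
by apply: complex_ext => /=; ring.
Qed.

Lemma phiE p V t : phi p V t =
  (expR (p * (- 2^-1 * ln (V ^+ 2 + t ^+ 2))) * cos (p * atan (t / V))) +i*
  (expR (p * (- 2^-1 * ln (V ^+ 2 + t ^+ 2))) * sin (p * atan (t / V))).
Proof. by rewrite /phi cexp_realM. Qed.

Lemma nC_phi p V t : 0 < V -> nC (phi p V t) = (V ^+ 2 + t ^+ 2) `^ (- (p / 2)).
Proof.
move=> V0; rewrite /phi nC_cexp /powR gt_eqF ?V2t2_gt0 //=; congr expR.
by rewrite mul0r subr0; field.
Qed.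

Lemma phiD p q V t : phi (p + q) V t = phi p V t * phi q V t.
Proof. by rewrite /phi rmorphD mulrDl cexpD. Qed.

Lemma cos_sin_atan (V t : R) : 0 < V ->
  cos (atan (t / V)) = V / Num.sqrt (V ^+ 2 + t ^+ 2) /\
  sin (atan (t / V)) = t / Num.sqrt (V ^+ 2 + t ^+ 2).
Proof.
move=> V0; have r0 := V2t2_gt0 t V0.
have s0 : 0 < Num.sqrt (V ^+ 2 + t ^+ 2) by rewrite sqrtr_gt0.
have c : cos (atan (t / V)) = V / Num.sqrt (V ^+ 2 + t ^+ 2).
  rewrite cos_atan (_ : 1 + (t / V) ^+ 2 = (V ^+ 2 + t ^+ 2) / V ^+ 2); last first.
    by field; rewrite gt_eqF.
  rewrite sqrtrM ?ltW // sqrtrV ?sqrtr_sqr ?gtr0_norm ?invf_div //.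
  by rewrite exprn_ge0 // ltW.
split=> //; have c0 : cos (atan (t / V)) != 0 by rewrite c gt_eqF // divr_gt0.
have := atanK (t / V); rewrite /tan c => h.
have -> : sin (atan (t / V)) = t / V * (V / Num.sqrt (V ^+ 2 + t ^+ 2)).
  by rewrite -[X in _ = X * _]h divfK // gt_eqF // divr_gt0.
by field; rewrite !gt_eqF.
Qed.

Lemma phi1E (V t : R) : 0 < V -> phi 1 V t = 'i%C / (t +i* V).
Proof.
move=> V0; have r0 := V2t2_gt0 t V0; rewrite phiE !mul1r.
have [-> ->] := cos_sin_atan t V0.
have -> : expR (- 2^-1 * ln (V ^+ 2 + t ^+ 2)) = (Num.sqrt (V ^+ 2 + t ^+ 2))^-1.
  rewrite -powR12_sqrt ?ltW // /powR gt_eqF // -expRN; congr expR; ring.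
have s2 : Num.sqrt (V ^+ 2 + t ^+ 2) ^+ 2 = V ^+ 2 + t ^+ 2 by rewrite sqr_sqrtr // ltW.
have s0 : Num.sqrt (V ^+ 2 + t ^+ 2) != 0 by rewrite gt_eqF // sqrtr_gt0.
set s := Num.sqrt _ in s2 s0 *.
have e x : s^-1 * (x / s) = x / (t ^+ 2 + V ^+ 2).
  by rewrite [t ^+ 2 + _]addrC -s2; field.
rewrite !e; apply: complex_ext => /=; ring.
Qed.

Lemma rD_r2 (V t : R) : is_derive t 1 (fun y => V ^+ 2 + y ^+ 2) (2 * t).
Proof.
apply: (@rD_eq _ (fun y : R => V ^+ 2 + y * y) _ _ _ (rD_add (rD_cst _ _) (rD_mul (rD_id _) (rD_id _)))).
by ring.
Qed.

(** With w = t + i V, the derivative of i / w is -i / w^2 = i (i / w)^2, which raises the exponent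
    by one. *)
Lemma cD_phi p V : 0 < V -> cD (phi p V) (fun t => 'i%C * p%:C * phi (p + 1) V t).
Proof.
move=> V0 t; have r0 := V2t2_gt0 t V0.
have dA : is_derive t 1 (fun y => expR (p * (- 2^-1 * ln (V ^+ 2 + y ^+ 2))))
   (expR (p * (- 2^-1 * ln (V ^+ 2 + t ^+ 2))) * (p * (- 2^-1 * ((V ^+ 2 + t ^+ 2)^-1 * (2 * t))))).
  apply: (@rD_comp _ expR (fun y => p * (- 2^-1 * ln (V ^+ 2 + y ^+ 2))) t _ _ _ (is_derive_expR _)).
  apply: rD_scale; apply: rD_scale.
  exact: (@rD_comp _ (@ln R) (fun y => V ^+ 2 + y ^+ 2) t _ _ (rD_r2 V t) (is_derive1_ln r0)).
have dT : is_derive t 1 (fun y => p * atan (y / V)) (p * ((1 + (t / V) ^+ 2)^-1 * V^-1)).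
  apply: rD_scale; apply: (@rD_comp _ (@atan R) (fun y => y / V) t _ _ _ (is_derive1_atan _)).
  apply: (@rD_eq _ (fun y => y * V^-1) _ _ _ (rD_mul (rD_id _) (rD_cst V^-1 _))); ring.
have dC := rD_mul dA (rD_comp dT (is_derive_cos (p * atan (t / V)))).
have dS := rD_mul dA (rD_comp dT (is_derive_sin (p * atan (t / V)))).
have [cE sE] := cos_sin_atan t V0.
have s2 : Num.sqrt (V ^+ 2 + t ^+ 2) ^+ 2 = V ^+ 2 + t ^+ 2 by rewrite sqr_sqrtr // ltW.
have s0 : Num.sqrt (V ^+ 2 + t ^+ 2) != 0 by rewrite gt_eqF // sqrtr_gt0.
have eT : (1 + (t / V) ^+ 2)^-1 * V^-1 = V / (V ^+ 2 + t ^+ 2).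
  by field; rewrite !gt_eqF.
have P1 : phi (p + 1) V t =
   phi p V t * ((V / (V ^+ 2 + t ^+ 2)) +i* (t / (V ^+ 2 + t ^+ 2))).
  rewrite phiD phi1E //; congr (_ * _).
  by apply: complex_ext => /=; rewrite [t ^+ 2 + _]addrC; ring.
split.
  rewrite (_ : (fun y => complex.Re (phi p V y)) = fun y =>
    expR (p * (- 2^-1 * ln (V ^+ 2 + y ^+ 2))) * cos (p * atan (y / V))); last first.
    by apply: funext => y; rewrite phiE.
  apply: rD_eq dC _.
  rewrite P1 phiE /= eT.
  by field; rewrite gt_eqF.
rewrite (_ : (fun y => complex.Im (phi p V y)) = fun y =>
  expR (p * (- 2^-1 * ln (V ^+ 2 + y ^+ 2))) * sin (p * atan (y / V))); last first.
  by apply: funext => y; rewrite phiE.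
apply: rD_eq dS _.
rewrite P1 phiE /= eT.
by field; rewrite gt_eqF.
Qed.

Lemma nCi : nC 'i%C = 1 :> R.
Proof. by rewrite /nC normc_def /= expr0n add0r expr1n sqrtr1. Qed.

Lemma phi_diff p V t M : 0 < V ->
  (forall x, t <= x <= t + 1 -> nC (phi (p + 1) V x) <= M) ->
  nC (phi p V (t + 1) - phi p V t) <= 2 * `|p| * M.
Proof.
move=> V0 hM; have := @cD_bound R _ _ t (t + 1) (`|p| * M) _ (cD_phi p V0).
rewrite lerDl ler01 addrAC subrr add0r mulr1 mulrA; apply=> // x xt.
by rewrite 2!nCM nC_real nCi mul1r ler_wpM2l ?normr_ge0 ?hM.
Qed.

Lemma cD_sub_lin (f f' : R -> R[i]) (w : R[i]) :
  cD f f' -> cD (fun x => f x - w * x%:C) (fun x => f' x - w).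
Proof.
move=> hf x; have [h1 h2] := hf x; case: w => a b.
have d1 : is_derive x 1 (fun y => complex.Re (f y) + - a * y) (complex.Re (f' x) + - a * 1).
  exact: rD_add h1 (rD_scale (- a) (rD_id x)).
have d2 : is_derive x 1 (fun y => complex.Im (f y) + - b * y) (complex.Im (f' x) + - b * 1).
  exact: rD_add h2 (rD_scale (- b) (rD_id x)).
rewrite mulr1 in d1; rewrite mulr1 in d2.
split.
  under [X in is_derive _ _ X _]funext => y.
    rewrite raddfB /= (_ : a * y - b * 0 = a * y); last by rewrite mulr0 subr0.
    rewrite -mulNr; over.
  by rewrite raddfB.
under [X in is_derive _ _ X _]funext => y.
  rewrite raddfB /= (_ : a * 0 + b * y = b * y); last by rewrite mulr0 add0r.
  rewrite -mulNr; over.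
by rewrite raddfB.
Qed.

(* Difference quotient of an antiderivative of [phi s V]: it telescopes over t + Z. *)
Definition dphi s V t : R[i] := (phi (s - 1) V (t + 1) - phi (s - 1) V t) / ('i%C * (s - 1)%:C).
Definition gphi s V t : R[i] := phi s V t - dphi s V t.

Lemma gphi_bound s V t M : 1 < s -> 0 < V ->
  (forall x, t <= x <= t + 1 -> nC (phi (s + 1) V x) <= M) ->
  nC (gphi s V t) <= 4 * s * M.
Proof.
move=> s1 V0 hM.
have s0 : 0 < s - 1 by rewrite subr_gt0.
have M0 : 0 <= M by apply: le_trans (nC_ge0 _) (hM t _); rewrite lexx lerDl ler01.
have h1 x : t <= x <= t + 1 -> nC (phi s V x - phi s V t) <= 2 * (s * M).
  move=> /andP[tx xt]; have := @cD_bound R _ _ t x (s * M) tx (cD_phi s V0).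
  have bd : forall x0, t <= x0 <= x -> nC ('i%C * s%:C * phi (s + 1) V x0) <= s * M.
    move=> y /andP[ty yx]; rewrite 2!nCM nC_real nCi mul1r gtr0_norm; last by lra.
    by rewrite ler_wpM2l ?hM ?ty ?(le_trans yx) //; lra.
  move/(_ bd) => h; apply: le_trans h _.
  by rewrite ler_piMr //; [rewrite !mulr_ge0 //; lra | lra].
pose w := 'i%C * (s - 1)%:C * phi s V t.
have h2 := @cD_bound R _ _ t (t + 1) ((s - 1) * (2 * (s * M))) _ (cD_sub_lin w (cD_phi (s - 1) V0)).
have {h2} : nC (phi (s - 1) V (t + 1) - w * (t + 1)%:C - (phi (s - 1) V t - w * t%:C))
   <= 2 * ((s - 1) * (2 * (s * M))).
  have := h2 _; rewrite lerDl ler01 => /(_ isT).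
  rewrite [t + 1 - t]addrAC subrr add0r mulr1; apply => x xt.
  rewrite subrK /w -mulrBr 2!nCM nC_real nCi mul1r gtr0_norm // ler_wpM2l ?h1 // ltW //.
have -> : phi (s - 1) V (t + 1) - w * (t + 1)%:C - (phi (s - 1) V t - w * t%:C) =
   - ('i%C * (s - 1)%:C) * gphi s V t.
  have s0C : (s - 1)%:C != 0 :> R[i] by rewrite -(rmorph0 (real_complex R)) (inj_eq (@complexI R)) gt_eqF.
  have i0 : 'i%C != 0 :> R[i] by rewrite -nC_eq0 nCi oner_eq0.
  rewrite /gphi /dphi mulrBr; set X := _ - phi (s - 1) V t; set D := 'i%C * _.
  rewrite [X in _ = _ - X](_ : _ = - X); last first.
    by rewrite mulNr mulrC divfK // mulf_neq0.
  rewrite /w /X -/D (_ : (t + 1)%:C = t%:C + 1); last by rewrite rmorphD.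
  ring.
rewrite nCM nCN nCM nCi mul1r nC_real gtr0_norm // => h.
rewrite -(ler_pM2l s0); apply: le_trans h _; rewrite le_eqVlt; apply/orP; left; apply/eqP; ring.
Qed.

Lemma cln_cexp (w : R[i]) : - pi < complex.Im w <= pi -> cln (cexp w) = w.
Proof.
case: w => a b /= /andP[b1 b2].
rewrite /cln -/(nC _) nC_cexp /= expRK; congr (_ +i* _).
rewrite /carg -/(nC _) nC_cexp /= /cexp /= !mul0r subr0 addr0 mulrAC divff ?mul1r; last first.
  by rewrite gt_eqF // expR_gt0.
case: ifPn => [|].
  rewrite pmulr_rge0 ?expR_gt0 // => sb.
  have [b0|b0] := leP 0 b; first by rewrite cosK // in_itv /= b0.
  have : sin (- b) > 0 by rewrite sin_gt0_pi //; apply/andP; split; lra.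
  by rewrite sinN; lra.
rewrite -ltNge pmulr_rlt0 ?expR_gt0 // => sb.
have [b0|b0] := leP 0 b.
  by have : 0 <= sin b by [rewrite sin_ge0_pi // b0]; lra.
by rewrite cosKN ?opprK //; lra.
Qed.

Lemma cpow_cexp (w s : R[i]) : - pi < complex.Im w <= pi -> cpow (cexp w) s = cexp (s * w).
Proof. by move=> h; rewrite /cpow cln_cexp. Qed.

Lemma cexp_ln (K : R) : 0 < K -> cexp (ln K)%:C = K%:C.
Proof.
move=> K0; rewrite /cexp /= cos0 sin0 lnK //.
by apply: complex_ext => /=; ring.
Qed.

Lemma cexp_powR (K p : R) : 0 < K -> cexp (p%:C * (ln K)%:C) = (K `^ p)%:C.
Proof. by move=> K0; rewrite -rmorphM -cexp_ln ?powR_gt0 // ln_powR. Qed.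

(** The argument atan (t / V) lies strictly between - pi / 2 and pi / 2, so the principal branch
    agrees with [lam]. *)
Lemma cpow_phi (K V t p : R) : 0 < K -> 0 < V ->
  cpow (K%:C * ('i%C / (t +i* V))) p%:C = (K `^ p)%:C * phi p V t.
Proof.
move=> K0 V0; rewrite -phi1E // -cexp_ln // -cexpD rmorph1 mul1r cpow_cexp.
  by rewrite mulrDr cexpD cexp_powR.
have := atan_gtNpi2 (t / V); have := atan_ltpi2 (t / V); have := pi_gt0 R => /= p0 h1 h2.
rewrite add0r; apply/andP; split; lra.
Qed.

Lemma cv_cexp_real (T : Type) (F : set_system T) {FF : Filter F} (u : T -> R) (a : R) (z : R[i]) :
  u @ F --> a -> cv F (fun t => cexp ((u t)%:C * z)) (cexp (a%:C * z)).
Proof.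
move=> ua; rewrite cexp_realM; under [X in cv _ X _]funext do rewrite cexp_realM.
have h (x : R) : (fun t => u t * x) @ F --> a * x by apply: cvgMl.
by apply: cv_ReIm; apply: cvgM; (apply: continuous_cvg; last exact: h);
  [exact: continuous_expR | exact: continuous_cos | exact: continuous_expR | exact: continuous_sin].
Qed.

Lemma rD_quot (f : R -> R) (a : R) : is_derive (0 : R) 1 f a ->
  (fun s => (f (s - 1) - f 0) / (s - 1)) @ (1 : R)^'+ --> a.
Proof.
move=> [df <-]; have h := df.
have s1 : (fun s : R => s - 1) @ (1 : R)^'+ --> (0 : R)^'.
  move=> A [e /= e0 hA]; exists e => // s /= se s1; apply: hA => /=.
    by rewrite sub0r opprB.
  by rewrite subr_eq0 gt_eqF.
have := cvg_comp _ _ s1 h.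
apply: cvg_trans; apply: near_eq_cvg; near=> s.
by rewrite /= /GRing.scale /= mulr1 addr0 mulrC.
Unshelve. all: end_near.
Qed.

Lemma complex_div_real (a b r : R) : (a +i* b) / r%:C = (a / r) +i* (b / r).
Proof.
rewrite -fmorphV /=.
by apply: complex_ext => /=; ring.
Qed.

Lemma cv_dcexp (z : R[i]) :
  cv (1 : R)^'+ (fun s => (cexp ((s - 1)%:C * z) - 1) / (s - 1)%:C) z.
Proof.
case: z => a b.
have dA (x : R) : is_derive (0 : R) 1 (fun y : R => y * x) x.
  by have := rD_mul (rD_id (0:R)) (rD_cst x (0:R)); rewrite mul1r mulr0 addr0.
have dE : is_derive (0 : R) 1 (fun y : R => expR (y * a)) a.
  by have := rD_comp (dA a) (is_derive_expR (0 * a)); rewrite mul0r expR0 mul1r.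
have dC : is_derive (0 : R) 1 (fun y : R => expR (y * a) * cos (y * b)) a.
  have := rD_mul dE (rD_comp (dA b) (is_derive_cos (0 * b))).
  by rewrite !mul0r cos0 sin0 oppr0 mul0r mulr0 addr0 mulr1.
have dS : is_derive (0 : R) 1 (fun y : R => expR (y * a) * sin (y * b)) b.
  have := rD_mul dE (rD_comp (dA b) (is_derive_sin (0 * b))).
  by rewrite !mul0r cos0 sin0 mulr0 add0r expR0 !mul1r.
have hC := rD_quot dC; have hS := rD_quot dS.
rewrite !mul0r expR0 cos0 sin0 !mul1r in hC hS.
apply: cv_eq (cv_ReIm hC hS); apply: nearW => s.
by rewrite cexp_realM /= -complex_div_real; congr (_ / _).
Qed.

Lemma cv_phi (p0 V t : R) : cv (1 : R)^'+ (fun s => phi (s + p0) V t) (phi (1 + p0) V t).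
Proof.
apply: cv_cexp_real; apply: cvgD; last exact: cvg_cst.
exact: cvg_at_right_filter.
Qed.

(** Subtracting 1 from both exponentials in [dphi] splits it into two difference quotients at
    exponent 0. *)
Lemma cv_gphi (V t : R) : exists l, cv (1 : R)^'+ (fun s => gphi s V t) l.
Proof.
have i0 : 'i%C != 0 :> R[i] by rewrite -nC_eq0 nCi oner_eq0.
have := cvM (cv_cst ('i%C^-1)) (cvB (cv_dcexp (lam V (t + 1))) (cv_dcexp (lam V t))).
move=> /(_ _ _ _ _) hd.
have hp := cv_phi 0 V t.
eexists; apply: cv_eq (cvB hp hd); near=> s.
have s0 : (s - 1)%:C != 0 :> R[i].
  rewrite -(rmorph0 (real_complex R)) (inj_eq (@complexI R)) subr_eq0 gt_eqF //.
rewrite addr0 /gphi /dphi -/(phi (s - 1) V (t + 1)) -/(phi (s - 1) V t).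
by field; rewrite i0 andbT; move: s0; rewrite rmorphB rmorph1.
Unshelve. all: end_near.
Qed.

End phi.

(** * The Dirichlet series of the terms [radT0] *)

Section at_right1.
Variable R : realType.

Lemma near12 : \forall s \near (1 : R)^'+, 1 < s /\ s < 2.
Proof.
near=> s; split; near: s; first exact: nbhs_right_gt.
by apply: nbhs_right_lt; rewrite ltr1n.
Unshelve. all: end_near.
Qed.

Lemma cv_sub1 : cv (1 : R)^'+ (fun s => (s - 1)%:C) 0.
Proof.
apply/(@cv_realP R _ _ _ (fun s : R => s - 1) 0); rewrite -[X in _ --> X](subrr (1 : R)).
by apply: cvgB; [exact: cvg_at_right_filter | exact: cvg_cst].
Qed.

Lemma cv_small (u : R -> R[i]) (M : R) :
  (\forall s \near (1 : R)^'+, nC (u s) <= (s - 1) * M) -> cv (1 : R)^'+ u 0.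
Proof.
move=> hu e e0.
have d0 : 0 < e / (`|M| + 1) by rewrite divr_gt0 // ltr_wpDl.
apply: filterS3 hu (cv_sub1 d0) near12 => s h1 h2 [s1 _].
rewrite subr0; apply: (le_lt_trans h1).
rewrite subr0 nC_real ger0_norm ?subr_ge0 ?ltW // ltr_pdivlMr in h2; last by rewrite ltr_wpDl.
apply: le_lt_trans _ h2; rewrite ler_wpM2l ?subr_ge0 ?ltW //.
by have := ler_norm M; lra.
Qed.

Lemma cv_conj (T : Type) (F : set_system T) {FF : Filter F} (u : T -> R[i]) l :
  cv F u l -> cv F (fun t => (conjc (u t))) (conjc l).
Proof. by move=> h e /h; apply: filterS => t; rewrite -rmorphB nC_conj. Qed.

End at_right1.

Section T0_limit.
Variable R : realType.

Definition q (n : nat) (p : R) : R := n.+1%:R `^ (- p).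

Lemma q_ge0 n p : 0 <= q n p. Proof. exact: powR_ge0. Qed.

Lemma qD n p p' : q n (p + p') = q n p * q n p'.
Proof. by rewrite /q opprD powRD //; apply/implyP => _; rewrite pnatr_eq0. Qed.

Lemma q_le_p n p p' : p <= p' -> q n p' <= q n p.
Proof. by move=> h; rewrite /q ler_powR ?ler1n // lerN2. Qed.

Lemma q_le_n n n' p : 0 <= p -> (n <= n')%N -> q n' p <= q n p.
Proof.
move=> p0 h; rewrite /q !powRN lef_pV2 ?posrE ?powR_gt0 //.
by rewrite ge0_ler_powR ?nnegrE ?ler_nat.
Qed.

Lemma q_le1 n p : 0 <= p -> q n p <= 1.
Proof.
move=> p0; apply: le_trans (q_le_n p0 (leq0n n)) _.
by rewrite /q powR1.
Qed.

Lemma bdd_q p : 1 < p -> bdd (fun n : nat => q n p).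
Proof. by move=> p1; exact: bdd_inj succn_inj (bdd_pseries p1). Qed.

Lemma bdd_Eklq : bdd (fun c : nat => Ekl R c.+1 * q c (31 / 16)).
Proof. exact: bdd_inj succn_inj (bdd_Ekl R). Qed.

(** The total exponent 2 s + 1 > 3 is split into 31/16 for a, enough for [Ekl], and 17/16 for j. *)
Lemma q_prod_le (s : R) a j : 1 < s -> q a s * q (a + j) (s + 1) <= q a (31 / 16) * q j (17 / 16).
Proof.
move=> s1; apply: (@le_trans _ _ (q a 1 * (q a (15 / 16) * q j (17 / 16)))); last first.
  by rewrite mulrA -qD (_ : 1 + 15 / 16 = 31 / 16 :> R) //; lra.
apply: ler_pM; rewrite ?q_ge0 //; first by rewrite q_le_p // ltW.
apply: (@le_trans _ _ (q (a + j) (15 / 16 + 17 / 16))); first by rewrite q_le_p //; lra.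
by rewrite qD ler_pM ?q_ge0 ?q_le_n ?leq_addr ?leq_addl //; lra.
Qed.

Lemma q_diff (s : R) n : 1 < s -> 0 <= q n s - q n.+1 s <= s * q n (s + 1).
Proof.
move=> s1; apply/andP; split; first by rewrite subr_ge0 q_le_n //; lra.
have h1 : 1 <= s + 1 by lra.
have := @powR_telescope_ge R (s + 1) n.+1 h1 (ltn0Sn _).
have e1 : 1 - (s + 1) = - s by lra.
have e2 : s + 1 - 1 = s by lra.
by rewrite e1 e2.
Qed.

Lemma q_tel (s : R) n : 1 < s ->
  0 <= (s - 1) * q n s - (q n (s - 1) - q n.+1 (s - 1)) <= (s - 1) * (s * q n (s + 1)).
Proof.
move=> s1; have s1' : 1 <= s by exact: ltW.
have := @powR_telescope_ge R s n.+1 s1' (ltn0Sn _).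
have := @powR_telescope R s n.+1 s1' (ltn0Sn _).
rewrite (_ : 1 - s = - (s - 1)); last by lra.
rewrite -!/(q _ _) => h1 h2; have /andP[h3 h4] := q_diff n s1.
apply/andP; split; first by lra.
have : (s - 1) * (q n s - q n.+1 s) <= (s - 1) * (s * q n (s + 1)).
  by rewrite ler_wpM2l //; lra.
lra.
Qed.

Lemma q_cvg0 (p : R) : 0 < p -> forall e : R, 0 < e -> exists N : nat,
  forall n, (N <= n)%N -> q n p < e.
Proof.
move=> p0 e e0; pose x := e `^ (- p^-1).
exists (Num.truncn x).+1 => n Nn.
have x0 : 0 < x by rewrite powR_gt0.
have xn : x < n.+1%:R.
  by apply: (lt_le_trans (truncnS_gt x)); rewrite ler_nat; exact: leqW.
have : x `^ p < n.+1%:R `^ p by rewrite gt0_ltr_powR // nnegrE ltW.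
rewrite /x -powRrM mulNr mulVf ?gt_eqF // powRN powRr1 ?ltW // => h.
rewrite /q powRN -[X in _ < X]invrK ltf_pV2 ?posrE ?powR_gt0 ?invr_gt0 //.
Qed.

Lemma cv_q n a : cv (1 : R)^'+ (fun s => (q n (s + a))%:C) (q n (1 + a))%:C.
Proof.
have h : (fun s : R => s + a) @ (1 : R)^'+ --> 1 + a.
  by apply: cvgD; [exact: cvg_at_right_filter | exact: cvg_cst].
have n0 : 0 < n.+1%:R^-1 :> R by rewrite invr_gt0.
have e x : (q n x)%:C = cexp (x%:C * (ln n.+1%:R^-1)%:C).
  rewrite cexp_powR // /q; congr (_%:C).
  by rewrite -powR_inv1 // -powRrM mulN1r.
by rewrite e; under [X in cv _ X _]funext do rewrite e; exact: cv_cexp_real.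
Qed.

(* The pair (c, d) with c, d > 0 is indexed by (c - 1, d - 1). *)
Definition fT0 (m : nat) (s : R) (p : nat * nat) : R[i] :=
  xi R m p.1.+1 p.2.+1 * (q p.1 s * q p.2 s)%:C.

Lemma nC_fT0 m s p : nC (fT0 m s p) <= q p.1 s * q p.2 s.
Proof.
rewrite /fT0 nCM nC_real ger0_norm ?mulr_ge0 ?q_ge0 //.
by rewrite ler_piMl ?nC_xi // mulr_ge0 ?q_ge0.
Qed.

Lemma asum_fT0 m s : 1 < s -> asum (fT0 m s).
Proof. by move=> s1; exact: asum_le (nC_fT0 m s) (bddX (bdd_q s1) (bdd_q s1)). Qed.

(** The pairs with d >= c, by c and d - c. Starting at d = c makes the boundary term of the
    summation by parts of size E(c) / c^2, with E = [Ekl], which is summable over c; a start at d =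
    1 would leave E(c) / c. *)
Definition upper (p : nat * nat) := (p.1, (p.1 + p.2)%N).
Lemma upper_inj : injective upper.
Proof. by move=> [a b] [c d] [-> /eqP]; rewrite eqn_add2l => /eqP ->. Qed.

(* For fixed c, [kl_decomp] and summation by parts in d replace [xi m c d] by its
   mean over d, and (s - 1) times the sum of d ^ (- s) over d >= c tends to 1. *)
Lemma half_limit m rho (K : R -> R[i]) : (0 < m)%N ->
  dsum (fun c : nat => rsum R m c / c%:R ^+ 2) rho ->
  (forall s, 1 < s -> dsum (fT0 m s \o upper) (K s)) ->
  cv (1 : R)^'+ (fun s => (s - 1)%:C * K s) rho.
Proof.
move=> m0 hrho hK.
have [C [B [C0 hxi hB hr]]] := kl_decomp R m0.
have hrho' : dsum (fun c : nat => rsum R m c.+1 / c.+1%:R ^+ 2) rho.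
  apply: (proj2 (@dsum_inj R nat nat succn _ rho succn_inj _) hrho).
  by move=> [_|c /(_ c)]; [rewrite expr0n invr0 mulr0 | rewrite eqxx].
pose gg (p : nat * nat) : R := 4 * C * ((Ekl R p.1.+1 * q p.1 (31 / 16)) * q p.2 (17 / 16)).
have bgg : bdd gg.
  apply: (bddZ (_ : 0 <= 4 * C)); first by rewrite mulr_ge0.
  by apply: bddX bdd_Eklq (bdd_q _); lra.
have [M hM] := proj2 bgg.
(* [rem] is what remains of (s - 1) [fT0] after a difference of [G] in d; summed over both variables
   it is O(s - 1) by the majorant [gg]. *)
pose rem s (p : nat * nat) : R[i] := let d := (p.1 + p.2)%N in
  (q p.1 s)%:C * (rsum R m p.1.+1 / p.1.+1%:R * ((s - 1) * q d s - (q d (s - 1) - q d.+1 (s - 1)))%:C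
    - (s - 1)%:C * B p.1.+1 d.+2 * (q d s - q d.+1 s)%:C).
pose G s (c d : nat) : R[i] := (q c s)%:C *
  (rsum R m c.+1 / c.+1%:R * (q (c + d) (s - 1))%:C + (s - 1)%:C * B c.+1 (c + d).+1%N * (q (c + d) s)%:C).
have rem_le s p : 1 < s -> s < 2 -> nC (rem s p) <= (s - 1) * gg p.
  move=> s1 s2; case: p => c j; rewrite /rem /gg /=.
  have sm : 0 <= s - 1 by lra.
  have E0 := Ekl_ge0 R c.+1.
  have CE0 : 0 <= C * Ekl R c.+1 by rewrite mulr_ge0.
  have /andP[t1 t2] := q_tel (c + j) s1; have /andP[u1 u2] := q_diff (c + j) s1.
  rewrite nCM nC_real ger0_norm ?q_ge0 //.
  have h1 : nC (rsum R m c.+1 / c.+1%:R * ((s - 1) * q (c + j) s - (q (c + j) (s - 1) - q (c + j).+1 (s - 1)))%:C)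
      <= C * Ekl R c.+1 * ((s - 1) * (s * q (c + j) (s + 1))).
    rewrite nCM nC_real (ger0_norm t1) ler_pM ?nC_ge0 //.
    rewrite nCM nCV nC_nat ler_pdivrMr //; apply: le_trans (hr c.+1 isT) _.
    by rewrite ler_peMr // ler1n.
  have h2 : nC ((s - 1)%:C * B c.+1 (c + j).+2 * (q (c + j) s - q (c + j).+1 s)%:C)
      <= C * Ekl R c.+1 * ((s - 1) * (s * q (c + j) (s + 1))).
    rewrite (_ : _ * _ * _ = B c.+1 (c + j).+2 * ((s - 1) * (q (c + j) s - q (c + j).+1 s))%:C); last first.
      by rewrite rmorphM /=; ring.
    rewrite nCM nC_real ger0_norm ?mulr_ge0 //.
    by apply: ler_pM; [exact: nC_ge0 | exact: mulr_ge0 | exact: hB | exact: ler_wpM2l].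
  apply: (@le_trans _ _ (q c s * (2 * (C * Ekl R c.+1 * ((s - 1) * (2 * q (c + j) (s + 1))))))).
    rewrite ler_wpM2l ?q_ge0 //; apply: le_trans (nCB _ _) _.
    have : C * Ekl R c.+1 * ((s - 1) * (s * q (c + j) (s + 1))) <=
           C * Ekl R c.+1 * ((s - 1) * (2 * q (c + j) (s + 1))).
      by apply: ler_wpM2l => //; apply: ler_wpM2l => //; apply: ler_wpM2r; [exact: q_ge0 | exact: ltW].
    lra.
  have := ler_wpM2l (_ : 0 <= 4 * (s - 1) * (C * Ekl R c.+1)) (q_prod_le c j s1).
  by rewrite !mulr_ge0 // => /(_ isT) h; apply: le_trans (le_trans _ h) _;
    rewrite le_eqVlt; apply/orP; left; apply/eqP; ring.
have dec s c j : (s - 1)%:C * (fT0 m s \o upper) (c, j) - rem s (c, j) = G s c j - G s c j.+1.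
  rewrite /fT0 /rem /G /upper /= hxi // addnS.
  rewrite (_ : Posz (c + j).+1 + 1 = (c + j).+2%:Z); last by lia.
  rewrite !(rmorphM, rmorphB) /=; ring.
have arem s : 1 < s -> s < 2 -> asum (rem s).
  move=> s1 s2; apply: asum_le (fun p => rem_le s p s1 s2) (bddZ _ bgg); lra.
have G0 s c : 1 < s -> forall e : R, 0 < e -> exists N : nat, forall d, (N <= d)%N -> nC (G s c d) < e.
  move=> s1 e e0.
  pose D := C * Ekl R c.+1 + (s - 1) * (C * Ekl R c.+1) + 1.
  have E0 : 0 <= C * Ekl R c.+1 by rewrite mulr_ge0 ?Ekl_ge0.
  have sm : 0 < s - 1 by lra.
  have D0 : 0 < D by rewrite ltr_wpDl // addr_ge0 // mulr_ge0 // ltW.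
  have [N hN] := q_cvg0 sm (divr_gt0 e0 D0).
  exists N => d Nd; have {}hN := hN (c + d)%N (leq_trans Nd (leq_addl _ _)).
  rewrite ltr_pdivlMr // mulrC in hN; apply: le_lt_trans _ hN.
  rewrite /G nCM nC_real ger0_norm ?q_ge0 //.
  apply: (@le_trans _ _ (1 * (C * Ekl R c.+1 * q (c + d) (s - 1)
     + (s - 1) * (C * Ekl R c.+1) * q (c + d) (s - 1)))); last first.
    by rewrite mul1r -mulrDl ler_wpM2r ?q_ge0 // lerDl.
  apply: ler_pM; rewrite ?q_ge0 ?nC_ge0 ?q_le1 //; first by lra.
  apply: le_trans (nCD _ _) (lerD _ _).
    rewrite 2!nCM nCV nC_nat nC_real ger0_norm ?q_ge0 // ler_wpM2r ?q_ge0 //.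
    rewrite ler_pdivrMr //; apply: le_trans (hr c.+1 isT) _.
    by rewrite ler_peMr // ler1n.
  rewrite 2!nCM !nC_real (ger0_norm (q_ge0 _ _)) (ger0_norm (ltW sm)).
  apply: ler_pM; rewrite ?q_ge0 ?mulr_ge0 ?nC_ge0 ?(ltW sm) //; last by rewrite q_le_p //; lra.
  by rewrite ler_wpM2l ?(ltW sm) // hB.
have aK s : 1 < s -> asum (fT0 m s \o upper).
  by move=> s1; exact: bdd_inj upper_inj (asum_fT0 m s1).
(* Telescoping in d leaves the boundary values at d = c, that is j = 0. *)
have main s : 1 < s -> s < 2 -> exists2 SE : R[i], nC SE <= (s - 1) * M &
    dsum (fun c => G s c 0%N) ((s - 1)%:C * K s - SE).
  move=> s1 s2; have [SE hSE] := dsum_exists (arem s s1 s2); exists SE.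
    apply: dsum_bound hSE => A; apply: le_trans (nC_sum _ _ _) _.
    apply: (@le_trans _ _ ((s - 1) * \sum_(i <- A) gg i)).
      by rewrite mulr_sumr; apply: ler_sum => p _; exact: rem_le.
    by rewrite ler_wpM2l // subr_ge0 ltW.
  have hD := dsumB (dsumZ (s - 1)%:C (hK s s1)) hSE.
  apply: (dsum_fubini hD) => c; apply: dsum_telescope_nat (dec s c) (G0 s c s1).
  apply: (@bdd_inj _ _ _ (fun d => (c, d)) (fun p => nC ((s - 1)%:C * (fT0 m s \o upper) p - rem s p))) => [? ? []//|].
  apply: asumB (arem s s1 s2).
  apply: asum_le (fun p => _) (bddZ (_ : 0 <= s - 1) (aK s s1)); last by lra.
  by move=> p; rewrite nCM nC_real ger0_norm // subr_ge0 ltW.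
pose l s := summability.sum (fun c => G s c 0%N : R[i]^o).
have hl s : 1 < s -> s < 2 -> dsum (fun c => G s c 0%N) (l s) /\ nC ((s - 1)%:C * K s - l s) <= (s - 1) * M.
  move=> s1 s2; have [SE hSE hG] := main s s1 s2.
  rewrite /l (dsum_sum hG); split => //.
  by rewrite (_ : _ - (_ - _) = SE) //; ring.
have cl : cv (1 : R)^'+ l rho.
  have b1 : bdd (fun c : nat => 2 * C * (Ekl R c.+1 * q c (31 / 16))).
    by apply: bddZ bdd_Eklq; rewrite mulr_ge0.
  have hlim c : cv (1 : R)^'+ (fun s => G s c 0%N) (rsum R m c.+1 / c.+1%:R ^+ 2).
    have h0 : cv (1 : R)^'+ (fun s => (q c (s + 0))%:C * (rsum R m c.+1 / c.+1%:R * (q c (s + - 1))%:C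
        + (s - 1)%:C * B c.+1 c.+1 * (q c (s + 0))%:C))
       ((q c (1 + 0))%:C * (rsum R m c.+1 / c.+1%:R * (q c (1 + - 1))%:C + 0 * B c.+1 c.+1 * (q c (1 + 0))%:C)).
      apply: cvM; first exact: cv_q.
      apply: cvD; apply: cvM; [exact: cv_cst | exact: cv_q | | exact: cv_q].
      by apply: cvM; [exact: cv_sub1 | exact: cv_cst].
    have e1 : (q c (1 + 0))%:C * (rsum R m c.+1 / c.+1%:R * (q c (1 + - 1))%:C + 0 * B c.+1 c.+1 * (q c (1 + 0))%:C)
       = rsum R m c.+1 / c.+1%:R ^+ 2.
      rewrite subrr addr0 mul0r mul0r addr0 /q oppr0 powRr0 rmorph1 mulr1 powR_inv1 //.
      by rewrite fmorphV rmorph_nat mulrC -mulrA -invfM expr2.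
    rewrite -e1; apply: cv_eq h0; apply: nearW => s.
    by rewrite /G addn0 !addr0.
  have hdom : \forall s \near (1 : R)^'+, forall c, nC (G s c 0%N) <= 2 * C * (Ekl R c.+1 * q c (31 / 16)).
    apply: filterS (near12 R) => s [s1 s2] c.
    have E0 : 0 <= C * Ekl R c.+1 by rewrite mulr_ge0 ?Ekl_ge0.
    rewrite /G addn0 nCM nC_real ger0_norm ?q_ge0 //.
    have -> : 2 * C * (Ekl R c.+1 * q c (31 / 16)) = q c (15 / 16) * (2 * (C * Ekl R c.+1) * q c 1).
      by rewrite (_ : 31 / 16 = 15 / 16 + 1) ?qD; [ring | lra].
    apply: ler_pM; rewrite ?q_ge0 ?nC_ge0 //; first by rewrite q_le_p //; lra.
    rewrite mulr2n mulrDl mulrDl; apply: le_trans (nCD _ _) (lerD _ _).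
      rewrite 2!nCM nCV nC_nat nC_real ger0_norm ?q_ge0 // mul1r.
      apply: (@le_trans _ _ (nC (rsum R m c.+1) / c.+1%:R)).
        by rewrite ler_piMr ?q_le1 //; [rewrite divr_ge0 ?nC_ge0 | lra].
      by rewrite /q powR_inv1 // ler_wpM2r ?hr.
    rewrite 2!nCM !nC_real (ger0_norm (q_ge0 _ _)) mul1r ger0_norm; last by lra.
    rewrite -mulrA; apply: (@le_trans _ _ (1 * (C * Ekl R c.+1 * q c 1))); last by rewrite mul1r.
    apply: ler_pM; rewrite ?mulr_ge0 ?nC_ge0 ?q_ge0 //; [lra | lra |].
    by apply: ler_pM; rewrite ?nC_ge0 ?q_ge0 ?hB // q_le_p // ltW.
  have hs : \forall s \near (1 : R)^'+, dsum (fun c => G s c 0%N) (l s).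
    by apply: filterS (near12 R) => s [s1 s2]; case: (hl s s1 s2).
  have [l0 h1 h2] := tannery b1 hlim hdom hs.
  by rewrite (dsum_uniq hrho' h1).
rewrite -[rho]add0r; apply: cv_eq (cvD (cv_small (_ : \forall s \near (1 : R)^'+, nC ((s - 1)%:C * K s - l s) <= (s - 1) * M)) cl).
  by apply: nearW => s; rewrite subrK.
by apply: filterS (near12 R) => s [s1 s2]; case: (hl s s1 s2).
Qed.

Lemma nC_e1B1 (x : R) : nC (e1 x%:C - 1) <= 4 * pi * `|x|.
Proof.
have pi0 := pi_ge0 R.
have lip (f df : R -> R) : (forall x, is_derive x (1 : R) f (df x)) -> (forall x, `|df x| <= 1) ->
    forall t, `|f t - f 0| <= `|t|.
  move=> hf hd t; have [t0|t0] := leP 0 t.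
    by have := rD_bound t0 hf (fun x _ => hd x); rewrite mul1r subr0 (ger0_norm t0).
  have := rD_bound (ltW t0) hf (fun x _ => hd x); rewrite mul1r sub0r (ltr0_norm t0).
  by rewrite distrC.
set t := pi *+ 2 * x.
have h1 : `|cos t - 1| <= `|t|.
  have := lip (@cos R) (fun x => - sin x) (fun x => is_derive_cos x) _ t.
  rewrite cos0; apply => y; rewrite normrN ler_norml; have := cos2Dsin2 y; nra.
have h2 : `|sin t| <= `|t|.
  have := lip (@sin R) cos (fun x => is_derive_sin x) _ t.
  rewrite sin0 subr0; apply => y; rewrite ler_norml; have := cos2Dsin2 y; nra.
have h3 : `|t| = 2 * pi * `|x|.
  by rewrite /t -(mulr_natl pi 2) normrM (ger0_norm (_ : 0 <= 2%:R * pi)) ?mulr_ge0.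
rewrite e1_realE -/t; apply: le_trans (nC_le _) _ => /=.
rewrite subr0; lra.
Qed.

(** From u d + v c = 1 follows u / c + v / d = 1 / (c d), where u inverts d modulo c and v inverts c
    modulo d. *)
Lemma xi_reciprocity m c d : (0 < c)%N -> (0 < d)%N ->
  xi R m c d = e1 (m%:R / (c%:R * d%:R))%:C * (conjc (xi R m d c)).
Proof.
move=> c0 d0; have [cop|ncop] := boolP (coprimez d c); last first.
  rewrite /xi (negbTE ncop) coprimez_sym (negbTE ncop) !andbF.
  by rewrite [X in _ * X](_ : _ = 0) ?mulr0 //; exact: conjc0.
have [[u v] /= uv] := coprimezP _ _ cop.
have ed : (u * d = 1 %[mod c%:Z])%Z.
  by apply/eqP; rewrite eqz_mod_dvd; apply/dvdzP; exists (- v); lia.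
have ec : (v * c = 1 %[mod d%:Z])%Z.
  by apply/eqP; rewrite eqz_mod_dvd; apply/dvdzP; exists (- u); lia.
rewrite (xiE R m c0 ed) (xiE R m d0 ec).
have -> : (conjc (om R d (m%:Z * v))) = om R d (- (m%:Z * v)) by rewrite om_conj.
rewrite !om_real -e1D -rmorphD; congr (e1 _%:C).
have c0R : c%:R != 0 :> R by rewrite pnatr_eq0 -lt0n.
have d0R : d%:R != 0 :> R by rewrite pnatr_eq0 -lt0n.
have uvR : u%:~R * d%:R + v%:~R * c%:R = 1 :> R.
  by have := congr1 (fun k : int => k%:~R : R) uv; rewrite intrD !intrM.
rewrite rmorphN !intrM /=.
have -> : m%:R / (c%:R * d%:R) = m%:R * (u%:~R * d%:R + v%:~R * c%:R) / (c%:R * d%:R) :> R.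
  by rewrite uvR mulr1.
by rewrite -pmulrn; field; rewrite c0R d0R.
Qed.

Definition lower (p : nat * nat) := ((p.1 + p.2)%N, p.1).
Lemma lower_inj : injective lower.
Proof. by move=> [a b] [c d] [+ ac]; rewrite /= ac => /eqP; rewrite eqn_add2l => /eqP ->. Qed.

(* By reciprocity the terms with d < c are conjugate, up to O(1 / cd), to those with d >= c. *)
Lemma L_limit m rho (L : R -> R[i]) : (0 < m)%N ->
  dsum (fun c : nat => rsum R m c / c%:R ^+ 2) rho ->
  (forall s, 1 < s -> dsum (fT0 m s) (L s)) ->
  cv (1 : R)^'+ (fun s => (s - 1)%:C * L s) (rho + (conjc rho)).
Proof.
move=> m0 hrho hL.
have aU s : 1 < s -> asum (fT0 m s \o upper).
  by move=> s1; exact: bdd_inj upper_inj (asum_fT0 m s1).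
pose K s := summability.sum (fun p => (fT0 m s \o upper) p : R[i]^o).
have hK s : 1 < s -> dsum (fT0 m s \o upper) (K s).
  by move=> s1; have [k hk] := dsum_exists (aU s s1); rewrite /K (dsum_sum hk).
have hKlim := half_limit m0 hrho hK.
have p2 : 1 < 2 :> R by lra.
have b1 := bddZ (_ : 0 <= 4 * pi * m%:R :> R) (bddX (bdd_q p2) (bdd_q p2)).
have {}b1 := b1 (mulr_ge0 (mulr_ge0 (ler0n R 4) (pi_ge0 R)) (ler0n R m)).
have [M1 hM1] := proj2 b1; have [M2 hM2] := proj2 (bdd_q p2).
have bound s : 1 < s -> nC (L s - K s - (conjc (K s))) <= M1 + M2.
  move=> s1; have s0 : 0 <= s by lra.
  pose Er p := fT0 m s (lower p) - (conjc (fT0 m s (upper p))).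
  have hEr p : nC (Er p) <= 4 * pi * m%:R * (q p.1 2 * q p.2 2).
    case: p => a j; rewrite /Er /fT0 /upper /lower /= xi_reciprocity //.
    rewrite [X in _ - X](_ : _ = (conjc (xi R m a.+1 (a + j).+1)) * (q a s * q (a + j) s)%:C); last first.
      by rewrite (rmorphM (@conjc R)); congr (_ * _); exact: conjc_real.
    rewrite (_ : _ - _ = (e1 (m%:R / ((a + j).+1%:R * a.+1%:R))%:C - 1) *
        ((conjc (xi R m a.+1 (a + j).+1)) * (q a s * q (a + j) s)%:C)); last first.
      by rewrite [q (a + j) s * _]mulrC; ring.
    rewrite nCM.
    have x0 : 0 <= m%:R / ((a + j).+1%:R * a.+1%:R) :> R by rewrite divr_ge0.
    have h1 := nC_e1B1 (m%:R / ((a + j).+1%:R * a.+1%:R)).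
    rewrite (ger0_norm x0) in h1.
    have h2 : nC ((conjc (xi R m a.+1 (a + j).+1)) * (q a s * q (a + j) s)%:C) <= q a 1 * q (a + j) 1.
      rewrite nCM nC_conj nC_real ger0_norm ?mulr_ge0 ?q_ge0 //.
      rewrite -[X in _ <= X]mul1r ler_pM ?nC_ge0 ?nC_xi ?mulr_ge0 ?q_ge0 //.
      by rewrite ler_pM ?q_ge0 // q_le_p // ltW.
    apply: le_trans (ler_pM (nC_ge0 _) (nC_ge0 _) h1 h2) _.
    have -> : 4 * pi * (m%:R / ((a + j).+1%:R * a.+1%:R)) * (q a 1 * q (a + j) 1) =
        4 * pi * m%:R * (q a 2 * q (a + j) 2).
      have e n : q n 2 = n.+1%:R^-1 * q n 1.
        by rewrite -[2]/(1 + 1)%:R natrD qD {1}/q powR_inv1.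
      by rewrite !e invfM; ring.
    rewrite ler_wpM2l ?mulr_ge0 ?pi_ge0 // ler_wpM2l ?q_ge0 // q_le_n ?leq_addl //.
  have [E hE] := dsum_exists (asum_le hEr b1).
  have hE1 : nC E <= M1.
    apply: dsum_bound hE => A; apply: le_trans (nC_sum _ _ _) _.
    by apply: le_trans (hM1 A); apply: ler_sum => p _; exact: hEr.
  have hDg a : nC (fT0 m s (a, a)) <= q a 2.
    apply: le_trans (nC_fT0 m s (a, a)) _; rewrite /= -qD q_le_p //; lra.
  have [D hD] := dsum_exists (asum_le hDg (bdd_q p2)).
  have hD1 : nC D <= M2.
    apply: dsum_bound hD => A; apply: le_trans (nC_sum _ _ _) _.
    by apply: le_trans (hM2 A); apply: ler_sum => p _; exact: hDg.
  have hlow : dsum (fT0 m s \o lower) (E + (conjc (K s))).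
    by apply: dsum_ext (dsumD hE (dsum_conj (hK s s1))) => p; rewrite /Er /= subrK.
  (* The pairs with c <= d and those with d <= c overlap in the diagonal, which is subtracted
     once. *)
  pose U p := if (p.1 <= p.2)%N then fT0 m s p else 0.
  pose W p := if (p.2 <= p.1)%N then fT0 m s p else 0.
  pose Dg p := if p.1 == p.2 then fT0 m s p else 0.
  have hU : dsum U (K s).
    apply/(dsum_inj _ upper_inj) => [[a b] h|].
      rewrite /U /=; case: ifP => // ab; have := h (a, (b - a)%N).
      by rewrite /upper /= subnKC // eqxx.
    by apply: dsum_ext (hK s s1) => -[a j]; rewrite /U /= leq_addr.
  have hW : dsum W (E + (conjc (K s))).
    apply/(dsum_inj _ lower_inj) => [[a b] h|].
      rewrite /W /=; case: ifP => // ab; have := h (b, (a - b)%N).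
      by rewrite /lower /= subnKC // eqxx.
    by apply: dsum_ext hlow => -[a j]; rewrite /W /= leq_addr.
  have hDD : dsum Dg D.
    have dinj : injective (fun a : nat => (a, a)) by move=> ? ? [].
    apply/(dsum_inj _ dinj) => [[a b] h|].
      by rewrite /Dg /=; case: eqP => // ab; have := h a; rewrite ab eqxx.
    by apply: dsum_ext hD => a; rewrite /Dg /= eqxx.
  have e : L s = K s + (E + (conjc (K s))) - D.
    apply: (dsum_uniq (hL s s1)); apply: dsum_ext (dsumB (dsumD hU hW) hDD) => -[a b].
    by rewrite /U /W /Dg /=; case: ltngtP => _; rewrite ?subr0 ?addr0 ?add0r ?addrK.
  rewrite e (_ : _ - _ - _ = E - D); last by ring.
  by apply: le_trans (nCB _ _) _; rewrite lerD.
have h1 : cv (1 : R)^'+ (fun s => (s - 1)%:C * K s + conjc ((s - 1)%:C * K s)) (rho + conjc rho).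
  by apply: cvD; [exact: hKlim | exact: cv_conj].
have h2 : cv (1 : R)^'+ (fun s => (s - 1)%:C * (L s - K s - conjc (K s))) 0.
  apply: (@cv_small _ _ (M1 + M2)); apply: filterS (near12 R) => s [s1 s2].
  by rewrite nCM nC_real ger0_norm ?ler_wpM2l ?bound // subr_ge0 ltW.
rewrite -[rho + _]add0r; apply: cv_eq (cvD h2 h1).
apply: nearW => s; rewrite (_ : conjc ((s - 1)%:C * K s) = (s - 1)%:C * conjc (K s)); first by ring.
by rewrite (rmorphM (@conjc R)); congr (_ * _); exact: conjc_real.
Qed.

End T0_limit.

(** * The terms [radT] *)

Section T_part.
Local Open Scope fset_scope.
Local Open Scope ring_scope.
Variable R : realType.

Lemma bdd_bool : bdd (fun _ : bool => 1 : R).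
Proof.
split=> //; exists (1 + 1) => A.
have h : A `<=` [fset true; false] by apply/fsubsetP => -[]; rewrite !inE.
apply: le_trans (fset_sum_le (fun=> ler01) h) _.
by rewrite big_fsetU1 ?inE // big_seq_fset1.
Qed.

Lemma bdd_absz (g : nat -> R) : bdd g -> bdd (fun d : int => g (absz d)).
Proof.
move=> hg.
have inj : injective (fun d : int => (absz d, d < 0)).
  by move=> a b [] + e; move: e; case: (ltP a 0); case: (ltP b 0) => //; lia.
have := bdd_inj inj (bddX hg bdd_bool).
by apply: bdd_le => d; [case: hg => h _; exact: h | rewrite /= mulr1].
Qed.

Lemma half_sum_le (A : {fset nat}) : \sum_(k <- A) (2^-1 : R) ^+ k <= 2.
Proof.
apply: fsum_nat_le => n; first by rewrite exprn_ge0 // invr_ge0.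
have -> : \sum_(0 <= k < n) (2^-1 : R) ^+ k = 2 - 2 * 2^-1 ^+ n.
  elim: n => [|n ih]; first by rewrite big_geq // expr0; ring.
  by rewrite big_nat_recr //= ih exprS; field.
by rewrite lerBlDr lerDl mulr_ge0 // exprn_ge0 // invr_ge0.
Qed.

Lemma bdd_half : bdd (fun k : nat => (2^-1 : R) ^+ k).
Proof.
split=> [k|]; first by rewrite exprn_ge0 // invr_ge0.
by exists 2; exact: half_sum_le.
Qed.

Lemma dsum_series (f : nat -> R[i]) l : dsum f l ->
  limn (series (fun k => f k : R[i]^o)) = l.
Proof.
move=> h; apply: (@cv_lim _ _ \oo _ (fun n => series f n)) => e e0.
have [A hA] := h e e0.
exists (\sum_(k <- A) k).+1 => // n /= An.
have := hA [fset k | k in iota 0 n]; rewrite (sum_fset_iota _ _ (@inj_id nat)); apply.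
apply/fsubsetP => k kA; apply/imfsetP; exists k => //=.
have : (k <= \sum_(k <- A) k)%N by rewrite (big_fsetD1 k) //= leq_addr.
by move=> kS; rewrite mem_iota add0n /=; exact: leq_ltn_trans kS An.
Qed.

Variables (x y : R) (y0 : 0 < y).

(** This is |c z + t| for c = a + 1 and z = x + i y. *)
Definition rad (a : nat) (t : R) : R := Num.sqrt ((a.+1%:R * y) ^+ 2 + (a.+1%:R * x + t) ^+ 2).
Definition kap : R := 1 + (2 + `|x|) / y.

Lemma kap_ge1 : 1 <= kap.
Proof. by rewrite lerDl divr_ge0 ?ltW // addr_ge0. Qed.

Lemma cy_gt0 (a : nat) : 0 < a.+1%:R * y. Proof. by rewrite mulr_gt0. Qed.

Lemma rad_gt0 a t : 0 < rad a t.
Proof. by rewrite sqrtr_gt0 V2t2_gt0 // cy_gt0. Qed.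

Lemma nC_phi_rad p a t : nC (phi p (a.+1%:R * y) (a.+1%:R * x + t)) = rad a t `^ (- p).
Proof.
rewrite nC_phi ?cy_gt0 // /rad -powR12_sqrt ?ltW ?V2t2_gt0 ?cy_gt0 // -powRrM.
by congr (_ `^ _); field.
Qed.

(** The imaginary part bounds c, and the real part then bounds |d|. The shift [e] covers the unit
    steps in d on which derivatives of [phi] are estimated. *)
Lemma rad_ge a (d : int) (e : R) : `|e| <= 1 ->
  (a + absz d).+1%:R <= kap * rad a (d%:~R + e).
Proof.
move=> e1; set r := rad _ _.
have c1 : 1 <= a.+1%:R :> R by rewrite ler1n.
have h1 : a.+1%:R * y <= r.
  rewrite -(ger0_norm (ltW (cy_gt0 a))) -sqrtr_sqr ler_wsqrtr // lerDl sqr_ge0 //.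
have h2 : `|a.+1%:R * x + (d%:~R + e)| <= r.
  by rewrite -sqrtr_sqr ler_wsqrtr // lerDr sqr_ge0.
have h3 : `|d%:~R| <= r + 1 + a.+1%:R * `|x| :> R.
  have : `|d%:~R| <= `|a.+1%:R * x + (d%:~R + e)| + `|e| + `|a.+1%:R * x| :> R.
    have E : d%:~R = (a.+1%:R * x + (d%:~R + e)) - e - a.+1%:R * x :> R by ring.
    rewrite {1}E.
    by apply: le_trans (ler_normB _ _) _; rewrite lerD2r; exact: ler_normB.
  rewrite normrM (ger0_norm (_ : 0 <= a.+1%:R)) // => h; apply: (le_trans h).
  by rewrite lerD2r lerD.
have h4 : a.+1%:R <= r / y by rewrite ler_pdivlMr.
have -> : (a + absz d).+1%:R = a.+1%:R + `|d%:~R| :> R.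
  by rewrite -addSn natrD; congr (_ + _); rewrite -intr_norm -abszE.
rewrite /kap mulrDl mul1r.
have -> : (2 + `|x|) / y * r = 2 * (r / y) + `|x| * (r / y) by ring.
have : a.+1%:R * `|x| <= `|x| * (r / y) by rewrite mulrC ler_wpM2l.
lra.
Qed.

Lemma rad_pow_le a (d : int) (e p : R) : `|e| <= 1 -> 0 <= p ->
  rad a (d%:~R + e) `^ (- p) <= kap `^ p * q (a + absz d) p.
Proof.
move=> e1 p0; have h := rad_ge a d e1.
have r0 := rad_gt0 a (d%:~R + e).
have k0 : 0 < kap by apply: lt_le_trans kap_ge1.
rewrite /q !powRN ler_pdivlMr ?powR_gt0 // mulrC ler_pdivrMr ?powR_gt0 //.
rewrite -powRM; [|exact: ltW|exact: ltW].
by apply: ge0_ler_powR => //; rewrite nnegrE // mulr_ge0 // ltW.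
Qed.

Variable m : nat.

(** For mu = -m and lower row (c, d), c = a + 1, this is mu g z - mu g oo. *)
Definition Uz (a : nat) (d : int) : R[i] := m%:R / (a.+1%:R * (a.+1%:R * (x +i* y) + d%:~R)).

Definition Kc (a : nat) : R := 2 * pi * m%:R / a.+1%:R.

Lemma twopii_Uz a d : twopii R * Uz a d =
  (Kc a)%:C * ('i%C / ((a.+1%:R * x + d%:~R) +i* (a.+1%:R * y))).
Proof.
have e1 : a.+1%:R * (x +i* y) + d%:~R = (a.+1%:R * x + d%:~R) +i* (a.+1%:R * y) :> R[i].
  rewrite -(rmorph_nat (real_complex R)) -(rmorph_int (real_complex R)).
  by apply: complex_ext => /=; ring.
have e2 := twopiiE R.
have eK : (Kc a)%:C = (2 * pi)%:C * m%:R / a.+1%:R :> R[i].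
  by rewrite -(rmorph_nat (real_complex R) m) -(rmorph_nat (real_complex R) a.+1) -fmorphV -!rmorphM.
by rewrite /Uz e1 e2 eK; set w := _ +i* (_ * y); rewrite invfM; ring.
Qed.

Definition tterm (s : R) (a : nat) (d : int) (k : nat) : R[i] :=
  (Kc a `^ (k%:R + s))%:C * phi (k%:R + s) (a.+1%:R * y) (a.+1%:R * x + d%:~R)
  / (rgamma (k%:R + s))%:C.

Hypothesis m0 : (0 < m)%N.

Lemma Kc_gt0 a : 0 < Kc a.
Proof. by rewrite divr_gt0 ?mulr_gt0 ?pi_gt0 // ltr0n. Qed.

Lemma divpow_tterm s a d k :
  divpow (twopii R * Uz a d) (k%:R + s%:C) = tterm s a d k.
Proof.
rewrite -(rmorph_nat (real_complex R)) -rmorphD /divpow cgamma_real twopii_Uz.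
by rewrite cpow_phi ?Kc_gt0 ?cy_gt0.
Qed.

Definition X1 : R := 2 * pi * m%:R * kap.
(** A value of A for [rgamma_ge] that makes X1 / A1 at most 1/2, whence geometric decay in k. *)
Definition A1 : R := 1 + 2 * X1.

Lemma X1_ge0 : 0 <= X1.
Proof. by rewrite !mulr_ge0 ?pi_ge0 // (le_trans ler01) ?kap_ge1. Qed.

(** The exponent [s'] is left free: s' = s gives summability for fixed s, and s' = 2 bounds the
    terms k > 0 uniformly in s. *)
Lemma tterm_le s s' a d k : 1 <= s -> 0 <= s' -> s' <= k%:R + s ->
  nC (tterm s a d k) <= expR (A1 + 1) * (q a s' * q (absz d) s') * 2^-1 ^+ k.
Proof.
move=> s1 s0' ss; have p0 : 0 <= k%:R + s by rewrite addr_ge0 // (le_trans ler01).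
set p := k%:R + s in p0 ss *.
have X0 := X1_ge0.
have A11 : 1 <= A1 by rewrite lerDl mulr_ge0.
have A10 : 0 < A1 by apply: lt_le_trans A11.
rewrite /tterm -/p 2!nCM nCV !nC_real nC_phi_rad (ger0_norm (powR_ge0 _ _)).
have g0 := @rgamma_gt0 R p p0; rewrite (gtr0_norm g0).
have gA := @rgamma_ge R A1 p A11 p0.
have c0 : 0 < A1 `^ p * expR (- (A1 + 1)) by rewrite mulr_gt0 ?powR_gt0 ?expR_gt0.
have r1 : rad a d%:~R `^ (- p) <= kap `^ p * q (a + absz d) p.
  by have := @rad_pow_le a d 0 p; rewrite normr0 addr0; apply.
have k0 : 0 <= kap by apply: le_trans kap_ge1.
have pm0 : 0 <= 2 * pi * m%:R :> R by rewrite !mulr_ge0 ?pi_ge0.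
have eK : Kc a `^ p = (2 * pi * m%:R) `^ p * q a p.
  rewrite /Kc powRM ?invr_ge0 //; congr (_ * _).
  by rewrite -powR_inv1 // -powRrM mulN1r.
apply: (@le_trans _ _ (X1 `^ p * (q a p * q (a + absz d) p) / (A1 `^ p * expR (- (A1 + 1))))).
  apply: ler_pM; rewrite ?mulr_ge0 ?powR_ge0 ?invr_ge0 ?(ltW g0) //; last by rewrite lef_pV2 ?posrE.
  rewrite eK /X1; move: (2 * pi * m%:R) pm0 => M pm0; rewrite powRM // -!mulrA.
  by rewrite ler_wpM2l ?powR_ge0 // [X in _ <= X]mulrCA ler_wpM2l ?q_ge0.
have -> : X1 `^ p * (q a p * q (a + absz d) p) / (A1 `^ p * expR (- (A1 + 1))) =
   expR (A1 + 1) * (q a p * q (a + absz d) p) * (X1 / A1) `^ p.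
  rewrite invfM expRN invrK powRM ?invr_ge0 ?(ltW A10) //.
  by rewrite -(powR_inv1 (ltW A10)) powRAC powR_inv1 ?powR_ge0 //; ring.
have Y1 : X1 / A1 <= 2^-1 by rewrite ler_pdivrMr // /A1; lra.
have Y0 : 0 <= X1 / A1 by rewrite divr_ge0 // ltW.
apply: ler_pM; rewrite ?mulr_ge0 ?expR_ge0 ?q_ge0 ?powR_ge0 //.
  rewrite ler_wpM2l ?expR_ge0 //; apply: ler_pM; rewrite ?q_ge0 //; first exact: q_le_p.
  by apply: le_trans (q_le_p _ ss) _; rewrite q_le_n // leq_addl.
rewrite -powR_mulrn ?invr_ge0 //.
apply: (@le_trans _ _ (2^-1 `^ p)); first by rewrite ge0_ler_powR ?nnegrE ?invr_ge0.
apply: ger_powR; first by rewrite invr_gt0 ltr0n /= invf_le1 // ler1n.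
by rewrite lerDl (le_trans ler01).
Qed.

End T_part.

(** * The limit of the sum of the terms [radT] *)

Section T_limit.
Local Open Scope fset_scope.
Local Open Scope ring_scope.
Variable R : realType.

Definition Phi (w s : R[i]) : R[i] :=
  limn (series (fun k : nat => (divpow (twopii R * w) (k%:R + s) : R[i]^o))).

Lemma dsum_shift (f : nat -> R[i]) l : dsum f l -> dsum (fun k => f k.+1) (l - f 0%N).
Proof.
move=> h; pose g k := f k - (if k == 0%N then f 0%N else 0).
have hg : dsum g (l - f 0%N).
  apply: dsumB h _.
  have := @dsum_finite R nat (fun k => if k == 0%N then f 0%N else 0) [:: 0%N] isT.
  by rewrite big_seq1; apply => i; rewrite inE => /negbTE ->.
have := proj2 (@dsum_inj R nat nat succn g (l - f 0%N) succn_inj _) hg.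
move=> H; apply: dsum_ext (H _) => [k|[_|k /(_ k)]]; rewrite /g /= ?subr0 ?subrr ?eqxx //.
Qed.

Lemma cv_powR (K b : R) : 0 < K ->
  cv (1 : R)^'+ (fun s => (K `^ (b + s))%:C) (K `^ (b + 1))%:C.
Proof.
move=> K0; rewrite -cexp_powR //; under [X in cv _ X _]funext do rewrite -cexp_powR //.
by apply: cv_cexp_real; apply: cvgD; [exact: cvg_cst | exact: cvg_at_right_filter].
Qed.

Lemma cv_rgamma (b : R) : 0 <= b ->
  cv (1 : R)^'+ (fun s => (rgamma (b + s))%:C) (rgamma (b + 1))%:C.
Proof.
move=> b0; apply/(@cv_realP R _ _ _ (fun s => rgamma (b + s)) (rgamma (b + 1))).
apply: (@continuous_cvg _ _ _ _ _ (fun s => b + s) (@rgamma R)).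
  by apply: continuous_rgamma; rewrite ltr_wpDl.
by apply: cvgD; [exact: cvg_cst | exact: cvg_at_right_filter].
Qed.

Variables (x y : R) (y0 : 0 < y) (m : nat) (m0 : (0 < m)%N).
Local Notation Uz := (Uz x y m).
Local Notation tterm := (tterm x y m).
Local Notation V a := (a.+1%:R * y).
Local Notation t a d := (a.+1%:R * x + d%:~R).

Let E1 : R := expR (A1 x y m + 1).
Let E1_ge0 : 0 <= E1. Proof. exact: expR_ge0. Qed.

Lemma Phi_dsum s a d : 1 < s ->
  dsum (tterm s a d) (Phi (Uz a d) s%:C) /\
  nC (Phi (Uz a d) s%:C) <= E1 * 2 * (q a s * q (absz d) s).
Proof.
move=> s1.
have le k : nC (tterm s a d k) <= E1 * (q a s * q (absz d) s) * 2^-1 ^+ k.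
  by apply: tterm_le => //; rewrite ?lerDr // ltW // (lt_trans ltr01).
have b0 : 0 <= E1 * (q a s * q (absz d) s) by rewrite !mulr_ge0 ?q_ge0.
have [l hl] := dsum_exists (asum_le le (bddZ b0 (@bdd_half R))).
have -> : Phi (Uz a d) s%:C = l.
  rewrite /Phi (_ : (fun k : nat => _) = tterm s a d); first exact: dsum_series.
  by apply: funext => k; exact: divpow_tterm.
split=> //; apply: dsum_bound hl => A; apply: le_trans (nC_sum _ _ _) _.
apply: (@le_trans _ _ (\sum_(k <- A) E1 * (q a s * q (absz d) s) * 2^-1 ^+ k)).
  by apply: ler_sum => k _; exact: le.
rewrite -mulr_sumr; apply: le_trans (ler_wpM2l b0 (half_sum_le R A)) _.
by rewrite le_eqVlt; apply/orP; left; apply/eqP; ring.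
Qed.

(** The conjugate appears because mu = -m, while the upper left entry is d^-1 modulo c. *)
Definition fT (s : R) (p : nat * int) : R[i] :=
  conjc (xi R m p.1.+1 p.2) * Phi (Uz p.1 p.2) s%:C.

Lemma nC_cxi c d : nC (conjc (xi R m c d)) <= 1.
Proof. by rewrite nC_conj nC_xi. Qed.

Lemma bdd_qq p : 1 < p -> bdd (fun z : nat * int => q z.1 p * q (absz z.2) p : R).
Proof. by move=> p1; exact: bddX (bdd_q p1) (bdd_absz (bdd_q p1)). Qed.

Lemma asum_fT s : 1 < s -> asum (fT s).
Proof.
move=> s1; apply: asum_le (bddZ (_ : 0 <= E1 * 2) (bdd_qq s1)); last by rewrite mulr_ge0.
move=> [a d]; rewrite /fT nCM; apply: le_trans (proj2 (Phi_dsum a d s1)).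
by rewrite ler_piMl ?nC_ge0 // nC_cxi.
Qed.

Lemma nC_tterm2 s p : 1 < s -> nC (conjc (xi R m p.1.1.+1 p.1.2) * tterm s p.1.1 p.1.2 p.2.+1) <=
  E1 * ((q p.1.1 2 * q (absz p.1.2) 2) * 2^-1 ^+ p.2).
Proof.
move=> s1; case: p => [[a d] k] /=.
rewrite nCM; apply: (@le_trans _ _ (1 * nC (tterm s a d k.+1))).
  by rewrite ler_wpM2r ?nC_ge0 // nC_cxi.
rewrite mul1r; apply: (@le_trans _ _ (E1 * (q a 2 * q (absz d) 2) * 2^-1 ^+ k.+1)).
  apply: tterm_le => //; first exact: ltW.
  by have : 1 <= k.+1%:R :> R; [rewrite ler1n | move: s1; lra].
rewrite -mulrA ler_wpM2l // ler_wpM2l ?mulr_ge0 ?q_ge0 // exprS.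
by apply: ler_piMl; [rewrite exprn_ge0 // invr_ge0 | rewrite invf_le1 // ler1n].
Qed.

Lemma cv_tterm a d k : cv (1 : R)^'+ (fun s => tterm s a d k) (tterm 1 a d k).
Proof.
rewrite /tterm; apply: cvM; first apply: cvM.
- by apply: cv_powR; exact: Kc_gt0.
- have := @cv_phi R k%:R (V a) (t a d); rewrite [1 + _]addrC.
  by apply: cv_eq; apply: nearW => s; rewrite addrC.
apply: cvV; last by apply: cv_rgamma.
by rewrite -(rmorph0 (real_complex R)) (inj_eq (@complexI R)) gt_eqF // rgamma_gt0.
Qed.

(** From k = 1 on, the exponent k + s is at least 2, so the majorant with exponent 2 is summable
    over (c, d, k) and independent of s. *)
Lemma tail_limit : exists2 S1 : R -> R[i],
  (forall s, 1 < s -> dsum (fun p : nat * int =>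
     conjc (xi R m p.1.+1 p.2) * (Phi (Uz p.1 p.2) s%:C - tterm s p.1 p.2 0)) (S1 s)) &
  exists l, cv (1 : R)^'+ S1 l.
Proof.
pose F s (p : nat * int * nat) := conjc (xi R m p.1.1.+1 p.1.2) * tterm s p.1.1 p.1.2 p.2.+1.
have p2 : 1 < 2 :> R by lra.
have bg : bdd (fun p : nat * int * nat => E1 * ((q p.1.1 2 * q (absz p.1.2) 2) * 2^-1 ^+ p.2)).
  exact: bddZ E1_ge0 (bddX (bdd_qq p2) (@bdd_half R)).
pose S1 s := summability.sum (F s : _ -> R[i]^o).
have hS1 s : 1 < s -> dsum (F s) (S1 s).
  move=> s1; have [l hl] := dsum_exists (asum_le (fun p => nC_tterm2 p s1) bg).
  by rewrite /S1 (dsum_sum hl).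
exists S1 => [s s1|].
  apply: (dsum_fubini (hS1 s s1)) => -[a d].
  exact: dsumZ (conjc (xi R m a.+1 d)) (dsum_shift (proj1 (Phi_dsum a d s1))).
have [l _ hl] := @tannery R R (1 : R)^'+ _ _ F (F 1) _ S1 bg
  (fun p => cvM (cv_cst _) (cv_tterm _ _ _))
  (filterS (fun s h p => nC_tterm2 p (proj1 h)) (near12 R))
  (filterS (fun s h => hS1 s (proj1 h)) (near12 R)).
by exists l.
Qed.

(** The terms k = 0 of [fT] without the factor (2 pi m)^s / Gamma (s + 1). *)
Definition f0 (s : R) (p : nat * int) : R[i] :=
  conjc (xi R m p.1.+1 p.2) * ((q p.1 s)%:C * phi s (V p.1) (t p.1 p.2)).

Lemma nC_phi_le s a (d : int) (e : R) : `|e| <= 1 -> 1 < s -> s < 2 ->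
  nC (phi (s + 1) (V a) (t a d + e)) <= kap x y `^ 3 * q (a + absz d) (s + 1).
Proof.
move=> e1 s1 s2; rewrite -addrA nC_phi_rad //.
apply: le_trans (rad_pow_le x y0 a d e1 (_ : 0 <= s + 1)) _; first by lra.
by rewrite ler_wpM2r ?q_ge0 // ler_powR ?kap_ge1 //; lra.
Qed.

Lemma q_absz_le s a (d : int) : 1 < s ->
  q a s * q (a + absz d) (s + 1) <= q a (31 / 16) * q (absz d) (17 / 16) :> R.
Proof. exact: q_prod_le. Qed.

Lemma phi_cvg0 (p : R) a : 0 < p -> forall e : R, 0 < e -> exists N : nat,
  forall d : int, (N <= absz d)%N -> nC (phi p (V a) (t a d)) < e.
Proof.
move=> p0 e e0.
have k0 : 0 < kap x y `^ p by rewrite powR_gt0 // (lt_le_trans ltr01) ?kap_ge1.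
have [N hN] := q_cvg0 p0 (divr_gt0 e0 k0).
exists N => d Nd; rewrite -[t a d]addr0 -addrA nC_phi_rad //.
apply: le_lt_trans (rad_pow_le x y0 a d (_ : `|0| <= 1) (ltW p0)) _; first by rewrite normr0.
by rewrite mulrC -ltr_pdivlMr // hN // (leq_trans Nd) // leq_addl.
Qed.

(** As d runs over all integers, the telescoping part has no boundary term and sums to 0. Hence [f0]
    has the same sum as [h], which has a majorant independent of s. *)
Lemma head_limit (S0 : R -> R[i]) : (forall s, 1 < s -> dsum (f0 s) (S0 s)) ->
  exists l, cv (1 : R)^'+ S0 l.
Proof.
move=> hS0; have [C [B [C0 hxi hB hr]]] := kl_decomp R m0.
pose r c := conjc (rsum R m c); pose B' c d := conjc (B c d).
have hxi' c d : (0 < c)%N -> conjc (xi R m c d) = r c / c%:R + B' c d - B' c (d + 1).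
  move=> c0; rewrite hxi // (rmorphB (@conjc R)) (rmorphD (@conjc R)) (rmorphM (@conjc R)).
  by congr (_ * _ + _ - _); rewrite (fmorphV (@conjc R)) (rmorph_nat (@conjc R)).
pose h s (p : nat * int) : R[i] := (q p.1 s)%:C * (r p.1.+1 / p.1.+1%:R * gphi s (V p.1) (t p.1 p.2)
  + B' p.1.+1 p.2 * (phi s (V p.1) (t p.1 p.2) - phi s (V p.1) (t p.1 (p.2 - 1)))).
(* The exponent 3 bounds s + 1, and the 12 below adds 8 from [gphi_bound] and 4 from [phi_diff],
   both for s < 2. *)
pose K3 := kap x y `^ 3.
pose gg (p : nat * int) : R := 12 * C * K3 * ((Ekl R p.1.+1 * q p.1 (31 / 16)) * q (absz p.2) (17 / 16)).
have K30 : 0 <= K3 by exact: powR_ge0.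
have bgg : bdd gg.
  apply: (bddZ (_ : 0 <= 12 * C * K3)); first by rewrite !mulr_ge0.
  by apply: bddX (bdd_Eklq R) (bdd_absz (bdd_q _)); lra.
have h_le s p : 1 < s -> s < 2 -> nC (h s p) <= gg p.
  move=> s1 s2; case: p => a d; rewrite /h /gg /=.
  set M := K3 * q (a + absz d) (s + 1).
  have M0 : 0 <= M by rewrite mulr_ge0 ?q_ge0.
  have hb u : t a d - 1 <= u -> u <= t a d + 1 -> nC (phi (s + 1) (V a) u) <= M.
    move=> u1 u2; have e : u = t a d + (u - t a d) by rewrite addrC subrK.
    by rewrite e; apply: nC_phi_le => //; rewrite ler_norml; apply/andP; split; lra.
  have g1 : nC (gphi s (V a) (t a d)) <= 8 * M.
    apply: le_trans (gphi_bound s1 (cy_gt0 y0 a) (M := M) _) _.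
      by move=> u /andP[u1 u2]; apply: hb => //; lra.
    by rewrite ler_wpM2r //; lra.
  have g2 : nC (phi s (V a) (t a d) - phi s (V a) (t a (d - 1))) <= 4 * M.
    have e : t a d = t a (d - 1) + 1 by rewrite intrB addrA subrK.
    rewrite [X in phi s _ X - _]e; apply: le_trans (phi_diff (cy_gt0 y0 a) (p := s) (M := M) _) _.
      by move=> u; rewrite -e => /andP[u1 u2]; apply: hb; lra.
    by rewrite ger0_norm ?ler_wpM2r //; lra.
  have E0 : 0 <= C * Ekl R a.+1 by rewrite mulr_ge0 ?Ekl_ge0.
  rewrite nCM nC_real ger0_norm ?q_ge0 //.
  apply: (@le_trans _ _ (q a s * (C * Ekl R a.+1 * (8 * M) + C * Ekl R a.+1 * (4 * M)))).
    rewrite ler_wpM2l ?q_ge0 //; apply: le_trans (nCD _ _) (lerD _ _).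
      rewrite nCM; apply: ler_pM; rewrite ?nC_ge0 // /r nCM nC_conj nCV nC_nat.
      rewrite ler_pdivrMr //; apply: le_trans (hr a.+1 isT) _.
      by rewrite ler_peMr // ler1n.
    by rewrite nCM; apply: ler_pM; rewrite ?nC_ge0 // /B' nC_conj hB.
  have := ler_wpM2l (_ : 0 <= 12 * K3 * (C * Ekl R a.+1)) (q_absz_le a d s1).
  rewrite !mulr_ge0 // => /(_ isT) H; apply: le_trans (le_trans _ H) _;
    rewrite le_eqVlt /M; apply/orP; left; apply/eqP; ring.
have ah s : 1 < s -> s < 2 -> asum (h s).
  by move=> s1 s2; exact: asum_le (fun p => h_le s p s1 s2) bgg.
have af s : 1 < s -> asum (f0 s).
  move=> s1; have k0 : 0 <= kap x y `^ s by exact: powR_ge0.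
  apply: asum_le (bddZ k0 (bdd_qq s1)) => -[a d]; rewrite /f0 /= 2!nCM nC_real ger0_norm ?q_ge0 //.
  apply: (@le_trans _ _ (1 * (q a s * (kap x y `^ s * q (absz d) s)))).
    apply: ler_pM; rewrite ?nC_ge0 ?mulr_ge0 ?q_ge0 ?nC_ge0 ?nC_cxi // ler_wpM2l ?q_ge0 //.
    rewrite -[t a d]addr0 -addrA nC_phi_rad //.
    apply: le_trans (rad_pow_le x y0 a d (_ : `|0| <= 1) _) _; rewrite ?normr0 //; first by lra.
    by rewrite ler_wpM2l // q_le_n ?leq_addl //; lra.
  by rewrite mul1r mulrCA.
(* The factor 1 / (s - 1) does no harm here: s is fixed while telescoping, and only the decay in |d|
   is used. *)
pose G s a (d : int) : R[i] := (q a s)%:C * (B' a.+1 d * phi s (V a) (t a (d - 1))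
   - r a.+1 / a.+1%:R * (phi (s - 1) (V a) (t a d) / ('i%C * (s - 1)%:C))).
have dec s a d : f0 s (a, d) - h s (a, d) = G s a d - G s a (d + 1).
  have e1 : t a (d + 1) = t a d + 1 by rewrite intrD addrA.
  rewrite /f0 /h /G /= hxi' // /gphi /dphi (addrK 1 d) e1.
  ring.
have G0 s a : 1 < s -> forall e : R, 0 < e -> exists N : nat, forall d, (N <= absz d)%N -> nC (G s a d) < e.
  move=> s1 e e0; have sm : 0 < s - 1 by lra.
  have s0 : 0 < s by lra.
  pose D := C * Ekl R a.+1 + 1.
  have E0 : 0 <= C * Ekl R a.+1 by rewrite mulr_ge0 ?Ekl_ge0.
  have D0 : 0 < D by rewrite ltr_wpDl.
  pose D2 := D / (s - 1).
  have D20 : 0 < D2 by rewrite divr_gt0.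
  have e2 : 0 < e / 2 / D by rewrite !divr_gt0.
  have e3 : 0 < e / 2 / D2 by rewrite !divr_gt0.
  have [N1 hN1] := phi_cvg0 a s0 e2; have [N2 hN2] := phi_cvg0 a sm e3.
  exists (N1 + N2).+1 => d Nd.
  have d1 : (N1 <= absz (d - 1)%R)%N by clear -Nd; lia.
  have d2 : (N2 <= absz d)%N by clear -Nd; lia.
  have {}hN1 := hN1 _ d1; have {}hN2 := hN2 _ d2.
  rewrite ltr_pdivlMr // mulrC in hN1; rewrite ltr_pdivlMr // mulrC in hN2.
  rewrite /G nCM nC_real ger0_norm ?q_ge0 //.
  apply: le_lt_trans (ler_wpM2r (nC_ge0 _) (q_le1 a (ltW s0))) _; rewrite mul1r.
  apply: le_lt_trans (nCB _ _) _; rewrite [X in _ < X](splitr e); apply: ltrD.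
    apply: le_lt_trans _ hN1; rewrite nCM ler_wpM2r ?nC_ge0 // /B' nC_conj.
    by apply: le_trans (hB _ _ _) _; rewrite ?lerDl.
  apply: le_lt_trans _ hN2; rewrite nCM.
  have hr' : nC (r a.+1 / a.+1%:R) <= D.
    rewrite nCM nCV nC_nat /r nC_conj ler_pdivrMr //; apply: le_trans (hr a.+1 isT) _.
    apply: (@le_trans _ _ D); first by rewrite lerDl.
    by rewrite ler_peMr ?(ltW D0) // ler1n.
  have hp u : nC (u / ('i%C * (s - 1)%:C)) = nC u / (s - 1).
    by rewrite nCM nCV nCM nCi mul1r nC_real gtr0_norm.
  rewrite hp; apply: le_trans (ler_wpM2r _ hr') _; first by rewrite divr_ge0 ?nC_ge0 // ltW.
  by rewrite /D2 mulrA mulrAC.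
have hh s : 1 < s -> s < 2 -> dsum (h s) (S0 s).
  move=> s1 s2; have hD := dsum_telescope_pairs (asumB (af s s1) (ah s s1 s2)) (dec s) (fun a => G0 s a s1).
  have := dsumB (hS0 s s1) hD; rewrite subr0; apply: dsum_ext => p; ring.
have hlim p : exists l, cv (1 : R)^'+ (fun s => h s p) l.
  case: p => a d; have [lg hg] := @cv_gphi R (V a) (t a d).
  eexists; apply: (@cvM _ _ _ _ (fun s => (q a s)%:C)).
    by have := cv_q a (0 : R); apply: cv_eq; apply: nearW => s; rewrite addr0.
  apply: (@cvD _ _ _ _ (fun s => r a.+1 / a.+1%:R * gphi s (V a) (t a d))).
    apply: cvM; [exact: cv_cst | exact: hg].
  apply: cvM; first exact: cv_cst.
  apply: (@cvB _ _ _ _ (fun s => phi s (V a) (t a d))).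
    by have := cv_phi (0 : R) (V a) (t a d); apply: cv_eq; apply: nearW => s; rewrite addr0.
  by have := cv_phi (0 : R) (V a) (t a (d - 1)); apply: cv_eq; apply: nearW => s; rewrite addr0.
have [h0 hh0] := choice hlim.
have [l _ hl] := @tannery R R (1 : R)^'+ _ _ h h0 gg S0 bgg hh0
  (filterS (fun s hs p => h_le s p (proj1 hs) (proj2 hs)) (near12 R))
  (filterS (fun s hs => hh s (proj1 hs) (proj2 hs)) (near12 R)).
by exists l.
Qed.

(* The terms k > 0 of [Phi] converge uniformly in s; the terms k = 0 are summed
   over d as in [half_limit], with [gphi] in place of the differences of d ^ (- s). *)
Lemma T_limit (S : R -> R[i]) : (forall s, 1 < s -> dsum (fT s) (S s)) ->
  exists l, cv (1 : R)^'+ S l.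
Proof.
move=> hS; have [S1 hS1 [l1 hl1]] := tail_limit.
have pm0 : 0 < 2 * pi * m%:R :> R by rewrite !mulr_gt0 ?pi_gt0 // ltr0n.
pose fac s : R[i] := ((2 * pi * m%:R) `^ (0 + s))%:C / (rgamma (0 + s))%:C.
have g0 s : 0 <= s -> (rgamma s)%:C != 0 :> R[i].
  by move=> s0; rewrite -(rmorph0 (real_complex R)) (inj_eq (@complexI R)) gt_eqF // rgamma_gt0.
have fac0 s : 1 < s -> fac s != 0.
  move=> s1; rewrite mulf_neq0 ?invr_eq0 ?g0 ?add0r //; last by lra.
  by rewrite -(rmorph0 (real_complex R)) (inj_eq (@complexI R)) gt_eqF // powR_gt0.
have cfac : cv (1 : R)^'+ fac (fac 1).
  apply: cvM; first exact: cv_powR.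
  by apply: cvV; [rewrite g0 // add0r | apply: cv_rgamma].
have hS0 s : 1 < s -> dsum (f0 s) ((fac s)^-1 * (S s - S1 s)).
  move=> s1; apply: dsum_ext (dsumZ (fac s)^-1 (dsumB (hS s s1) (hS1 s s1))) => -[a d].
  rewrite /fT /f0 /= -mulrBr opprB addrCA subrr addr0 /tterm mulr0n add0r.
  have -> : Kc R m a `^ s = (2 * pi * m%:R) `^ s * q a s.
    rewrite /Kc powRM ?(ltW pm0) ?invr_ge0 //; congr (_ * _).
    by rewrite -powR_inv1 // -powRrM mulN1r.
  apply: (mulfI (fac0 s s1)); rewrite mulVKf ?fac0 //.
  by rewrite /fac !add0r rmorphM /=; ring.
have [l0 hl0] := head_limit hS0.
exists (fac 1 * l0 + l1).
have h : cv (1 : R)^'+ (fun s => fac s * ((fac s)^-1 * (S s - S1 s)) + S1 s) (fac 1 * l0 + l1).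
  by apply: cvD => //; exact: cvM.
apply: cv_eq h; apply: filterS (near12 R) => s [s1 _].
by rewrite mulVKf ?fac0 // subrK.
Qed.

End T_limit.

(** * The Hecke correspondence on lower rows *)

Section hecke_identity.
Local Open Scope fset_scope.
Local Open Scope ring_scope.
Variable R : realType.

(** [j] is a bijection only between [P] and [Q], so finite sets are pulled back one element at a
    time. *)
Lemma dsum_reindex_on (I J : choiceType) (P : pred I) (Q : pred J) (j : I -> J)
   (f : I -> R[i]) (g : J -> R[i]) l :
  (forall i, ~~ P i -> f i = 0) -> (forall y, ~~ Q y -> g y = 0) ->
  (forall i, P i -> Q (j i) /\ g (j i) = f i) ->
  (forall i i', P i -> P i' -> j i = j i' -> i = i') ->
  (forall y, Q y -> exists2 i, P i & j i = y) ->
  dsum f l -> dsum g l.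
Proof.
move=> f0 g0 jP j_inj j_surj hf e e0; have [A hA] := hf e e0.
exists [fset j i | i in A & P i] => B AB.
have key (s : seq J) : uniq s -> exists D : {fset I},
    (forall i, (i \in D) = P i && (j i \in s)) /\ \sum_(y <- s) g y = \sum_(i <- D) f i.
  elim: s => [_|y s ih /= /andP[ys /ih [D [hD eD]]]].
    by exists fset0; split=> [i|]; rewrite ?inE ?andbF // !big_nil.
  have [Qy|nQy] := boolP (Q y).
    have [i0 Pi0 ji0] := j_surj y Qy.
    have i0D : i0 \notin D by rewrite hD ji0 (negbTE ys) andbF.
    exists (i0 |` D); split=> [i|]; last first.
      by rewrite big_cons big_fsetU1 // eD -(proj2 (jP _ Pi0)) ji0.
    rewrite !inE hD; apply/idP/idP.
      by case/orP => [/eqP ->|/andP[-> ->]]; rewrite ?Pi0 ?ji0 ?eqxx ?orbT.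
    case/andP => Pi /orP[/eqP jy|->]; last by rewrite Pi orbT.
    by rewrite (j_inj i i0) ?eqxx // ji0.
  exists D; split=> [i|]; last by rewrite big_cons g0 // add0r.
  rewrite hD inE; case: (boolP (P i)) => //= Pi.
  by case: eqP => // jy; move: nQy; rewrite -jy (proj1 (jP _ Pi)).
have [D [hD ->]] := key (enum_fset B) (fset_uniq B).
have := hA (A `|` D) (fsubsetUl _ _); congr (nC (_ - _) < e).
apply/esym/big_fset_incl; first exact: fsubsetUr.
move=> i; rewrite inE => /orP[iA|-> //]; rewrite hD negb_and => /orP[/f0 //|h].
have [Pi|/f0 //] := boolP (P i); case/negP: h; apply: (fsubsetP AB).
by apply/imfsetP; exists i => //; rewrite !inE /= iA.
Qed.

Lemma asum_rows (K I : choiceType) (L : seq K) (F : K * I -> R[i]) :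
  (forall k i, k \notin L -> F (k, i) = 0) ->
  (forall k, k \in L -> asum (fun i => F (k, i))) -> asum F.
Proof.
move=> F0 hF.
have hM k : exists M, k \in L -> forall A : {fset I}, \sum_(i <- A) nC (F (k, i)) <= M.
  have [kL|kL] := boolP (k \in L); last by exists 0.
  by have [_ [M hM]] := hF k kL; exists M.
have [M {}hM] := choice hM.
split=> [p|]; first exact: nC_ge0.
exists (\sum_(k <- [fset k in L]) M k) => A.
pose A2 := [fset p.2 | p in A].
apply: (@le_trans _ _ (\sum_(p <- [fset k in L] `*` A2) nC (F p))); last first.
  rewrite big_fsetM; rewrite big_seq [X in _ <= X]big_seq; apply: ler_sum => k.
  by rewrite inE => kL; apply: hM.
rewrite (big_fsetID _ (fun p : K * I => p.1 \in L) A) /= [X in _ + X]big1_seq ?addr0; last first.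
  by move=> [k i] /andP[_]; rewrite !inE /= => /andP[_ kL]; rewrite F0 ?nC0.
apply: fset_sum_le => [p|]; first exact: nC_ge0.
apply/fsubsetP => p; rewrite !inE /= => /andP[pA pL].
rewrite ?pL /=; apply/imfsetP; exists p => //.
Qed.

(* A is the upper left entry, modulo translations, of a matrix of determinant n
   with lower row (C, D). *)
Lemma weight_sum n C' (D : int) : let C := C'.+1 in
  \sum_(A < C | (C%:Z %| A%:Z * D - n%:Z)%Z) om R C (- A%:Z) = conjc (xi R n C D).
Proof.
move=> C; have [cop|ncop] := boolP (coprimez D C).
  have z1 := zinvP cop.
  (* For D coprime to C the congruence has the single solution n D^-1 modulo C. *)
  pose A0 := absz ((n%:Z * zinv C D) %% C%:Z)%Z.
  have A0E : (A0%:Z = (n%:Z * zinv C D) %% C%:Z)%Z by rewrite /A0 gez0_abs // modz_ge0.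
  have A0C : (A0 < C)%N by have := @ltz_pmod (n%:Z * zinv C D) C%:Z isT; rewrite -A0E.
  have hdiv (a : int) : (C%:Z %| a * D - n%:Z)%Z = (a == n%:Z * zinv C D %[mod C%:Z])%Z.
    move: z1 => /eqP; rewrite eqz_mod_dvd => /dvdzP[k hk].
    rewrite eqz_mod_dvd; apply/dvdzP/dvdzP => -[u hu].
      exists (u * zinv C D - a * k).
      have -> : a - n%:Z * zinv C D = (a * D - n%:Z) * zinv C D - a * (zinv C D * D - 1) by ring.
      by rewrite hu hk; ring.
    exists (u * D + n%:Z * k).
    have -> : a * D - n%:Z = (a - n%:Z * zinv C D) * D + n%:Z * (zinv C D * D - 1) by ring.
    by rewrite hu hk; ring.
  rewrite (bigD1 (Ordinal A0C)) /=; last by rewrite hdiv A0E modz_mod.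
  rewrite big1 ?addr0 => [|A /andP[]].
    have -> : xi R n C D = om R C (n%:Z * zinv C D) by rewrite /xi cop.
    rewrite -om_conj; apply: om_mod => //.
    by rewrite A0E modzNm.
  rewrite hdiv => /eqP hA /eqP []; apply/val_inj => /=.
  apply/eqP; rewrite -eqz_nat A0E -hA modz_small //; exact: ltn_ord.
have -> : xi R n C D = 0 by rewrite /xi (negbTE ncop).
rewrite rmorph0.
set W := (X in X = _); pose g := gcdn (absz D) C.
have g0 : (0 < g)%N by rewrite gcdn_gt0 orbT.
have gC : (g %| C)%N by exact: dvdn_gcdr.
have g1 : (1 < g)%N.
  by rewrite ltn_neqAle g0 andbT eq_sym; move: ncop; rewrite coprimezE.
(* Shifting A by C / g preserves the congruence, because g divides D, and multiplies the sum by a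
   root of unity other than 1; so the sum is 0, as is [xi]. *)
pose l := (C %/ g)%N.
have lC : (0 < l < C)%N by rewrite divn_gt0 // dvdn_leq //= ltn_Pdiv.
have lD : (C%:Z %| l%:Z * D)%Z.
  have /dvdzP[u hu] : (g%:Z %| D)%Z by rewrite dvdzE /= dvdn_gcdl.
  apply/dvdzP; exists u; rewrite hu mulrCA -PoszM /l divnK //.
have eW : W = om R C (- l%:Z) * W.
  rewrite {1}/W (reindex_inj (addrI (inord l : 'I_C))) /= mulr_sumr.
  have vE (A : 'I_C) : val (inord l + A) = ((l + A) %% C)%N.
    by rewrite /= inordK //; case/andP: lC.
  apply: eq_big => A.
    have := vE A => /= ->; rewrite -modz_nat /modz.
    rewrite (_ : _ - n%:Z = A%:Z * D - n%:Z + (l%:Z * D - ((l + A)%:Z %/ C%:Z)%Z * D * C%:Z)); last first.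
      by rewrite PoszD; ring.
    set w := (X in _ + X); have wC : (C%:Z %| w)%Z by apply: rpredB => //; exact: dvdz_mull (dvdzz _).
    by rewrite (rpredDr (A%:Z * D - n%:Z) wC).
  move=> _; have := vE A => /= ->; rewrite -omD; apply: om_mod => //.
  by rewrite -opprD -PoszD -modz_nat -modzNm modz_mod modzNm.
apply/eqP; have : (1 - om R C (- l%:Z)) * W == 0 by rewrite mulrBl mul1r -eW subrr.
rewrite mulf_eq0 => /orP[|//].
by rewrite -nC_eq0 nC_1Bom nC_eq0 subr_eq0 eq_sym (negbTE (om_neq1 _ lC)).
Qed.

End hecke_identity.

Section hecke_cosets.
Local Open Scope fset_scope.
Local Open Scope ring_scope.

Lemma eqz_modP (a b c : int) : (a = b %[mod c])%Z <-> exists k, a = b + k * c.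
Proof.
split=> [/eqP|[k ->]]; last by rewrite addrC modzMDl.
by rewrite eqz_mod_dvd => /dvdzP[k hk]; exists k; rewrite -hk addrC subrK.
Qed.

Lemma coprimez_eq1 (a b u v : int) : u * a + v * b = 1 -> coprimez a b.
Proof. by move=> h; apply/coprimezP; exists (u, v). Qed.

Lemma zinv_coprime c (d : int) : coprimez d c%:Z -> coprimez (zinv c d) c%:Z.
Proof.
move=> /zinvP/eqz_modP[k hk]; apply: (@coprimez_eq1 _ _ d (- k)).
by rewrite mulrC hk; ring.
Qed.

(** The inverse of d is a unit modulo c. This reads alpha off the image of [hecke_map]. *)
Lemma gcd_zinv c alpha (d : int) : (0 < c * alpha)%N -> coprimez d c%:Z ->
  gcdn (absz ((zinv c d * alpha%:Z) %% (c * alpha)%:Z)%Z) (c * alpha) = alpha.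
Proof.
move=> C0 /zinv_coprime cop.
have : gcdz ((zinv c d * alpha%:Z) %% (c * alpha)%:Z)%Z (c * alpha)%:Z = alpha%:Z.
  rewrite gcdz_modl PoszM -mulz_gcdl.
  by move/eqP: cop; rewrite /coprimez => ->; rewrite mul1r absz_nat.
by rewrite /gcdz => -[].
Qed.

Lemma bezout_zinv (c : nat) (p d : int) : (d * p = 1 %[mod c%:Z])%Z ->
  (zinv c d = p %[mod c%:Z])%Z.
Proof.
move=> h; have cop : coprimez d c%:Z.
  by case/eqz_modP: h => k hk; apply: (@coprimez_eq1 _ _ p (- k)); rewrite mulrC hk; ring.
case/eqz_modP: (zinvP cop) => u hu; case/eqz_modP: h => v hv.
apply/eqz_modP; exists (p * u - zinv c d * v).
have e0 : zinv c d = zinv c d * (d * p) - zinv c d * v * c%:Z by rewrite hv; ring.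
rewrite {1}e0.
have -> : zinv c d * (d * p) = p * (zinv c d * d) by ring.
by rewrite hu; ring.
Qed.

(* A matrix with lower row (c, d) times [[alpha, b], [0, delta]], alpha delta = n,
   has upper left entry d^-1 alpha modulo C and lower row (C, D) =
   (c alpha, c b + d delta). *)
Definition hecke_map n (p : (nat * nat) * (nat * int)) : (nat * int) * nat :=
  let alpha := (n %/ p.1.1)%N in let c := p.2.1.+1 in let C := (c * alpha)%N in
  ((C.-1, c%:Z * p.1.2%:Z + p.2.2 * p.1.1%:Z), absz ((zinv c p.2.2 * alpha%:Z) %% C%:Z)%Z).

Definition hecke_src n (p : (nat * nat) * (nat * int)) :=
  [&& (0 < p.1.1)%N, (p.1.1 %| n)%N, (p.1.2 < p.1.1)%N & coprimez p.2.2 p.2.1.+1%:Z].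

(** The divisibility provides the upper right entry of a matrix of determinant n. *)
Definition hecke_tgt n (p : (nat * int) * nat) :=
  (p.2 < p.1.1.+1)%N && (p.1.1.+1%:Z %| p.2%:Z * p.1.2 - n%:Z)%Z.

Lemma hecke_map_tgt n p : (0 < n)%N -> hecke_src n p -> hecke_tgt n (hecke_map n p).
Proof.
case: p => [[del b] [a d]] n0 /and4P[/= del0 deln bdel cop]; rewrite /hecke_tgt /=.
set al := (n %/ del)%N; have nE : n = (al * del)%N by rewrite divnK.
have al0 : (0 < al)%N by rewrite divn_gt0 // dvdn_leq.
have C0 : (0 < a.+1 * al)%N by rewrite muln_gt0.
rewrite prednK //; set C := (a.+1 * al)%N in C0 *.
have C0' : C%:Z != 0 by rewrite eqz_nat -lt0n.
apply/andP; split.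
  by rewrite -ltz_nat gez0_abs ?modz_ge0 // ltz_pmod.
rewrite gez0_abs ?modz_ge0 //.
have /eqz_modP[k hk] := modz_mod (zinv a.+1 d * al%:Z) C%:Z; rewrite hk.
have /eqz_modP[u hu] := zinvP cop.
apply/dvdzP; exists (zinv a.+1 d * b%:Z + u * del%:Z + k * (a.+1%:Z * b%:Z + d * del%:Z)).
have CE : C%:Z = a.+1%:Z * al%:Z by rewrite PoszM.
rewrite nE PoszM.
have -> : (al%:Z * del%:Z) = (al%:Z * del%:Z) * (zinv a.+1 d * d) - al%:Z * del%:Z * u * a.+1%:Z by rewrite hu; ring.
by rewrite CE; ring.
Qed.

(** Once alpha is known from [gcd_zinv], so are c and delta; equal images then leave d' = d + w c
    and b = b' + w delta, and two residues below delta force w = 0. *)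
Lemma hecke_map_inj n p p' : (0 < n)%N -> hecke_src n p -> hecke_src n p' ->
  hecke_map n p = hecke_map n p' -> p = p'.
Proof.
case: p p' => [[del b] [a d]] [[del' b'] [a' d']] n0 /and4P[/= del0 deln bdel cop].
move=> /and4P[/= del0' deln' bdel' cop'].
rewrite /hecke_map /=.
set al := (n %/ del)%N; have nE : n = (al * del)%N by rewrite divnK.
set al' := (n %/ del')%N; have nE' : n = (al' * del')%N by rewrite divnK.
have al0 : (0 < al)%N by rewrite divn_gt0 // dvdn_leq.
have al0' : (0 < al')%N by rewrite divn_gt0 // dvdn_leq.
have C0 : (0 < a.+1 * al)%N by rewrite muln_gt0.
have C0' : (0 < a'.+1 * al')%N by rewrite muln_gt0.
move=> [eC eD eA].
have {}eC : (a.+1 * al = a'.+1 * al')%N by rewrite -(prednK C0) eC prednK.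
have ea : al = al' by rewrite -(gcd_zinv C0 cop) eA eC gcd_zinv.
have edel : del = del' by apply/eqP; rewrite -(eqn_pmul2l al0) -nE ea -nE'.
have eaa : a = a' by apply/eqP; rewrite -eqSS -(eqn_pmul2r al0) eC ea.
subst a' del'; rewrite -/al in eA eD *.
have C0z : (a.+1 * al)%N%:Z != 0 by rewrite eqz_nat -lt0n.
move: eA => /(congr1 Posz); rewrite !gez0_abs ?modz_ge0 // => /eqz_modP[k hk].
have {}hk : zinv a.+1 d = zinv a.+1 d' + k * a.+1%:Z.
  have al0z : al%:Z != 0 by rewrite eqz_nat -lt0n.
  by apply: (mulIf al0z); rewrite hk PoszM; ring.
have /eqz_modP[u hu] := zinvP cop; have /eqz_modP[v hv] := zinvP cop'.
have [w hw] : exists w, d' = d + w * a.+1%:Z.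
  exists (d' * k * d + d * v - d' * u).
  have e1 : d = d * (zinv a.+1 d' * d') - d * v * a.+1%:Z by rewrite hv; ring.
  have e2 : d' = d' * (zinv a.+1 d * d) - d' * u * a.+1%:Z by rewrite hu; ring.
  by rewrite {1}e2 {3}e1 hk; ring.
have eb : b%:Z = b'%:Z + w * del%:Z.
  have a0z : a.+1%:Z != 0 by [].
  by apply: (mulfI a0z); apply: (addIr (d * del%:Z)); rewrite eD hw; ring.
have w0 : w = 0.
  have [//|wn] := eqVneq w 0.
  have : (`|w * del%:Z| < del%:Z).
    have -> : w * del%:Z = b%:Z - b'%:Z by rewrite eb; ring.
    by clear -bdel bdel'; lia.
  rewrite normrM; suff : 1 <= `|w| by clear; nia.
  by clear -wn; lia.
move: eb hw; rewrite w0 !mul0r !addr0 => -[->] ->.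
by [].
Qed.

Lemma hecke_map_surj n y : (0 < n)%N -> hecke_tgt n y ->
  exists2 p, hecke_src n p & hecke_map n p = y.
Proof.
case: y => [[c0 D] A] n0 /andP[/= AC dv].
set C := c0.+1 in AC dv.
pose al := gcdn A C; have al0 : (0 < al)%N by rewrite gcdn_gt0 orbT.
have alA : (al %| A)%N by exact: dvdn_gcdl.
have alC : (al %| C)%N by exact: dvdn_gcdr.
pose c := (C %/ al)%N; pose p := (A %/ al)%N.
have CE : C = (c * al)%N by rewrite divnK.
have AE : A = (p * al)%N by rewrite divnK.
have c_gt0 : (0 < c)%N by rewrite divn_gt0 // dvdn_leq.
have cop : coprimez p%:Z c%:Z.
  rewrite coprimezE /= /coprime -(eqn_pmul2r al0) mul1n muln_gcdl -CE -AE //.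
have /dvdzP[u hu] := dv.
have nE : n%:Z = (p%:Z * D - u * c%:Z) * al%:Z.
  have -> : n%:Z = A%:Z * D - u * C%:Z by rewrite -hu; ring.
  by rewrite CE AE !PoszM; ring.
have aln : (al %| n)%N by have : (al%:Z %| n%:Z)%Z by [apply/dvdzP; exists (p%:Z * D - u * c%:Z)].
pose del := (n %/ al)%N; have nE' : n = (del * al)%N by rewrite divnK.
have del0 : (0 < del)%N by rewrite divn_gt0 // dvdn_leq.
have al0z : al%:Z != 0 by rewrite eqz_nat -lt0n.
have delE : del%:Z = p%:Z * D - u * c%:Z by apply: (mulIf al0z); rewrite -nE nE' PoszM.
have /eqz_modP[k hk] := zinvP cop.
(* Replacing d by d + w c and b by b - w delta keeps D fixed; [w] is chosen to bring b below
   delta. *)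
pose b0 := zinv c p%:Z * u - k * D; pose w := (b0 %/ del%:Z)%Z.
have dz : del%:Z != 0 by rewrite eqz_nat -lt0n.
have b_ge0 : 0 <= (b0 %% del%:Z)%Z by exact: modz_ge0.
have hb : b0 = w * del%:Z + (b0 %% del%:Z)%Z by exact: divz_eq.
pose d := zinv c p%:Z + w * c%:Z.
have hd : (d * p%:Z = 1 %[mod c%:Z])%Z.
  by apply/eqz_modP; exists (k + w * p%:Z); rewrite /d mulrDl hk; ring.
have copd : coprimez d c%:Z.
  by case/eqz_modP: hd => v hv; apply: (@coprimez_eq1 _ _ p%:Z (- v)); rewrite mulrC hv; ring.
have cS : c.-1.+1 = c by rewrite prednK.
exists ((del, absz (b0 %% del%:Z)%Z), (c.-1, d)).
  rewrite /hecke_src /= cS del0 copd andbT nE' dvdn_mulr //=.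
  by rewrite -ltz_nat gez0_abs // ltz_pmod.
rewrite /hecke_map /= cS.
have -> : (n %/ del)%N = al by rewrite nE' mulKn.
rewrite -CE gez0_abs //; congr ((_, _), _).
  have -> : (b0 %% del%:Z)%Z = b0 - w * del%:Z by rewrite {2}hb; ring.
  rewrite /d /b0.
  have -> : c%:Z * (zinv c p%:Z * u - k * D - w * del%:Z) + (zinv c p%:Z + w * c%:Z) * del%:Z =
     zinv c p%:Z * (del%:Z + u * c%:Z) - k * D * c%:Z by ring.
  have -> : del%:Z + u * c%:Z = p%:Z * D by rewrite delE; ring.
  by rewrite mulrA hk; ring.
have /eqz_modP[v hv] := bezout_zinv hd.
have -> : zinv c d * al%:Z = v * C%:Z + A%:Z by rewrite hv CE AE !PoszM; ring.
by rewrite modzMDl modz_small // ltz_nat AC.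
Qed.
End hecke_cosets.

(** * Hecke identities before the limit *)

Section hecke_sum.
Local Open Scope fset_scope.
Local Open Scope ring_scope.
Variable R : realType.

Lemma xi_ncop m c d : ~~ coprimez d c%:Z -> xi R m c d = 0.
Proof. by move=> h; rewrite /xi (negbTE h) andbF. Qed.

Definition hecke_pairs n := [seq (d, b) | d <- divisors n, b <- iota 0 d].

Lemma hecke_pairsP n del b : (0 < n)%N ->
  ((del, b) \in hecke_pairs n) = [&& (0 < del)%N, (del %| n)%N & (b < del)%N].
Proof.
move=> n0; apply/allpairsPdep/idP => [[d [b' [+ + [-> ->]]]]|/and3P[h1 h2 h3]].
  by rewrite -dvdn_divisors // mem_iota => dn b'd; rewrite dn b'd (dvdn_gt0 n0 dn).
by exists del, b; rewrite -dvdn_divisors // mem_iota.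
Qed.

Lemma hecke_pairs_uniq n : uniq (hecke_pairs n).
Proof.
apply: allpairs_uniq_dep => [|d _|[d b] [d' b'] _ _ [-> ->] //]; first exact: divisors_uniq.
exact: iota_uniq.
Qed.

Lemma big_hecke_pairs n (V : nmodType) (F : nat * nat -> V) :
  \sum_(k <- hecke_pairs n) F k = \sum_(d <- divisors n) \sum_(b < d) F (d, nat_of_ord b).
Proof.
rewrite /hecke_pairs big_allpairs_dep; apply: eq_bigr => d _.
by rewrite -(big_mkord xpredT (fun b => F (d, b))) /index_iota subn0.
Qed.

Definition hx n (x : R) (k : nat * nat) : R := ((n %/ k.1)%:R * x + k.2%:R) / k.1%:R.
Definition hy n (y : R) (k : nat * nat) : R := (n %/ k.1)%:R * y / k.1%:R.

Lemma hecke_point n x y k : ((n %/ k.1)%:R * (x +i* y) + k.2%:R) / k.1%:R = hx n x k +i* hy n y k :> R[i].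
Proof.
rewrite -!(rmorph_nat (real_complex R)) -fmorphV.
by apply: complex_ext => /=; rewrite /hx /hy; ring.
Qed.

Lemma hy_gt0 n y k : (0 < n)%N -> k \in hecke_pairs n -> 0 < y -> 0 < hy n y k.
Proof.
case: k => del b n0; rewrite hecke_pairsP // => /and3P[d0 dn _] y0.
by rewrite /hy /= divr_gt0 ?mulr_gt0 // ltr0n // divn_gt0 // dvdn_leq.
Qed.

Lemma Cz_neq0 (x y : R) (a : nat) (d : int) : 0 < y -> a.+1%:R * (x +i* y) + d%:~R != 0 :> R[i].
Proof.
move=> y0; rewrite -(rmorph_nat (real_complex R)) -(rmorph_int (real_complex R)).
apply/eqP => /(congr1 (@complex.Im R)) /=; rewrite addr0 mul0r addr0.
by apply/eqP; rewrite mulf_neq0 // gt_eqF.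
Qed.

Variables (x y : R) (y0 : 0 < y) (n : nat) (n0 : (0 < n)%N).

Lemma hecke_field (u v w t r z : R[i]) : t != 0 -> u != 0 -> v != 0 ->
  v * u * z + (v * w + r * t) != 0 ->
  1 / (v * (v * ((u * z + w) / t) + r)) = u * t / (v * u * (v * u * z + (v * w + r * t))).
Proof.
by move=> t0 u0 v0 h; field; rewrite t0 u0 v0 h.
Qed.

(** With z' = (alpha z + b) / delta one has c z' + d = (C z + D) / delta and c = C / alpha, where
    alpha delta = n. *)
Lemma Uz_hecke del b a d : hecke_src n ((del, b), (a, d)) ->
  let y' := hecke_map n ((del, b), (a, d)) in
  Uz (hx n x (del, b)) (hy n y (del, b)) 1 a d = Uz x y n y'.1.1 y'.1.2.
Proof.
case/and4P => /= del0 deln _ _; rewrite /Uz -hecke_point /=.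
set al := (n %/ del)%N; have nE : n = (al * del)%N by rewrite divnK.
have al0 : (0 < al)%N by rewrite divn_gt0 // dvdn_leq.
have C0 : (0 < a.+1 * al)%N by rewrite muln_gt0.
have := @Cz_neq0 x y (a.+1 * al).-1 (a.+1%:Z * b%:Z + d * del%:Z) y0.
rewrite prednK // nE !natrM rmorphD !rmorphM /= -!pmulrn.
have dR : del%:R != 0 :> R[i] by rewrite pnatr_eq0 -lt0n.
have aR : al%:R != 0 :> R[i] by rewrite pnatr_eq0 -lt0n.
have cR : a.+1%:R != 0 :> R[i] by rewrite pnatr_eq0.
set z := x +i* y; move=> h.
exact: hecke_field.
Qed.

(** Both sides are the sum of [H] over triples (C, D, A): [hecke_map] carries the level one terms to
    it bijectively, and summing over A first gives the coefficient of (C, D) by [weight_sum]. *)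
Lemma fT_hecke s (S : nat * nat -> R[i]) : 1 < s ->
  (forall k, k \in hecke_pairs n -> dsum (fT (hx n x k) (hy n y k) 1 s) (S k)) ->
  dsum (fT x y n s) (\sum_(k <- hecke_pairs n) S k).
Proof.
move=> s1 hS.
pose F (p : (nat * nat) * (nat * int)) :=
  if p.1 \in hecke_pairs n then fT (hx n x p.1) (hy n y p.1) 1 s p.2 else 0.
have aF : asum F.
  apply: (@asum_rows R _ _ (hecke_pairs n)) => [k i /negbTE|k kL]; first by rewrite /F /= => ->.
  rewrite /F /= kL; apply: asum_fT => //; exact: hy_gt0.
have [l hl] := dsum_exists aF.
have -> : \sum_(k <- hecke_pairs n) S k = l.
  pose S' k := if k \in hecke_pairs n then S k else 0.
  have h1 : dsum S' l.
    apply: (dsum_fubini hl) => k; rewrite /F /S' /=; case: ifP => [/hS //|_].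
    exact: dsum0.
  have := dsum_finite (hecke_pairs_uniq n) (_ : forall k, k \notin hecke_pairs n -> S' k = 0).
  move=> /(_ (fun k h => ifN _ _ h)) h2.
  rewrite -(dsum_uniq h2 h1); apply: eq_big_seq => k; rewrite /S' => -> //.
pose H (p : (nat * int) * nat) := if hecke_tgt n p then
   om R p.1.1.+1 (- p.2%:Z) * Phi (Uz x y n p.1.1 p.1.2) s%:C else 0.
have hH : dsum H l.
  apply: (dsum_reindex_on (P := hecke_src n) (Q := hecke_tgt n) (j := hecke_map n) _ _ _ _ _ hl).
  - move=> [[del b] [a d]]; rewrite /F /hecke_src /= hecke_pairsP // !negb_and.
    case: ifP => // /and3P[-> -> ->] /=; rewrite /fT /= => h.
    by rewrite xi_ncop // rmorph0 mul0r.
  - by move=> p; rewrite /H => /negbTE ->.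
  - move=> [[del b] [a d]] Pi; have Qj := hecke_map_tgt n0 Pi; split => //.
    rewrite /H Qj -(Uz_hecke Pi) /F /=.
    have /and4P[/= del0 deln bdel cop] := Pi; rewrite hecke_pairsP // del0 deln bdel /= /fT /=.
    congr (_ * _); have al0 : (0 < n %/ del)%N by rewrite divn_gt0 // dvdn_leq.
    have C0 : (0 < a.+1 * (n %/ del))%N by rewrite muln_gt0.
    rewrite prednK // gez0_abs ?modz_ge0 -?lt0n //.
    have -> : xi R 1 a.+1 d = om R a.+1 (zinv a.+1 d) by rewrite /xi cop /= mul1r.
    rewrite om_conj; congr conjc.
    transitivity (om R (a.+1 * (n %/ del)) (zinv a.+1 d * (n %/ del)%:Z)).
      by apply: om_mod => //; rewrite modz_mod.
    rewrite /om natrM rmorphM /= -pmulrn; congr e1.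
    have aR : (n %/ del)%:R != 0 :> R[i] by rewrite pnatr_eq0 -lt0n.
    by rewrite -mulf_div divff // mulr1.
  - by move=> p p' Pp Pp'; exact: hecke_map_inj.
  - by move=> p; exact: hecke_map_surj.
apply: (dsum_fubini hH) => -[c0 D].
have hf := @dsum_finite R nat (fun A => H ((c0, D), A)) (iota 0 c0.+1) (iota_uniq _ _).
have -> : fT x y n s (c0, D) = \sum_(A <- iota 0 c0.+1) H ((c0, D), A).
  have -> : iota 0 c0.+1 = index_iota 0 c0.+1 by rewrite /index_iota subn0.
  rewrite big_mkord /fT -weight_sum mulr_suml [LHS]big_mkcond; by apply: eq_bigr => A _; rewrite /H /hecke_tgt /= ltn_ord.
by apply: hf => A; rewrite mem_iota /= add0n => h; rewrite /H /hecke_tgt /= (negbTE h).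
Qed.

(** For delta > 1 the sum of e(- b / delta) over b vanishes; only delta = 1 remains. *)
Lemma e1_hecke : \sum_(k <- hecke_pairs n) e1 (- (hx n x k +i* hy n y k)) = e1 (- (n%:R * (x +i* y))) :> R[i].
Proof.
rewrite big_hecke_pairs (bigD1_seq 1%N) ?divisors_uniq -?dvdn_divisors //=.
rewrite big_ord1 big1_seq ?addr0 => [|d /andP[d1]].
  by rewrite -hecke_point /= divn1 addr0 divr1.
rewrite -dvdn_divisors // => dn; have d0 := dvdn_gt0 n0 dn.
under eq_bigr => b _.
  rewrite -hecke_point /= mulrDl opprD e1D.
  rewrite (_ : e1 (- (b%:R / d%:R)) = om R d (b%:Z * (-1))); last by rewrite /om rmorphM /= -pmulrn mulrN1 mulNr.
  over.
rewrite -mulr_sumr om_sum //.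
have -> : (d%:Z %| -1)%Z = false.
  by rewrite dvdzE /= dvdn1; exact/negbTE.
by rewrite muln0 mulr0.
Qed.

End hecke_sum.

(** * Sums over cosets *)

Section cosets.
Local Open Scope ring_scope.
Variable R : realType.

Lemma translationE (k : int) (i j : 'I_2) :
  translation k i j = (i == j)%:R + k * ((i == 0) && (j == 1))%:R.
Proof. by rewrite /translation !mxE. Qed.

Lemma mx2E (g g' : 'M[int]_2) : g 0 0 = g' 0 0 -> g 0 1 = g' 0 1 ->
  g 1 0 = g' 1 0 -> g 1 1 = g' 1 1 -> g = g'.
Proof.
have ord2 (i : 'I_2) : i = 0 \/ i = 1 by case: i => -[|[|//]] hi; [left|right]; exact/val_inj.
move=> h00 h01 h10 h11; apply/matrixP => i j.
by case: (ord2 i) => ->; case: (ord2 j) => ->.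
Qed.

Lemma trans_mul k (g : 'M[int]_2) :
  [/\ (translation k *m g) 0 0 = g 0 0 + k * g 1 0,
      (translation k *m g) 0 1 = g 0 1 + k * g 1 1,
      (translation k *m g) 1 0 = g 1 0 & (translation k *m g) 1 1 = g 1 1].
Proof.
have l1 : lift ord0 ord0 = 1 :> 'I_2 by exact/val_inj.
have l0 : ord0 = 0 :> 'I_2 by exact/val_inj.
by split; rewrite mxE !big_ord_recl big_ord0 !translationE l1 l0 /= ?(mulr1, mulr0, mul1r, mul0r, addr0, add0r).
Qed.

Lemma trans_add k l (g : 'M[int]_2) :
  translation (k + l) *m g = translation k *m (translation l *m g).
Proof.
have [a1 a2 a3 a4] := trans_mul (k + l) g.
have [b1 b2 b3 b4] := trans_mul k (translation l *m g).
have [c1 c2 c3 c4] := trans_mul l g.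
by apply: mx2E; rewrite ?a1 ?a2 ?a3 ?a4 ?b1 ?b2 ?b3 ?b4 ?c1 ?c2 ?c3 ?c4 //; ring.
Qed.

Lemma trans0 (g : 'M[int]_2) : translation 0 *m g = g.
Proof. by rewrite /translation scale0r addr0 mul1mx. Qed.

Lemma SL2ZE (g : 'M[int]_2) : SL2Z g <-> g 0 0 * g 1 1 - g 0 1 * g 1 0 = 1.
Proof.
rewrite /SL2Z /= (expand_det_row g 0) !big_ord_recl big_ord0 /cofactor !det_mx11 !mxE /=.
have l1 : lift ord0 ord0 = 1 :> 'I_2 by exact/val_inj.
have l0 : ord0 = 0 :> 'I_2 by exact/val_inj.
have l2 : lift 1 0 = 0 :> 'I_2 by exact/val_inj.
rewrite l1 l0 l2.
by rewrite addr0 addn0 expr0 (_ : bump 0 0 = 1%N) // mul1r addn1 expr1 mulN1r mulrN.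
Qed.

Lemma SL2Z_trans k g : SL2Z g -> SL2Z (translation k *m g).
Proof.
move=> /SL2ZE h; apply/SL2ZE; have [-> -> -> ->] := trans_mul k g.
by rewrite -[RHS]h; ring.
Qed.

Lemma SL2Z_opp g : SL2Z g -> SL2Z (- g).
Proof. by move=> /SL2ZE h; apply/SL2ZE; rewrite !mxE !mulrNN. Qed.

(** The witness is the upper right entry of g g'^-1, which is a translation. *)
Lemma SL2Z_lower g g' : SL2Z g -> SL2Z g' -> g 1 0 = g' 1 0 -> g 1 1 = g' 1 1 ->
  exists k, g = translation k *m g'.
Proof.
move=> /SL2ZE h /SL2ZE h' e0 e1; exists (g 0 1 * g' 0 0 - g 0 0 * g' 0 1).
have [t1 t2 t3 t4] := trans_mul (g 0 1 * g' 0 0 - g 0 0 * g' 0 1) g'.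
rewrite e0 e1 in h; apply: mx2E; rewrite ?t1 ?t2 ?t3 ?t4 //.
  transitivity (g 0 0 * (g' 0 0 * g' 1 1 - g' 0 1 * g' 1 0) +
    g' 0 0 * (1 - (g 0 0 * g' 1 1 - g 0 1 * g' 1 0))); last by ring.
  by rewrite h h'; ring.
transitivity (g 0 1 * (g' 0 0 * g' 1 1 - g' 0 1 * g' 1 0) +
  g' 0 1 * (1 - (g 0 0 * g' 1 1 - g 0 1 * g' 1 0))); last by ring.
by rewrite h h'; ring.
Qed.

Definition radS mu (g : 'M[int]_2) (z s : R[i]) : R[i] := radT mu g z s - radT0 mu g s.

Lemma mobius_denom g (x y : R) : 0 < y -> SL2Z g ->
  (g 1 0)%:~R * (x +i* y) + (g 1 1)%:~R != 0 :> R[i].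
Proof.
move=> y0 /SL2ZE h; rewrite -!(rmorph_int (real_complex R)).
apply/eqP => e; have := congr1 (@complex.Im R) e; have := congr1 (@complex.Re R) e.
rewrite /= !mul0r !(addr0, add0r, subr0) => e1 /eqP; rewrite mulf_eq0 (gt_eqF y0) orbF => /eqP c0.
move: e1; rewrite c0 mul0r add0r => /eqP; rewrite intr_eq0 => /eqP d0.
move/eqP: c0; rewrite intr_eq0 => /eqP c0.
by move: h; rewrite c0 d0 !mulr0 subrr.
Qed.

Lemma e1_add_int (mu : R) (w : R[i]) (k : int) :
  e1 (mu%:C * (w + k%:~R)) = e1 (mu * k%:~R)%:C * e1 (mu%:C * w) :> R[i].
Proof. by rewrite mulrDr addrC e1D rmorphM rmorph_int. Qed.

(** A translation leaves mu g z - mu g oo unchanged and affects only the leading exponential.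
    Multiples k of h give independence of the representative, k = 1 the vanishing for h > 1. *)
Lemma radS_trans mu g x y s k : 0 < y -> SL2Z g ->
  radS mu (translation k *m g) (x +i* y) s = e1 (mu * k%:~R)%:C * radS mu g (x +i* y) s.
Proof.
move=> y0 gS; have hz := mobius_denom x y0 gS.
have [t1 t2 t3 t4] := trans_mul k g.
have mE w : (g 1 0)%:~R * w + (g 1 1)%:~R != 0 -> mobius (translation k *m g) w = mobius g w + k%:~R :> R[i].
  move=> w0; rewrite /mobius t1 t2 t3 t4 !rmorphD !rmorphM /=.
  by rewrite -[k%:~R in RHS](mulfK w0) -[in RHS]mulrDl; congr (_ / _); ring.
have e3 a b : mu%:C * (a + k%:~R) - mu%:C * (b + k%:~R) = mu%:C * a - mu%:C * b :> R[i] by ring.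
rewrite /radS mulrBr /radT /radT0 t3 t4 mE //; congr (_ - _).
  have [c0|c0] := ifPn; first by rewrite e1_add_int.
  have mo : mobius_oo R (translation k *m g) = mobius_oo R g + k%:~R.
    have c0R : (g 1 0)%:~R != 0 :> R[i] by rewrite intr_eq0.
    rewrite /mobius_oo t1 t3 rmorphD rmorphM /=.
    by rewrite -[k%:~R in RHS](mulfK c0R) -[in RHS]mulrDl.
  by rewrite mo e3 e1_add_int -mulrA.
have [cd0|] := ifPn; first by rewrite mulr0.
rewrite mulf_eq0 negb_or => /andP[c0 d0].
have mo : mobius_oo R (translation k *m g) = mobius_oo R g + k%:~R.
  have c0R : (g 1 0)%:~R != 0 :> R[i] by rewrite intr_eq0.
  rewrite /mobius_oo t1 t3 rmorphD rmorphM /=.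
  by rewrite -[k%:~R in RHS](mulfK c0R) -[in RHS]mulrDl.
by rewrite mo mE ?mulr0 ?add0r ?intr_eq0 // !e3 e1_add_int -mulrA.
Qed.

Lemma radS_opp mu g z s : radS mu (- g) z s = radS mu g z s.
Proof.
have mE w : mobius (- g) w = mobius g w :> R[i].
  by rewrite /mobius !mxE !rmorphN /= !mulNr -!opprD invrN mulrNN.
have mo : mobius_oo R (- g) = mobius_oo R g.
  by rewrite /mobius_oo !mxE !rmorphN /= invrN mulrNN.
by rewrite /radS /radT /radT0 !mxE !mE !mo mulrNN oppr_eq0.
Qed.

Lemma Bcoset_refl h g : Bcoset h g g.
Proof. by exists 0; left; rewrite mulr0 trans0. Qed.

Lemma Bcoset_trans h k g : Bcoset h (translation (h%:Z * k) *m g) = Bcoset h g.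
Proof.
apply/seteqP; split=> x [l hl].
  by exists (l + k); rewrite mulrDr trans_add.
exists (l - k); rewrite -trans_add.
by rewrite (_ : _ + _ = h%:Z * l) //; ring.
Qed.

Lemma Bcoset_opp h g : Bcoset h (- g) = Bcoset h g.
Proof.
by apply/seteqP; split=> x [l [] ->]; exists l; rewrite mulmxN ?opprK; [right|left|right|left].
Qed.

Lemma radS_repr mu h g x y s : 0 < y -> SL2Z g ->
  (forall k : int, e1 (mu * (h%:Z * k)%:~R)%:C = 1 :> R[i]) ->
  radS mu (coset_repr (Bcoset h g)) (x +i* y) s = radS mu g (x +i* y) s.
Proof.
move=> y0 gS hmu.
have : Bcoset h g (coset_repr (Bcoset h g)).
  by apply: xgetPex; exists g; exact: Bcoset_refl.
by move=> [k [] ->]; rewrite ?radS_opp radS_trans // hmu mul1r.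
Qed.

Definition mkcoset h g (gS : SL2Z g) : set_type (Bcosets h) :=
  SigSub (mem_set (ex_intro2 _ _ g gS erefl)).

End cosets.

(** * Translations of cosets and their representatives by lower rows *)

Section coset_sums.
Local Open Scope fset_scope.
Local Open Scope ring_scope.
Variable R : realType.

Lemma Bcoset_SL2Z h g g' : SL2Z g -> Bcoset h g g' -> SL2Z g'.
Proof. by move=> gS [k [] ->]; [|apply: SL2Z_opp]; exact: SL2Z_trans. Qed.

Lemma Bcoset_eq h g g' : Bcoset h g g' -> Bcoset h g' = Bcoset h g.
Proof. by move=> [k [] ->]; rewrite ?Bcoset_opp Bcoset_trans. Qed.

(** Translations commute, so left multiplication by one is well defined on the cosets of B(hZ). *)
Lemma Bcoset_translation h k g g' : Bcoset h g = Bcoset h g' ->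
  Bcoset h (translation k *m g) = Bcoset h (translation k *m g').
Proof.
move=> e; have [l hl] : Bcoset h g' g by rewrite -e; exact: Bcoset_refl.
have tC : translation k *m (translation (h%:Z * l) *m g') = translation (h%:Z * l) *m (translation k *m g').
  by rewrite -!trans_add addrC.
by case: hl => ->; rewrite ?mulmxN ?Bcoset_opp tC Bcoset_trans.
Qed.

Lemma coset_reprP h (X : set_type (Bcosets h)) :
  SL2Z (coset_repr (val X)) /\ Bcoset h (coset_repr (val X)) = val X.
Proof.
have [g gS eX] := set_valP X; rewrite /= in eX.
have hr : Bcoset h g (coset_repr (val X)).
  by rewrite eX; apply: xgetPex; exists g; have := Bcoset_refl h g; rewrite eX.
by split; [exact: Bcoset_SL2Z gS hr | rewrite (Bcoset_eq hr)].
Qed.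

Definition shift_coset h k (X : set_type (Bcosets h)) : set_type (Bcosets h) :=
  mkcoset h (SL2Z_trans k (proj1 (coset_reprP X))).

Lemma shift_cosetK h k : cancel (@shift_coset h k) (@shift_coset h (- k)).
Proof.
move=> X; apply/val_inj => /=.
rewrite (@Bcoset_translation h (- k) _ (translation k *m coset_repr (val X))); last first.
  exact: (proj2 (coset_reprP (shift_coset k X))).
by rewrite -trans_add addNr trans0 (proj2 (coset_reprP X)).
Qed.

(* Left multiplication by z |-> z + 1 permutes the cosets and multiplies every
   summand by e(mu), so the sum vanishes as soon as e(mu) != 1; a divergent sum
   would be [point], which is 0 as well. *)
Lemma radSum_eq0 mu h x y s : 0 < y ->
  (forall k : int, e1 (mu * (h%:Z * k)%:~R)%:C = 1 :> R[i]) ->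
  e1 mu%:C != 1 :> R[i] -> radSum mu h (x +i* y) s = 0.
Proof.
move=> y0 hmu mu1.
pose f (X : set_type (Bcosets h)) := radS mu (coset_repr (val X)) (x +i* y) s.
rewrite /radSum -[X in summability.sum X]/f.
have [[l hl]|nl] := pselect (exists l, dsum f l).
  rewrite (dsum_sum hl).
  have inj : injective (@shift_coset h 1) by exact: can_inj (@shift_cosetK h 1).
  have surj Y : (forall X, Y != shift_coset 1 X) -> f Y = 0.
    by move=> /(_ (shift_coset (-1) Y)); have := @shift_cosetK h (-1) Y; rewrite opprK => ->; rewrite eqxx.
  have h1 : dsum (f \o @shift_coset h 1) l by apply/(dsum_inj _ inj surj).
  have h2 : dsum (f \o @shift_coset h 1) (e1 mu%:C * l).
    apply: dsum_ext (dsumZ (e1 mu%:C) hl) => X; rewrite /f /=.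
    have [gS _] := coset_reprP X.
    by rewrite radS_repr ?radS_trans ?mulr1 //; exact: SL2Z_trans.
  have /eqP := dsum_uniq h1 h2; rewrite -subr_eq0 -{1}[l]mul1r -mulrBl mulf_eq0 subr_eq0 eq_sym.
  by rewrite (negbTE mu1) => /eqP.
have pE : partial_sum (f : _ -> R[i]^o) = fun A : {fset set_type (Bcosets h)} => \sum_(i <- A) f i.
  by apply: funext => A; exact: esym (big_seq_fsetE _ A xpredT f).
rewrite /summability.sum pE dvgP // => hc; apply: nl.
eexists; apply/dsumP; apply/cvP; exact: hc.
Qed.

Lemma dsum_option (I : choiceType) (f : option I -> R[i]) l :
  dsum (f \o Some) l -> dsum f (f None + l).
Proof.
move=> hl.
have h1 : dsum (fun i : option I => if i is None then f None else 0) (f None).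
  have := @dsum_finite R (option I) (fun i => if i is None then f None else 0) [:: None] isT.
  by rewrite big_seq1; apply => -[].
have h2 : dsum (fun i : option I => if i is Some k then f (Some k) else 0) l.
  apply: (proj1 (@dsum_inj R _ _ Some _ l (@Some_inj _) _)) => [[k|] // /(_ k)|].
    by rewrite eqxx.
  exact: hl.
by apply: dsum_ext (dsumD h1 h2) => -[k|]; rewrite ?add0r ?addr0.
Qed.

(** The division is exact when d is coprime to a + 1. *)
Definition lower_mx (a : nat) (d : int) : 'M[int]_2 :=
  \matrix_(i, j) if i == 0 then (if j == 0 then zinv a.+1 d else ((zinv a.+1 d * d - 1) %/ a.+1%:Z)%Z)
                 else (if j == 0 then a.+1%:Z else d).

Lemma lower_mxE a d : coprimez d a.+1%:Z -> exists v : int,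
  [/\ lower_mx a d 0 0 = zinv a.+1 d, lower_mx a d 0 1 = v,
      lower_mx a d 1 0 = a.+1%:Z, lower_mx a d 1 1 = d & zinv a.+1 d * d - v * a.+1%:Z = 1].
Proof.
move=> /zinvP/eqP; rewrite eqz_mod_dvd => /divzK hv.
by exists ((zinv a.+1 d * d - 1) %/ a.+1%:Z)%Z; split; rewrite ?mxE //= hv; ring.
Qed.

Lemma lower_mx_SL2Z a d : coprimez d a.+1%:Z -> SL2Z (lower_mx a d).
Proof. by move=> /lower_mxE[v [e1 e2 e3 e4 e5]]; apply/SL2ZE; rewrite e1 e2 e3 e4. Qed.

(** [None] indexes the coset with c = 0, and [Some (a, d)] the lower row (a + 1, d). *)
Definition cop_idx (i : option (nat * int)) : bool :=
  if i is Some (a, d) then coprimez d a.+1%:Z else true.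

Definition idx_mx (i : option (nat * int)) : 'M[int]_2 :=
  if i is Some (a, d) then if coprimez d a.+1%:Z then lower_mx a d else 1%:M else 1%:M.

Lemma SL2Z1 : SL2Z 1%:M.
Proof. by rewrite /SL2Z /= det1. Qed.

Lemma idx_mx_SL2Z i : SL2Z (idx_mx i).
Proof.
case: i => [[a d]|] /=; last exact: SL2Z1.
by case: ifP => [/lower_mx_SL2Z //|_]; exact: SL2Z1.
Qed.

(** A coset determines its lower row up to sign, and the indexed rows, with c > 0 or equal to (0,
    1), contain no two opposite ones. *)
Lemma idx_mx_inj i i' : cop_idx i -> cop_idx i' ->
  Bcoset 1 (idx_mx i) = Bcoset 1 (idx_mx i') -> i = i'.
Proof.
pose low j := if j is Some (a, d) then (a.+1%:Z, d) else (0, 1) : int * int.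
have lowE j : cop_idx j -> idx_mx j 1 0 = (low j).1 /\ idx_mx j 1 1 = (low j).2.
  case: j => [[a d]|] /= cop; last by rewrite !mxE.
  by rewrite cop; have [v [_ _ -> -> _]] := lower_mxE cop.
have low_inj j j' : low j = low j' -> j = j'.
  by case: j j' => [[a d]|] [[a' d']|] // [-> ->].
have low_opp j j' : (low j).1 = - (low j').1 -> (low j).2 = - (low j').2 -> j = j'.
  by case: j j' => [[a d]|] [[a' d']|].
move=> ci ci' e; have [k hk] : Bcoset 1 (idx_mx i') (idx_mx i) by rewrite -e; exact: Bcoset_refl.
have [_ _ t3 t4] := trans_mul (1%:Z * k) (idx_mx i').
have [h0 h1] := lowE i ci; have [h0' h1'] := lowE i' ci'; rewrite h0' in t3; rewrite h1' in t4.
case: hk => hk; rewrite hk in h0 h1.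
  by apply: low_inj; rewrite (surjective_pairing (low i)) -h0 -h1 t3 t4 -surjective_pairing.
by apply: low_opp; rewrite -?h0 -?h1 mxE ?t3 ?t4.
Qed.

Lemma idx_mx_surj g : SL2Z g -> exists2 i, cop_idx i & Bcoset 1 (idx_mx i) = Bcoset 1 g.
Proof.
have main g' : SL2Z g' -> 0 < g' 1 0 -> exists2 i, cop_idx i & Bcoset 1 (idx_mx i) = Bcoset 1 g'.
  move=> gS c0; pose a := (absz (g' 1 0)).-1.
  have aE : a.+1%:Z = g' 1 0 by rewrite /a prednK ?absz_gt0 ?gt_eqF // gtz0_abs.
  have cop : coprimez (g' 1 1) a.+1%:Z.
    have /SL2ZE h := gS; apply: (@coprimez_eq1 _ _ (g' 0 0) (- g' 0 1)).
    by rewrite aE -h; ring.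
  exists (Some (a, g' 1 1)) => //; rewrite /= cop.
  have [v [_ _ e3 e4 _]] := lower_mxE cop.
  have [|//|k ->] := @SL2Z_lower (lower_mx a (g' 1 1)) g' (lower_mx_SL2Z cop) gS.
    by rewrite e3 aE.
  by rewrite -{1}[k]mul1r Bcoset_trans.
move=> gS; have [c0|c0|c0] := ltgtP (g 1 0) 0; last 1 first.
- exists None => //=; have /SL2ZE := gS; rewrite c0 mulr0 subr0 => h.
  have [d1|d1] : g 1 1 = 1 \/ g 1 1 = -1.
    have /eqP := congr1 absz h; rewrite abszM muln_eq1 => /andP[_ /eqP].
    by clear; lia.
    have [//|//|k ->] := @SL2Z_lower 1%:M g SL2Z1 gS; rewrite ?mxE ?c0 ?d1 //.
    by rewrite -{1}[k]mul1r Bcoset_trans.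
  have [||k ->] := @SL2Z_lower 1%:M (- g) SL2Z1 (SL2Z_opp gS); rewrite ?mxE ?c0 ?d1 //.
  by rewrite -{1}[k]mul1r Bcoset_trans Bcoset_opp.
- have [|i ci ei] := main (- g) (SL2Z_opp gS); first by rewrite mxE oppr_gt0.
  by exists i => //; rewrite ei Bcoset_opp.
- exact: main.
Qed.

End coset_sums.

(** * The summands of level one *)

Section summands.
Local Open Scope fset_scope.
Local Open Scope ring_scope.
Variable R : realType.

Definition hpi : R[i] := 0 +i* (pi / 2).

Lemma cexp_hpi : cexp hpi = 'i%C.
Proof.
rewrite /cexp /hpi /= expR0 cos_pihalf sin_pihalf.
by apply: complex_ext => /=; ring.
Qed.

Lemma cexp_Nhpi : cexp (- hpi) = - 'i%C.
Proof.
rewrite /cexp /hpi /= oppr0 expR0 cosN sinN cos_pihalf sin_pihalf.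
by apply: complex_ext => /=; ring.
Qed.

Lemma cpow_posi (r s : R) : 0 < r -> cpow (r%:C * 'i%C) s%:C = (r `^ s)%:C * cexp (s%:C * hpi).
Proof.
move=> r0; have p0 := pi_gt0 R.
rewrite -cexp_hpi -[in LHS](cexp_ln r0) -cexpD cpow_cexp ?mulrDr ?cexpD ?cexp_powR //=.
by rewrite add0r; apply/andP; split; lra.
Qed.

Lemma cpow_negi (r s : R) : 0 < r -> cpow (- (r%:C * 'i%C)) s%:C = (r `^ s)%:C * cexp (- (s%:C * hpi)).
Proof.
move=> r0; have p0 := pi_gt0 R.
rewrite -mulrN -cexp_Nhpi -[in LHS](cexp_ln r0) -cexpD cpow_cexp ?mulrDr ?cexpD ?cexp_powR ?mulrN //=.
by rewrite add0r; apply/andP; split; lra.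
Qed.

Lemma e1_half (s : R[i]) : e1 (s / 2%:R) = cexp (s * hpi + s * hpi).
Proof.
rewrite /e1; congr cexp; rewrite -mulrDr mulrC -mulrA; congr (_ * _).
apply: (mulfI (_ : 2%:R != 0 :> R[i])); first by rewrite pnatr_eq0.
rewrite mulVKf ?pnatr_eq0 // mulr_natl.
by apply: complex_ext => /=; lra.
Qed.

(** This equals - exp (- pi i s / 2) (exp (2 pi i s) - 1), hence the zero at s = 1. *)
Definition kap0 (s : R) : R[i] := cexp (- (s%:C * hpi)) - cexp (s%:C * hpi + s%:C * hpi) * cexp (s%:C * hpi).

(** For principal branches i^s = e(s / 2) (-i)^s; this makes [radT0] vanish on lower rows with c d >
    0. *)
Lemma divpow_posi (r s : R) : 0 < r ->
  divpow (r%:C * 'i%C) s%:C - e1 (s%:C / 2%:R) * divpow (- (r%:C * 'i%C)) s%:C = 0.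
Proof.
move=> r0; rewrite /divpow cgamma_real e1_half cpow_posi // cpow_negi //.
have h : cexp (s%:C * hpi) * cexp (- (s%:C * hpi)) = 1 by rewrite -cexpD subrr cexp0.
rewrite cexpD; move: h; move: (cexp (s%:C * hpi)) (cexp (- _)) => E N h.
transitivity ((r `^ s)%:C * E / (rgamma s)%:C * (1 - E * N)); first by ring.
by rewrite h subrr mulr0.
Qed.

Lemma divpow_negi (r s : R) : 0 < r ->
  divpow (- (r%:C * 'i%C)) s%:C - e1 (s%:C / 2%:R) * divpow (r%:C * 'i%C) s%:C =
  (r `^ s)%:C / (rgamma s)%:C * kap0 s.
Proof.
move=> r0; rewrite /divpow cgamma_real e1_half cpow_posi // cpow_negi // /kap0; ring.
Qed.

Definition kappa (m : nat) (s : R) : R[i] := ((2 * pi * m%:R) `^ s)%:C / (rgamma s)%:C * kap0 s.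

Lemma cv_kap0 : exists K, cv (1 : R)^'+ (fun s => kap0 s / (s - 1)%:C) K.
Proof.
(* [w] is 2 pi i, so exp (s w) = exp ((s - 1) w), and the quotient becomes a derivative of the
   exponential at 0. *)
pose w := hpi + hpi + hpi + hpi.
have w1 : cexp w = 1.
  have := e1_nat R 1; rewrite /e1 mulr1 => <-; congr cexp.
  by apply: complex_ext => /=; rewrite -?(mulr_natl pi 2); lra.
exists (- (cexp (1%:C * (- hpi)) * w)).
have h1 : cv (1 : R)^'+ (fun s => cexp (s%:C * (- hpi))) (cexp (1%:C * (- hpi))).
  by apply: cv_cexp_real; exact: cvg_at_right_filter.
apply: cv_eq (cvN (cvM h1 (cv_dcexp w))); apply: nearW => s /=.
rewrite -mulNr mulrA; congr (_ / _).
have -> : cexp ((s - 1)%:C * w) = cexp (s%:C * w).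
  have -> : s%:C * w = (s - 1)%:C * w + w by rewrite rmorphB rmorph1 mulrBl mul1r subrK.
  by rewrite (cexpD _ w) w1 mulr1.
rewrite /kap0 /w mulrN -!cexpD mulNr mulrBr mulr1 opprB -cexpD; congr (_ - cexp _); ring.
Qed.

(** The same [K] serves all m: only (2 pi m)^s depends on m, and it contributes the factor m that is
    needed to match m rho_m. *)
Lemma cv_kappa : exists K, forall m, (0 < m)%N ->
  cv (1 : R)^'+ (fun s => kappa m s / (s - 1)%:C) (m%:R * K).
Proof.
have [K hK] := cv_kap0; exists ((2 * pi)%:C / (rgamma 1)%:C * K) => m m0.
have pm0 : 0 < 2 * pi * m%:R :> R by rewrite !mulr_gt0 ?pi_gt0 // ltr0n.
have hP := cv_powR 0 pm0; have hG := cv_rgamma (lexx (0 : R)).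
have G0 : (rgamma (0 + 1))%:C != 0 :> R[i].
  by rewrite -(rmorph0 (real_complex R)) (inj_eq (@complexI R)) gt_eqF // rgamma_gt0.
have hV : cv (1 : R)^'+ (fun s => (rgamma (0 + s))%:C^-1) (rgamma (0 + 1))%:C^-1 by apply: cvV.
have E : m%:R * ((2 * pi)%:C / (rgamma 1)%:C * K) = ((2 * pi * m%:R) `^ (0 + 1))%:C * (rgamma (0 + 1))%:C^-1 * K.
  rewrite add0r powRr1 ?ltW // rmorphM rmorph_nat; ring.
rewrite E.
apply: cv_eq (cvM (cvM hP hV) hK); apply: nearW => s; rewrite /kappa !add0r; ring.
Qed.

Lemma T0_limit : exists K, forall m rho (L : R -> R[i]), (0 < m)%N ->
  dsum (fun c : nat => rsum R m c / c%:R ^+ 2) rho ->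
  (forall s, 1 < s -> dsum (fT0 m s) (L s)) ->
  cv (1 : R)^'+ (fun s => kappa m s * L s) (K * (m%:R * (rho + conjc rho))).
Proof.
have [K hK] := cv_kappa; exists K => m rho L m0 hrho hL.
have -> : K * (m%:R * (rho + conjc rho)) = m%:R * K * (rho + conjc rho) by ring.
have hM : cv (1 : R)^'+ (fun s => kappa m s / (s - 1)%:C * ((s - 1)%:C * L s))
    (m%:R * K * (rho + conjc rho)) by apply: cvM; [exact: hK | exact: (@L_limit R m rho L m0 hrho hL)].
apply: cv_eq hM.
apply: filterS (near12 R) => s [s1 _]; have s0 : (s - 1)%:C != 0 :> R[i].
  by rewrite -(rmorph0 (real_complex R)) (inj_eq (@complexI R)) gt_eqF // subr_gt0.
by rewrite mulrA divfK.
Qed.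

Lemma mobius_sub g w : SL2Z g -> (g 1 0)%:~R != 0 :> R[i] ->
  (g 1 0)%:~R * w + (g 1 1)%:~R != 0 :> R[i] ->
  mobius g w - mobius_oo R g = - ((g 1 0)%:~R * ((g 1 0)%:~R * w + (g 1 1)%:~R))^-1.
Proof.
move=> /SL2ZE/(congr1 (intr : int -> R[i])); rewrite rmorphB !rmorphM rmorph1 /= /mobius /mobius_oo.
move: ((g 0 0)%:~R : R[i]) ((g 0 1)%:~R : R[i]) ((g 1 0)%:~R : R[i]) ((g 1 1)%:~R : R[i]) => a b c d h c0 e0.
apply: (mulIf c0); apply: (mulIf e0).
have -> : - (c * (c * w + d))^-1 * c * (c * w + d) = - 1 by field; rewrite c0 e0.
rewrite -h; field; rewrite c0 e0 //.
Qed.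

Variable m : nat.

Lemma e1_lower a d : coprimez d a.+1%:Z ->
  e1 ((- m%:R : R)%:C * mobius_oo R (lower_mx a d)) = conjc (xi R m a.+1 d).
Proof.
move=> cop; have [v [e0 _ e3 _ _]] := lower_mxE cop.
have -> : xi R m a.+1 d = om R a.+1 (m%:Z * zinv a.+1 d) by rewrite /xi cop.
rewrite -om_conj /om /mobius_oo e0 e3; congr e1.
by rewrite rmorphN rmorph_nat rmorphN rmorphM /= -!pmulrn mulrA mulNr.
Qed.

Lemma radT_lower a d x y s : 0 < y -> coprimez d a.+1%:Z ->
  radT (- m%:R) (lower_mx a d) (x +i* y) s = conjc (xi R m a.+1 d) * Phi (Uz x y m a d) s.
Proof.
move=> y0 cop; have [v [_ _ e3 e4 _]] := lower_mxE cop.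
rewrite /radT e3 /= e1_lower // /Phi; congr (_ * _).
have gS := lower_mx_SL2Z cop.
have := mobius_sub gS _ (mobius_denom x y0 gS); rewrite e3 e4 intr_eq0 => /(_ isT) hs.
by rewrite -mulrBr hs -pmulrn rmorphN rmorph_nat mulrNN.
Qed.

(** [Negz d'] is - (d' + 1), and index d' of [fT0] stands for d' + 1. The inverse of -d is minus
    that of d, so the conjugate disappears. For d > 0 the two powers cancel by [divpow_posi]. *)
Lemma radT0_lower a d (s : R) : coprimez d a.+1%:Z -> 0 < s -> (0 < m)%N ->
  radT0 (- m%:R) (lower_mx a d) s%:C =
  if d is Negz d' then kappa m s * fT0 m s (a, d') else 0.
Proof.
move=> cop s0 m0; have [v [_ _ e3 e4 _]] := lower_mxE cop.
have gS := lower_mx_SL2Z cop.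
rewrite /radT0 e3 e4 mulf_eq0 /=.
have [->|d0] := eqVneq d 0; first by [].
have := @mobius_sub _ 0 gS; rewrite e3 e4 mulr0 add0r !intr_eq0 => /(_ isT d0) hs.
rewrite e1_lower // -!mulrBr -[mobius_oo _ _ - _]opprB hs opprK.
have e2 := twopiiE R.
rewrite rmorphN rmorph_nat -pmulrn.
case: d cop d0 {v e3 e4 gS hs} => d cop d0.
  pose r : R := 2 * pi * m%:R / (a.+1%:R * d%:R).
  have dR : 0 < d%:R :> R by rewrite ltr0n lt0n.
  have r0 : 0 < r by rewrite divr_gt0 ?mulr_gt0 ?pi_gt0 // ltr0n.
  have rE : twopii R * (m%:R * (a.+1%:R * d%:R)^-1) = r%:C * 'i%C.
    by rewrite e2 /r !rmorphM fmorphV !rmorphM !rmorph_nat; ring.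
  by rewrite -pmulrn mulrNN mulNr mulrN rE divpow_posi // mulr0.
pose r : R := 2 * pi * m%:R / (a.+1%:R * d.+1%:R).
have r0 : 0 < r by rewrite divr_gt0 ?mulr_gt0 ?pi_gt0 // ltr0n.
have rE : twopii R * (m%:R * (a.+1%:R * d.+1%:R)^-1) = r%:C * 'i%C.
  by rewrite e2 /r !rmorphM fmorphV !rmorphM !rmorph_nat; ring.
rewrite NegzE rmorphN /= -pmulrn mulrN invrN opprK mulrNN mulNr mulrN rE divpow_negi // /kappa /fT0 /=.
have -> : conjc (xi R m a.+1 (- d.+1%:Z)) = xi R m a.+1 d.+1.
  have cop' : coprimez d.+1 a.+1%:Z by move: cop; rewrite NegzE !coprimezE abszN.
  rewrite (@xiE R m a.+1 (- d.+1%:Z) (- zinv a.+1 d.+1)) //; last by rewrite mulrNN; exact: zinvP.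
  by rewrite /xi cop' mulrN om_conj conjcK.
have -> : r `^ s = (2 * pi * m%:R) `^ s * (q a s * q d s).
  rewrite /r /q -powRM // powRM ?invr_ge0 ?mulr_ge0 ?pi_ge0 //.
  by rewrite -[in LHS]powR_inv1 ?mulr_ge0 // -powRrM mulN1r.
by rewrite 2!rmorphM /=; ring.
Qed.

End summands.

(** * Rademacher sums of level one, and vanishing for h > 1 *)

Section level_one.
Local Open Scope fset_scope.
Local Open Scope ring_scope.
Variable R : realType.

Lemma radSum_level1 m x y s S L : 0 < y -> (0 < m)%N -> 1 < s ->
  dsum (fT x y m s) S -> dsum (fT0 m s) L ->
  radSum (- m%:R : R) 1 (x +i* y) s%:C = e1 (- (m%:R * (x +i* y))) + (S - kappa m s * L).
Proof.
move=> y0 m0 s1 hS hL; have s0 : 0 < s by apply: lt_trans s1.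
pose F i := if cop_idx i then radS (- m%:R : R) (idx_mx i) (x +i* y) s%:C else 0.
have hmu (k : int) : e1 ((- m%:R : R) * (1%:Z * k)%:~R)%:C = 1.
  have -> : - m%:R * (1%:Z * k)%:~R = (- (m%:Z * k))%:~R :> R.
    by rewrite mul1r rmorphN rmorphM /= -pmulrn mulNr.
  by rewrite rmorph_int e1_int.
pose G (p : nat * int) := if p.2 is Negz d' then kappa m s * fT0 m s (p.1, d') else 0.
have hG : dsum G (kappa m s * L).
  pose j (p : nat * nat) := (p.1, Negz p.2).
  apply: (proj1 (@dsum_inj R _ _ j G _ _ _)) => [[a d] [a' d'] [-> ->] //|[a [d|d]] //|].
    by move=> /(_ (a, d)); rewrite eqxx.
  by apply: dsum_ext (dsumZ (kappa m s) hL) => -[a d].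
have hF : dsum F (F None + (S - kappa m s * L)).
  apply: dsum_option; apply: dsum_ext (dsumB hS hG) => -[a d]; rewrite /F /=.
  have [cop|ncop] := boolP (coprimez d a.+1%:Z).
    by rewrite /radS radT_lower // radT0_lower //.
  rewrite /fT /= xi_ncop // rmorph0 mul0r sub0r.
  case: d ncop => [d|d] ncop; rewrite /G /= ?oppr0 // /fT0 /=.
  by rewrite xi_ncop ?mul0r ?mulr0 ?oppr0 //; move: ncop; rewrite NegzE !coprimezE abszN.
have F0 : F None = e1 (- (m%:R * (x +i* y))).
  rewrite /F /= /radS /radT /radT0 !mxE /= ?mul0r ?eqxx subr0 /mobius !mxE /=.
  by rewrite mul0r add0r addr0 mul1r divr1 rmorphN rmorph_nat mulNr.
rewrite -F0; apply: dsum_sum.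
apply: (dsum_reindex_on (P := cop_idx) (Q := xpredT)
  (j := fun i => mkcoset 1 (idx_mx_SL2Z i)) _ _ _ _ _ hF) => //.
- by move=> i; rewrite /F => /negbTE ->.
- move=> i ci; split=> //; rewrite /F ci -/(radS _ _ _ _) /=.
  by rewrite radS_repr //; exact: idx_mx_SL2Z.
- by move=> i i' ci ci' /(congr1 val) /=; exact: idx_mx_inj.
move=> X _; have [gS eX] := coset_reprP X.
have [i ci ei] := idx_mx_surj gS.
by exists i => //; apply/val_inj; rewrite /= ei eX.
Qed.

Lemma radQ_level1 m x y (S L : R -> R[i]) l t : 0 < y -> (0 < m)%N ->
  (forall s, 1 < s -> dsum (fT x y m s) (S s)) ->
  (forall s, 1 < s -> dsum (fT0 m s) (L s)) ->
  cv (1 : R)^'+ S l -> cv (1 : R)^'+ (fun s => kappa m s * L s) t ->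
  radQ (- m%:R : R) 1 (x +i* y) = e1 (- (m%:R * (x +i* y))) + (l - t).
Proof.
move=> y0 m0 hS hL Sl Lt; apply: cv_lim.
have h : cv (1 : R)^'+ (fun s => e1 (- (m%:R * (x +i* y))) + (S s - kappa m s * L s))
    (e1 (- (m%:R * (x +i* y))) + (l - t)).
  by apply: cvD; [exact: cv_cst | exact: cvB].
apply: cv_eq h; apply: filterS (near12 R) => s [s1 _].
by rewrite (radSum_level1 y0 m0 s1 (hS s s1) (hL s s1)).
Qed.

(** The order is -g / h with g = n / h coprime to h > 1, so mu h is an integer while e(mu) differs
    from 1. *)
Lemma radQ_eq0 (n h : nat) x y : (0 < n)%N -> (h %| n)%N -> exact_divisor n h -> h != 1%N ->
  0 < y -> radQ (- (n%:R / h%:R ^+ 2) : R) h (x +i* y) = 0.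
Proof.
move=> n0 hn /andP[_ cop] h1 y0; have h0 : (0 < h)%N := dvdn_gt0 n0 hn.
have hR : h%:R != 0 :> R by rewrite pnatr_eq0 -lt0n.
pose g := (n %/ h)%N; have nE : n = (g * h)%N by rewrite divnK.
have muE : - (n%:R / h%:R ^+ 2) = - g%:R / h%:R :> R.
  rewrite nE natrM; move: (g%:R : R) => u; by field.
rewrite muE; apply: cv_lim; apply: cv_eq (cv_cst 0); apply: nearW => s; apply/esym.
apply: radSum_eq0 => // [k|].
  have -> : - g%:R / h%:R * (h%:Z * k)%:~R = (- (g%:Z * k))%:~R :> R.
    by rewrite rmorphN !rmorphM /= -!pmulrn mulrA divfK // mulNr.
  by rewrite rmorph_int e1_int.
have -> : - g%:R / h%:R = (- g%:Z)%:~R / h%:R :> R by rewrite rmorphN /= -pmulrn.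
rewrite -om_real om_conj -[X in _ != X](rmorph1 (@conjc R)) (inj_eq (can_inj (@conjcK R))).
rewrite (@om_mod R h g (g %% h)%N) //; last by rewrite -modz_nat modz_mod.
apply: om_neq1; rewrite ltn_mod h0 andbT lt0n; apply: contra h1 => hg.
by move: cop; rewrite -/g /coprime (gcdn_idPl hg).
Qed.

End level_one.

Theorem theorem5p5p6 (R : realType) (n : nat) (n_sqfree : squarefree n)
    (z : complex R) (z_upper : 0 < complex.Im z) :
  n%:R * hecke n (radQ (-1) 1) z =
  \sum_(h <- divisors n | exact_divisor n h) radQ (- (n%:R / h%:R ^+ 2)) h z.
Proof.
have [n0 _] := n_sqfree; case: z z_upper => x y /= y0.
have -> : \sum_(h <- divisors n | exact_divisor n h) radQ (- (n%:R / h%:R ^+ 2)) h (x +i* y)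
    = radQ (- n%:R : R) 1 (x +i* y).
  rewrite big_mkcond (bigD1_seq 1%N) ?divisors_uniq -?dvdn_divisors //=.
  rewrite /exact_divisor dvd1n coprime1n /= expr1n divr1 big1_seq ?addr0 // => h /andP[h1].
  by rewrite -dvdn_divisors // => hn; case: ifP => // hex; exact: radQ_eq0.
rewrite /hecke mulrA divff ?pnatr_eq0 -?lt0n // mul1r.
rewrite -(big_hecke_pairs n (fun k => radQ (- 1%:R : R) 1 (((n %/ k.1)%:R * (x +i* y) + k.2%:R) / k.1%:R))).
have [K hK] := T0_limit R.
have [rho1 h1] := rsum_series R (ltn0Sn 0); have [rhon hn] := rsum_series R n0.
have hL m s : 1 < s -> dsum (fT0 m s) (summability.sum (fT0 m s : _ -> R[i]^o)).
  by move=> s1; have [l hl] := dsum_exists (@asum_fT0 R m s s1); rewrite (dsum_sum hl).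
pose S k s := summability.sum (fT (hx n x k) (hy n y k) 1 s : _ -> R[i]^o).
have hS k s : k \in hecke_pairs n -> 1 < s -> dsum (fT (hx n x k) (hy n y k) 1 s) (S k s).
  move=> kn s1; have [l hl] := dsum_exists (asum_fT (hx n x k) (hy_gt0 n0 kn y0) (ltn0Sn 0) s1).
  by rewrite /S (dsum_sum hl).
have hl k : exists l, k \in hecke_pairs n -> cv (1 : R)^'+ (S k) l.
  have [kn|kn] := boolP (k \in hecke_pairs n); last by exists 0.
  have [l hl] := T_limit (hy_gt0 n0 kn y0) (ltn0Sn 0) (fun s => @hS k s kn).
  by exists l.
have [l {}hl] := choice hl.
pose t1 := K * (1%:R * (rho1 + conjc rho1)); pose tn := K * (n%:R * (rhon + conjc rhon)).
have t1E := hK 1%N rho1 _ (ltn0Sn 0) h1 (hL 1%N).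
have tnE := hK n rhon _ n0 hn (hL n).
have LHSE k : k \in hecke_pairs n ->
    radQ (- 1%:R : R) 1 (((n %/ k.1)%:R * (x +i* y) + k.2%:R) / k.1%:R) =
    e1 (- (hx n x k +i* hy n y k)) + (l k - t1).
  move=> kn; rewrite hecke_point.
  have := @radQ_level1 R 1 (hx n x k) (hy n y k) (S k) _ (l k) t1 (hy_gt0 n0 kn y0) (ltn0Sn 0)
    (fun s => @hS k s kn) (hL 1%N) (hl k kn) t1E.
  by rewrite mul1r.
rewrite (eq_big_seq _ LHSE) big_split /= sumrB e1_hecke //.
(* There are sigma(n) pairs, and n rho_n = sigma(n) rho_1; conjugation gives the same for the other
   half of the residue. *)
have tn_t1 : tn = \sum_(k <- hecke_pairs n) t1.
  rewrite big_hecke_pairs; under eq_bigr => d _ do rewrite sumr_const card_ord.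
  have := rsum_hecke n0 h1 hn => e; rewrite sumrMnr /tn mulrDr.
  have ec : n%:R * conjc rhon = (\sum_(d <- divisors n) d)%:R * conjc rho1.
    by have := congr1 (@conjc R) e; rewrite 2!rmorphM 2!rmorph_nat.
  by rewrite e ec /t1 -mulrDr mul1r mulr_natl mulrnAr.
rewrite -tn_t1; apply/esym.
apply: (@radQ_level1 R n x y (fun s => \sum_(k <- hecke_pairs n) S k s) _ _ _ y0 n0 _ (hL n) _ tnE).
  by move=> s s1; apply: fT_hecke => // k kn; exact: hS.
(* [cv_sum] asks for convergence at every index, so [S] and [l] are replaced by 0 off the list. *)
pose S' k := if k \in hecke_pairs n then S k else fun _ => 0.
pose l' k := if k \in hecke_pairs n then l k else 0.
have h' k : cv (1 : R)^'+ (S' k) (l' k).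
  by rewrite /S' /l'; case: ifP => [/hl //|_]; exact: cv_cst.
have -> : \sum_(k <- hecke_pairs n) l k = \sum_(k <- hecke_pairs n) l' k.
  by apply: eq_big_seq => k; rewrite /l' => ->.
have hs : cv (1 : R)^'+ (fun s => \sum_(k <- hecke_pairs n) S' k s) (\sum_(k <- hecke_pairs n) l' k).
  exact: cv_sum.
apply: cv_eq hs; apply: nearW => s; apply: eq_big_seq => k kn; by rewrite /S' kn.
Qed.
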